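(* Let $p$ be a prime, let $K$ be a finite extension of $\mathbb{Q}_p$, and let $\phi\in K(z)$ be a rational map of degree at least $2$ such that $\infty\in F_{\mathbb{C}_p}(\phi)$. Then the following are equivalent: (1) $\phi$ is subhyperbolic, i.e. each critical point of $\phi$ lying in $J_{\mathbb{C}_p}(\phi)$ is eventually periodic; (2) for every finite extension $L$ of $K$, the map $\phi$ is expanding in $J_{\mathbb{C}_p}(\phi)\cap L$ with respect to an admissible metric.
   Context: $\mathbb{C}_p$ denotes the completion of an algebraic closure of $\mathbb{Q}_p$ with its non-archimedean absolute value $|\cdot|$, and $K$ carries the restricted absolute value. For a rational map $\phi\in K(z)$ of degree at least $2$ and a field extension $L$ of $K$ (inside $\mathbb{C}_p$), the $L$-Fatou set $F_L(\phi)$ is the set of points of $\mathbb{P}^1_L$ having a neighborhood in $\mathbb{P}^1_L$ on which the family of iterates $\{\phi^n\}_{n\ge1}$ is equicontinuous with respect to the spherical metric; the $L$-Julia set is $J_L(\phi)=\mathbb{P}^1_L\setminus F_L(\phi)$. For a finite extension $L$ of $K$, $\nu_L$ denotes the normalized Haar measure on $L$. Admissible function: let $L$ be a finite extension of $K$. A continuous extended-real-valued function $\rho=\rho_L$ defined on some neighborhood $V\subset\mathbb{C}_p$ of $J_{\mathbb{C}_p}(\phi)\cap L$ is admissible if (i) there is $C>0$ with $\rho(V)\subset[C,+\infty]$; (ii) $\rho$ (possibly) blows up only at finitely many points $z_1,\dots,z_\ell\in J_{\mathbb{C}_p}(\phi)\cap L$, called exceptional points; and (iii) there exist $B>0$ and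 $0<\beta<1$ with $\rho(z)\le\sum_{j=1}^{\ell}B/|z-z_j|^{\beta}$. The admissible metric induced by $\rho_L$ is $\rho_L(z)\,d\nu_L(z)$ on $V\cap L$. Expanding: $\phi$ is expanding in $J_{\mathbb{C}_p}(\phi)\cap L$ with respect to the admissible metric $\rho_L\,d\nu_L$ if there exists $\lambda>1$ such that for every $z\in J_L(\phi)$ for which neither $z$ nor $\phi(z)$ is an exceptional point of $\rho_L$, one has $\rho_L(\phi(z))\,|\phi'(z)|\ge\lambda\,\rho_L(z)$. *)

(* Defs.v *)
From HB Require Import structures.
From mathcomp Require Import all_boot all_order all_algebra.
From mathcomp Require Import all_classical all_reals all_analysis.
Set Implicit Arguments. Unset Strict Implicit. Unset Printing Implicit Defensive.
Import Order.TTheory GRing.Theory Num.Theory.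
Local Open Scope classical_set_scope.
Local Open Scope ring_scope.

Section PadicDynamics.
Variables (R : realType) (C : closedFieldType) (absv : C -> R).

Definition Qp_in : set C :=
  [set x | forall e : R, 0 < e -> exists q : rat, absv (x - ratr q) < e].

Definition poly_over (S : set C) (q : {poly C}) : Prop := forall i, S q`_i.

Definition algebraic_over (S : set C) (y : C) : Prop :=
  exists q : {poly C}, [/\ q != 0, poly_over S q & root q y].

(* absv is a non-archimedean absolute value on C, extending the p-adic
   absolute value |n| = p^(-v_p(n)) on the integers, C is complete, and
   the elements algebraic over Q_p (an algebraic closure of Q_p) are dense.
   Together with C being algebraically closed this characterizes C_p up to
   isometric isomorphism. *)
Definition is_Cp (p : nat) : Prop :=
  [/\ [/\ (forall x, absv x = 0 <-> x = 0),
      (forall x y, absv (x * y) = absv x * absv y) &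
      (forall x y, absv (x + y) <= Num.max (absv x) (absv y))],
      (forall n : nat, (0 < n)%N -> absv n%:R = ((p%:R : R) ^+ (logn p n))^-1),
      (forall u : nat -> C,
          (forall e : R, 0 < e -> exists N, forall m n, (N <= m)%N -> (N <= n)%N ->
              absv (u m - u n) < e) ->
          exists l, forall e : R, 0 < e -> exists N, forall n, (N <= n)%N ->
              absv (u n - l) < e)
    & (forall x (e : R), 0 < e -> exists y, algebraic_over Qp_in y /\ absv (x - y) < e)].

Definition is_subfield (L : set C) : Prop :=
  [/\ L 0, L 1, (forall x y, L x -> L y -> L (x - y)),
      (forall x y, L x -> L y -> L (x * y)) & (forall x, L x -> L x^-1)].

Definition finite_ext_Qp (L : set C) : Prop :=
  [/\ is_subfield L, Qp_in `<=` L &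
      exists s : seq C, (forall b, b \in s -> L b) /\
        forall x, L x -> exists c : C ^nat, (forall i, Qp_in (c i)) /\
           x = \sum_(i < size s) c i * s`_i].

(* P^1(C) = option C, with None = infinity *)
Definition P1_of (L : set C) : set (option C) :=
  [set x | match x with Some z => L z | None => True end].

Definition chord (x y : option C) : R :=
  match x, y with
  | Some a, Some b => absv (a - b) / (Num.max 1 (absv a) * Num.max 1 (absv b))
  | Some a, None => 1 / Num.max 1 (absv a)
  | None, Some b => 1 / Num.max 1 (absv b)
  | None, None => 0
  end.

Definition is_ratmap (K : set C) (P Q : {poly C}) : Prop :=
  [/\ coprimep P Q, poly_over K P & poly_over K Q].

Definition rdeg (P Q : {poly C}) : nat := (maxn (size P) (size Q)).-1.

Definition rat_eval (P Q : {poly C}) (x : option C) : option C :=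
  match x with
  | Some z => if Q.[z] != 0 then Some (P.[z] / Q.[z]) else None
  | None => if (size Q < size P)%N then None
            else if (size P < size Q)%N then Some 0
            else Some (lead_coef P / lead_coef Q)
  end.

Definition rat_deriv (P Q : {poly C}) (z : C) : C :=
  (P^`() * Q - P * Q^`()).[z] / (Q.[z] ^+ 2).

Definition equicont_iter (P Q : {poly C}) (U : set (option C)) : Prop :=
  forall x, U x -> forall e : R, 0 < e -> exists2 d : R, 0 < d &
    forall y, U y -> chord x y < d ->
      forall n, (0 < n)%N -> chord (iter n (rat_eval P Q) x) (iter n (rat_eval P Q) y) < e.

Definition Fatou (P Q : {poly C}) (L : set C) : set (option C) :=
  [set x | P1_of L x /\ exists2 r : R, 0 < r &
       equicont_iter P Q (P1_of L `&` [set y | chord x y < r])].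

Definition Julia (P Q : {poly C}) (L : set C) : set (option C) :=
  P1_of L `\` Fatou P Q L.

(* reversed polynomial w^d p(1/w) *)
Definition revd (d : nat) (p : {poly C}) : {poly C} := \poly_(i < d.+1) p`_(d - i).

(* critical point of P/Q at finite c: derivative in the chart z (if the value
   is finite) or in the chart 1/z (if the value is infinity) vanishes *)
Definition crit_fin (P Q : {poly C}) (c : C) : bool :=
  if Q.[c] != 0 then (P^`() * Q - P * Q^`()).[c] == 0
  else (Q^`() * P - Q * P^`()).[c] == 0.

Definition critical (P Q : {poly C}) (x : option C) : Prop :=
  match x with
  | Some c => crit_fin P Q c
  | None => crit_fin (revd (rdeg P Q) P) (revd (rdeg P Q) Q) 0
  end.

Definition eventually_periodic (P Q : {poly C}) (x : option C) : Prop :=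
  exists m n, (0 < n)%N /\ iter (m + n) (rat_eval P Q) x = iter m (rat_eval P Q) x.

Definition subhyperbolic (P Q : {poly C}) : Prop :=
  forall c, critical P Q c -> Julia P Q setT c -> eventually_periodic P Q c.

Definition open_in_C (V : set C) : Prop :=
  forall z, V z -> exists2 r : R, 0 < r & forall w, absv (w - z) < r -> V w.

Definition econt_on (V : set C) (rho : C -> \bar R) : Prop :=
  forall z, V z ->
    match rho z with
    | EFin r => forall e : R, 0 < e -> exists2 d : R, 0 < d & forall w, V w ->
                  absv (w - z) < d -> ((r - e)%:E < rho w /\ rho w < (r + e)%:E)%E
    | +oo%E => forall M : R, exists2 d : R, 0 < d & forall w, V w ->
                  absv (w - z) < d -> (M%:E < rho w)%E
    | -oo%E => forall M : R, exists2 d : R, 0 < d & forall w, V w ->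
                  absv (w - z) < d -> (rho w < M%:E)%E
    end.

Definition admissible (P Q : {poly C}) (L : set C) (V : set C)
    (rho : C -> \bar R) (zs : seq C) : Prop :=
  [/\ [/\ open_in_C V,
      (forall z, L z -> Julia P Q setT (Some z) -> V z) &
      econt_on V rho],
      (exists2 c0 : R, 0 < c0 & forall z, V z -> (c0%:E <= rho z)%E),
      (forall zj, zj \in zs -> L zj /\ Julia P Q setT (Some zj)),
      (forall z, V z -> rho z = +oo%E -> z \in zs) &
      (exists B beta : R, [/\ 0 < B, 0 < beta, beta < 1 &
          forall z, V z -> z \notin zs ->
            (rho z <= (\sum_(zj <- zs) B / powR (absv (z - zj)) beta)%:E)%E])].

Definition expanding_admissible (P Q : {poly C}) (L : set C) : Prop :=
  exists (V : set C) (rho : C -> \bar R) (zs : seq C),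
    admissible P Q L V rho zs /\
    exists2 lam : R, 1 < lam &
      forall z w, Julia P Q L (Some z) -> rat_eval P Q (Some z) = Some w ->
        z \notin zs -> w \notin zs ->
        (rho w * (absv (rat_deriv P Q z))%:E >= lam%:E * rho z)%E.

End PadicDynamics.

(* Main.v *)
(* Around a Julia point the iterates carry small discs to discs whose radii, computed by Gauss
   norms, eventually exceed a fixed size; call such points expansive. Conversely an expansive
   point with coordinates in [L] is a Julia point over a ramified extension [L'] of [L]
   containing an element of generic absolute value [r], because the image of a circle of radius
   [r] is again a circle of maximal radius.

   If some Julia critical point is not preperiodic, then one of them, say [c], is a limit of
   expansive points [z <> c] of some finite extension: either the orbit of another critical point
   accumulates at [c], or univalent discs of definite image size around [f c] allow preimages of
   the orbit of [f c] to be found close to [f c], and these are lifted through [c]. Multiplying the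
   expansion inequality along the orbit of [z], up to a time [n] after which the orbit of [c] does
   not meet the exceptional points, gives [rho(f^n z) |(f^n)' z| >= rho z], which is impossible as
   [z] tends to [c] since the left-hand side tends to [0].

   If all Julia critical points are preperiodic, those in [L] have a finite forward orbit [A]. With
   exponents [gam] such that [e_a gam(f a) = gam a], where [e_a] is the local degree, the weight
   equal to [|z - a|^(gam a - 1)] near [a \in A] and to [1] elsewhere is multiplied along orbits
   near [A] by constants that tend to infinity. By compactness of the Julia points of [L], some
   iterate expands the weight by a factor [2], and the minimum of the rescaled pull-backs of the
   weight over one such period is expanded at every step. It is extended to [C_p] by an almost
   nearest point projection, truncated by [sum_j B / |z - z_j|^beta]. *)

Require Import Defs.
From HB Require Import structures.
From mathcomp Require Import all_boot all_order all_algebra.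
From mathcomp Require Import all_classical all_reals all_analysis.
From mathcomp Require Import ring zify.
Set Implicit Arguments. Unset Strict Implicit. Unset Printing Implicit Defensive.
Import Order.TTheory GRing.Theory Num.Theory.
Local Open Scope classical_set_scope.
Local Open Scope ring_scope.

(** * Non-archimedean absolute values and Gauss norms *)

(** Two difficulties are specific to the ultrametric setting. First, expansion is only assumed on
    [J_L], which is a priori smaller than the set of [C_p]-Julia points in [L]: [L] may contain too
    few nearby points to see the failure of equicontinuity. A radius that is an [l]-th root of a
    value of [L], with [l] a prime above the degree, keeps the monomials of the Taylor expansions
    over [L] at distinct absolute values, so nothing cancels on that circle, and one extra point
    [z + u] moves away from [z] as fast as the whole disc grows. Secondly, the derivative of [u ^ e]
    has absolute value [|e| |u| ^ (e - 1)], where [|e| < 1] if [p] divides [e]. The loss along an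
    orbit in [A] stays bounded because the orbit ends in a cycle of expansive points, which contains
    no critical point: only the first [size A] factors can differ from 1. The powers of [m0] come
    from there. The normalization [eta] puts all [gam a] between [eta] and [1/2], so the weights
    tend to infinity at [A] and [beta = 1 - eta] is less than 1. An extra exceptional point [x0]
    makes the upper bound of admissibility hold far from [A], and also if [A] is empty. *)

Definition padic_field (R : realType) (C : closedFieldType) (absv : C -> R)
  (p : nat) : Prop := prime p /\ is_Cp absv p.
Existing Class padic_field.

Lemma exp_small (R : realType) (t e : R) : 0 <= t < 1 -> 0 < e -> exists n, t ^+ n < e.
Proof.
move=> /andP[t0 t1] e0; have h : `|t| < 1 by rewrite ger0_norm.
have /cvgrPdist_lt/(_ _ e0)[n _ /(_ n (leqnn n))] := cvg_expr h.
by rewrite sub0r normrN ger0_norm ?exprn_ge0// => ?; exists n.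
Qed.

Section AbsoluteValue.
Context {R : realType} {C : closedFieldType} {absv : C -> R} {p : nat}.
Context {HC : padic_field absv p}.
Implicit Types (x y z u : C) (q : {poly C}) (r s t : R).

Lemma p_prime : prime p. Proof. by case: HC. Qed.

Lemma abs_eq0P x : absv x = 0 <-> x = 0.
Proof. by case: HC => _ [[]]. Qed.

Lemma absM x y : absv (x * y) = absv x * absv y.
Proof. by case: HC => _ [[]]. Qed.

Lemma absD x y : absv (x + y) <= Num.max (absv x) (absv y).
Proof. by case: HC => _ [[]]. Qed.

Lemma abs_nat n : (0 < n)%N -> absv n%:R = ((p%:R : R) ^+ (logn p n))^-1.
Proof. by case: HC => _ [_ h _ _]; apply: h. Qed.

Lemma abs0 : absv 0 = 0. Proof. exact/abs_eq0P. Qed.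

Lemma abs_eq0 x : (absv x == 0) = (x == 0).
Proof. by apply/eqP/eqP => /abs_eq0P. Qed.

Lemma abs1 : absv 1 = 1.
Proof. by have := @abs_nat 1 isT; rewrite logn1 expr0 invr1. Qed.

(* Every element of an algebraically closed field is a square. *)
Lemma abs_ge0 x : 0 <= absv x.
Proof.
have [y /eqP] := @GRing.solve_monicpoly C 2 (fun i => if i == 0%N then x else 0) isT.
rewrite big_ord_recl big_ord1 /= expr0 mulr1 mul0r addr0 => /eqP <-.
by rewrite expr2 absM sqr_ge0.
Qed.

Lemma abs_gt0 x : (0 < absv x) = (x != 0).
Proof. by rewrite lt_def abs_ge0 andbT abs_eq0. Qed.

Lemma absN x : absv (- x) = absv x.
Proof.
have h : absv (-1) = 1.
  apply/eqP; rewrite -(@eqrXn2 _ 2) ?abs_ge0 ?ler01 //.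
  by rewrite expr2 -absM mulrNN mulr1 abs1 expr1n.
by rewrite -mulN1r absM h mul1r.
Qed.

Lemma absC x y : absv (x - y) = absv (y - x).
Proof. by rewrite -absN opprB. Qed.

Lemma absX x n : absv (x ^+ n) = absv x ^+ n.
Proof. by elim: n => [|n IH]; rewrite ?expr0 ?abs1 // !exprS absM IH. Qed.

Lemma absV x : absv x^-1 = (absv x)^-1.
Proof.
have [->|x0] := eqVneq x 0; first by rewrite !(invr0, abs0).
apply: (mulfI (x := absv x)); first by rewrite abs_eq0.
by rewrite -absM !divff ?abs1 // abs_eq0.
Qed.

Lemma absf_div x y : absv (x / y) = absv x / absv y.
Proof. by rewrite absM absV. Qed.

Lemma absD_le r x y : absv x <= r -> absv y <= r -> absv (x + y) <= r.
Proof. by move=> xr yr; rewrite (le_trans (absD x y))// ge_max xr yr. Qed.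

Lemma absD_lt r x y : absv x < r -> absv y < r -> absv (x + y) < r.
Proof. by move=> xr yr; rewrite (le_lt_trans (absD x y))// gt_max xr yr. Qed.

Lemma absB_le r x y : absv x <= r -> absv y <= r -> absv (x - y) <= r.
Proof. by move=> xr yr; rewrite absD_le// absN. Qed.

Lemma abs_tri_le r x y z : absv (x - y) <= r -> absv (y - z) <= r -> absv (x - z) <= r.
Proof. by move=> h1 h2; rewrite -(subrKA y) absD_le. Qed.

Lemma abs_tri_lt r x y z : absv (x - y) < r -> absv (y - z) < r -> absv (x - z) < r.
Proof. by move=> h1 h2; rewrite -(subrKA y) absD_lt. Qed.

Lemma absDl x y : absv y < absv x -> absv (x + y) = absv x.
Proof.
move=> yx; apply/eqP; rewrite eq_le absD_le ?(ltW yx)//= leNgt; apply/negP => h.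
by have := @absD_lt (absv x) (x + y) (- y) h; rewrite absN addrK ltxx => /(_ yx).
Qed.

Lemma abs_near x y : absv (y - x) < absv x -> absv y = absv x.
Proof. by move=> h; rewrite -[y in LHS](subrK x) addrC absDl. Qed.

Lemma abs_sum_le (I : Type) (l : seq I) (Q : pred I) (F : I -> C) r :
  0 <= r -> (forall i, Q i -> absv (F i) <= r) ->
  absv (\sum_(i <- l | Q i) F i) <= r.
Proof.
move=> r0 h; elim/big_ind : _ => //; first by rewrite abs0.
by move=> x y; exact: absD_le.
Qed.

Lemma abs_sum_lt (I : Type) (l : seq I) (Q : pred I) (F : I -> C) r :
  0 < r -> (forall i, Q i -> absv (F i) < r) ->
  absv (\sum_(i <- l | Q i) F i) < r.
Proof.
move=> r0 h; elim/big_ind : _ => //; first by rewrite abs0.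
by move=> x y; exact: absD_lt.
Qed.

Lemma abs_nat_le1 n : absv n%:R <= 1.
Proof.
case: n => [|n]; first by rewrite abs0 ler01.
rewrite abs_nat// invf_le1 ?exprn_gt0 ?ltr0n ?prime_gt0 ?p_prime//.
by rewrite exprn_ege1// ler1n prime_gt0// p_prime.
Qed.

Lemma abs_nat_gt0 n : (0 < n)%N -> 0 < absv n%:R.
Proof.
by move=> n0; rewrite abs_nat// invr_gt0 exprn_gt0// ltr0n prime_gt0// p_prime.
Qed.

Lemma natC_neq0 n : (0 < n)%N -> (n%:R : C) != 0.
Proof. by move=> /abs_nat_gt0; rewrite abs_gt0. Qed.

(** Differentiating a monomial of degree [i] costs a factor [|i|]; since [i] divides [d!], one
    constant bounds this loss for all degrees up to [d]. *)
Lemma abs_fact i d : (0 < i <= d)%N -> absv (d`!)%:R <= absv i%:R.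
Proof.
move=> id; have : (i %| d`!)%N by rewrite dvdn_fact.
case/dvdnP => k ->; rewrite natrM absM ler_piMl ?abs_ge0//.
exact: abs_nat_le1.
Qed.

Lemma abs_p_inv : absv p%:R = (p%:R : R)^-1.
Proof. by rewrite abs_nat ?prime_gt0 ?p_prime// lognE p_prime prime_gt0 ?p_prime// dvdnn divnn prime_gt0 ?p_prime//= logn1 expr1. Qed.

Lemma abs_p_lt1 : absv p%:R < 1.
Proof. by rewrite abs_p_inv invf_lt1 ?ltr0n ?ltr1n ?prime_gt1 ?prime_gt0 ?p_prime. Qed.

Lemma abs_p_gt0 : 0 < absv p%:R.
Proof. by rewrite abs_nat_gt0// prime_gt0// p_prime. Qed.

Lemma abs_p_exp_small r : 0 < r -> exists k, absv (p%:R ^+ k) < r.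
Proof.
move=> r0; have [|k hk] := @exp_small _ (absv p%:R) r _ r0; first by rewrite abs_ge0 abs_p_lt1.
by exists k; rewrite absX.
Qed.

(** The Gauss norm, a bound for [|q|] on the disc of radius [s]. Equality at a point is derived only
    where one monomial strictly dominates, as in [horner_dominant]. *)
Definition gaussn (s : R) (q : {poly C}) : R :=
  \big[Num.max/0]_(i < size q) (absv q`_i * s ^+ i).

Lemma gaussn_ge0 s q : 0 <= gaussn s q.
Proof. by rewrite /gaussn; elim/big_rec : _ => // i x _ x0; rewrite le_max x0 orbT. Qed.
#[local] Hint Resolve abs_ge0 gaussn_ge0 : core.

Lemma gaussn_ge s q i : absv q`_i * s ^+ i <= gaussn s q.
Proof.
have [iq|iq] := ltnP i (size q); last by rewrite nth_default// abs0 mul0r.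
exact: (@le_bigmax _ _ _ 0 (fun i : 'I_(size q) => absv q`_i * s ^+ i) (Ordinal iq)).
Qed.

Lemma gaussn_le s q r : 0 <= r -> (forall i, (i < size q)%N -> absv q`_i * s ^+ i <= r) ->
  gaussn s q <= r.
Proof. by move=> r0 h; apply: bigmax_le => // i _; apply: h. Qed.

Lemma gaussn_attained s q : 0 <= s -> q != 0 ->
  exists2 i, (i < size q)%N & gaussn s q = absv q`_i * s ^+ i.
Proof.
move=> s0 q0; have sq : (0 < size q)%N by rewrite size_poly_gt0.
have h (i : 'I_(size q)) : xpredT i -> 0 <= absv q`_i * s ^+ i.
  by move=> _; rewrite mulr_ge0 ?exprn_ge0.
by rewrite /gaussn; have [i _ ->] := Order.TotalTheory.eq_bigmax (Ordinal sq) xpredT _ isT h; exists i.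
Qed.

Lemma gaussn0 s : gaussn s 0 = 0.
Proof. by rewrite /gaussn size_poly0 big_ord0. Qed.

Lemma gaussn_gt0 s q : 0 < s -> q != 0 -> 0 < gaussn s q.
Proof.
move=> s0 q0; apply: lt_le_trans (gaussn_ge s q (size q).-1).
by rewrite mulr_gt0 ?exprn_gt0// abs_gt0 -lead_coefE lead_coef_eq0.
Qed.

Lemma gaussnD s q1 q2 : 0 <= s -> gaussn s (q1 + q2) <= Num.max (gaussn s q1) (gaussn s q2).
Proof.
move=> s0; apply: gaussn_le => [|i _]; first by rewrite le_max gaussn_ge0.
rewrite coefD (le_trans (ler_wpM2r _ (absD _ _))) ?exprn_ge0//.
rewrite maxr_pMl ?exprn_ge0//.
by rewrite ge_max !le_max !gaussn_ge orbT.
Qed.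

Lemma gaussnZ s a q : gaussn s (a *: q) = absv a * gaussn s q.
Proof.
have [->|a0] := eqVneq a 0; first by rewrite scale0r gaussn0 abs0 mul0r.
rewrite /gaussn size_scale// [RHS](big_morph _ (id1 := 0) (op1 := Num.max)).
- by apply: eq_bigr => i _; rewrite coefZ absM mulrA.
- by move=> x y; rewrite maxr_pMr.
- by rewrite mulr0.
Qed.

Lemma gaussnN s q : gaussn s (- q) = gaussn s q.
Proof. by rewrite -scaleN1r gaussnZ absN abs1 mul1r. Qed.

Lemma gaussnC s a : gaussn s a%:P = absv a.
Proof.
have [->|a0] := eqVneq a 0; first by rewrite gaussn0 abs0.
apply/eqP; rewrite eq_le; apply/andP; split.
  apply: gaussn_le => // i _; rewrite coefC.
  by case: eqP => [->|_]; rewrite ?expr0 ?mulr1// abs0 mul0r.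
by have := gaussn_ge s a%:P 0; rewrite coefC expr0 mulr1.
Qed.

Lemma gaussnM s q1 q2 : 0 <= s -> gaussn s (q1 * q2) <= gaussn s q1 * gaussn s q2.
Proof.
move=> s0; apply: gaussn_le => [|i _]; first by rewrite mulr_ge0.
rewrite coefM.
have [si0|si0] := eqVneq (s ^+ i) 0; first by rewrite si0 mulr0 mulr_ge0.
have si : 0 < s ^+ i by rewrite lt_def si0 exprn_ge0.
rewrite -ler_pdivlMr//; apply: abs_sum_le => [|j _].
  by rewrite divr_ge0 ?mulr_ge0// ltW.
have ji : (j <= i)%N by rewrite -ltnS.
rewrite ler_pdivlMr//; have -> : s ^+ i = s ^+ j * s ^+ (i - j) by rewrite -exprD subnKC.
rewrite absM mulrACA; by apply: ler_pM (gaussn_ge _ _ _) (gaussn_ge _ _ _); rewrite mulr_ge0 ?exprn_ge0.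
Qed.

Lemma gaussn_horner s q u : absv u <= s -> absv q.[u] <= gaussn s q.
Proof.
move=> us; rewrite horner_coef; apply: abs_sum_le => // i _.
rewrite absM absX (le_trans _ (gaussn_ge s q i))// ler_wpM2l//.
by rewrite lerXn2r// nnegrE// (le_trans _ us).
Qed.

Lemma abs_subX s u v i : absv u <= s -> absv v <= s ->
  absv (u ^+ i.+1 - v ^+ i.+1) <= absv (u - v) * s ^+ i.
Proof.
move=> us vs; have s0 : 0 <= s by rewrite (le_trans _ us).
rewrite subrXX absM ler_wpM2l//; apply: abs_sum_le => [|j _]; first exact: exprn_ge0.
have ji : (j <= i)%N by rewrite -ltnS.
have -> : s ^+ i = s ^+ (i - j) * s ^+ j by rewrite -exprD subnK.
by rewrite absM !absX /=; apply: ler_pM; rewrite ?exprn_ge0 ?lerXn2r ?nnegrE.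
Qed.

(** [u ^ i - v ^ i] is divisible by [u - v], and the cofactor, a sum of monomials of degree [i - 1],
    is bounded by the largest of them, so no factor [i] appears. *)
Lemma gaussn_lip s q u v : 0 < s -> absv u <= s -> absv v <= s ->
  absv (q.[u] - q.[v]) <= gaussn s q / s * absv (u - v).
Proof.
move=> s0 us vs; rewrite !horner_coef -sumrB; apply: abs_sum_le => [|[[|i] /= _] _].
- by rewrite mulr_ge0// divr_ge0// ltW.
- by rewrite !expr0 subrr abs0 mulr_ge0// divr_ge0// ltW.
- rewrite -mulrBr absM (le_trans (ler_wpM2l _ (abs_subX i us vs)))//.
  rewrite mulrCA mulrC ler_wpM2r// ler_pdivlMr// -mulrA -exprSr.
  exact: gaussn_ge.
Qed.

Lemma gaussn_mono s t q : 0 <= s <= t -> gaussn s q <= gaussn t q.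
Proof.
move=> /andP[s0 st]; apply: gaussn_le => // i _; apply: le_trans (gaussn_ge t q i).
by rewrite ler_wpM2l// lerXn2r// nnegrE// (le_trans s0).
Qed.

(** The Schwarz lemma for Gauss norms, coefficient by coefficient: [t ^ i <= t ^ k] for every index
    [i >= k] that occurs. *)
Lemma gaussn_shrink s t q k : 0 <= s -> 0 <= t <= 1 -> (forall i, (i < k)%N -> q`_i = 0) ->
  gaussn (t * s) q <= t ^+ k * gaussn s q.
Proof.
move=> s0 /andP[t0 t1] qk; apply: gaussn_le => [|i _]; first by rewrite mulr_ge0 ?exprn_ge0.
have [ik|ki] := ltnP i k; first by rewrite qk// abs0 mul0r mulr_ge0 ?exprn_ge0.
rewrite exprMn mulrCA ler_pM ?exprn_ge0 ?mulr_ge0 ?exprn_ge0//.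
  by rewrite ler_wiXn2l.
exact: gaussn_ge.
Qed.

Lemma horner_dominant q u (k : nat) : 0 < absv u ->
  (forall i, (i < size q)%N -> i != k -> absv q`_i * absv u ^+ i < absv q`_k * absv u ^+ k) ->
  q`_k != 0 -> absv q.[u] = absv q`_k * absv u ^+ k.
Proof.
move=> u0 h qk; have kq : (k < size q)%N.
  by rewrite ltnNge; apply: contra qk => /(nth_default 0) ->.
have pos : 0 < absv q`_k * absv u ^+ k by rewrite mulr_gt0 ?abs_gt0// exprn_gt0// -abs_gt0.
rewrite horner_coef (bigD1 (Ordinal kq))//= absDl absM absX//.
by apply: abs_sum_lt => // i ik; rewrite absM absX; apply: h.
Qed.

Lemma gaussn_dominant s q (k : nat) : 0 < s ->
  (forall i, (i < size q)%N -> i != k -> absv q`_i * s ^+ i < absv q`_k * s ^+ k) ->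
  gaussn s q = absv q`_k * s ^+ k.
Proof.
move=> s0 h; apply/eqP; rewrite eq_le gaussn_ge andbT gaussn_le//.
  by rewrite mulr_ge0// exprn_ge0// ltW.
by move=> i iq; have [->//|ik] := eqVneq i k; rewrite ltW// h.
Qed.

Lemma gaussn_X_add s a : 0 <= s -> gaussn s ('X + a%:P) <= Num.max (absv a) s.
Proof.
move=> s0; rewrite (le_trans (gaussnD _ _ s0))// gaussnC ge_max !le_max lexx /= andbT.
apply/orP; right; apply: gaussn_le => // i _; rewrite coefX.
by case: eqP => [->|_]; rewrite ?abs1 ?mul1r ?expr1// abs0 mul0r.
Qed.

End AbsoluteValue.
Arguments gaussn {R C} absv s q.
#[export] Hint Extern 0 (is_true (0 <= _ _)%R) => exact: abs_ge0 : core.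
#[export] Hint Extern 0 (is_true (0 <= gaussn _ _ _)%R) => exact: gaussn_ge0 : core.

(** * Rational maps on discs *)

Definition good_map (C : closedFieldType) (P Q : {poly C}) : Prop :=
  coprimep P Q /\ (2 <= rdeg P Q)%N.
Existing Class good_map.

Section RationalMap.
Context {R : realType} {C : closedFieldType} {absv : C -> R} {p : nat}.
Context {HC : padic_field absv p}.
Variables P Q : {poly C}.
Implicit Types (x y z u v : C) (q : {poly C}) (r s t : R).

Lemma absMn x n : absv (x *+ n) = absv x * absv n%:R.
Proof. by rewrite -[x *+ n]mulr_natr absM. Qed.

Definition shiftp q z := q \Po ('X + z%:P).
(** The numerator of [f (z + u) - f z] over the denominator [Q(z) Q(z + u)]. On discs where [|Q|] is
    constant, its coefficients play the part of the Taylor coefficients of the map, while staying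
    polynomial. *)
Definition diffp z := Q.[z] *: shiftp P z - P.[z] *: shiftp Q z.
Definition wronsk := P^`() * Q - P * Q^`().
(** Total on [C], with value 0 at poles by the convention on division. It agrees with [rat_eval] off
    the poles, which Julia orbits never meet when infinity is a Fatou point. *)
Definition ratf z := P.[z] / Q.[z].
Notation df := (rat_deriv P Q).

Lemma shiftp_horner q z u : (shiftp q z).[u] = q.[z + u].
Proof. by rewrite horner_comp !hornerE addrC. Qed.

Lemma size_shiftp q z : size (shiftp q z) = size q.
Proof. by rewrite size_comp_poly2// size_XaddC. Qed.

Lemma deriv_shiftp q z : (shiftp q z)^`() = shiftp q^`() z.
Proof. by rewrite /shiftp deriv_comp derivD derivX derivC addr0 mulr1. Qed.

Lemma shiftp_coef0 q z : (shiftp q z)`_0 = q.[z].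
Proof. by rewrite -horner_coef0 shiftp_horner addr0. Qed.

Lemma shiftp_coef1 q z : (shiftp q z)`_1 = q^`().[z].
Proof. by rewrite -(shiftp_coef0 q^`()) -deriv_shiftp coef_deriv mulr1n. Qed.

Lemma diffp_horner z u : (diffp z).[u] = P.[z + u] * Q.[z] - P.[z] * Q.[z + u].
Proof. by rewrite !hornerE !shiftp_horner mulrC. Qed.

Lemma diffp_coef0 z : (diffp z)`_0 = 0.
Proof. by rewrite coefB !coefZ !shiftp_coef0 mulrC subrr. Qed.

Lemma diffp_coef1 z : (diffp z)`_1 = wronsk.[z].
Proof. by rewrite coefB !coefZ !shiftp_coef1 !hornerE mulrC. Qed.

Lemma size_diffp z : (size (diffp z) <= (rdeg P Q).+1)%N.
Proof.
rewrite (leq_trans (size_polyD _ _))// size_polyN.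
rewrite (leq_trans _ (leqSpred _))// geq_max !leq_max.
by rewrite -(size_shiftp P z) -(size_shiftp Q z) !size_scale_leq orbT.
Qed.

(** The quotient rule for [f (z + u) - f z], cleared of denominators: it ties all coefficients of
    [diffp z] to the Wronskian near [z]. *)
Lemma diffp_deriv z :
  (diffp z)^`() * shiftp Q z - diffp z * (shiftp Q z)^`() = Q.[z] *: shiftp wronsk z.
Proof.
have -> : shiftp wronsk z = shiftp P^`() z * shiftp Q z - shiftp P z * shiftp Q^`() z.
  by rewrite /shiftp /wronsk !(rmorphB, rmorphM).
rewrite derivB !derivZ !deriv_shiftp -!mul_polyC /diffp -!mul_polyC.
ring.
Qed.

Lemma ratf_diff z u : Q.[z] != 0 -> Q.[z + u] != 0 ->
  ratf (z + u) - ratf z = (diffp z).[u] / (Q.[z] * Q.[z + u]).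
Proof. by move=> z0 u0; rewrite diffp_horner /ratf; field; rewrite z0 u0. Qed.

Lemma rat_derivE z : df z = wronsk.[z] / Q.[z] ^+ 2.
Proof. by []. Qed.

Context {HPQ : good_map P Q}.

Lemma cPQ : coprimep P Q. Proof. by case: HPQ. Qed.
Lemma dPQ : (2 <= rdeg P Q)%N. Proof. by case: HPQ. Qed.

(** Otherwise [P] would be a constant multiple of [Q], and coprimality would force both to be
    constant. *)
Lemma diffp_neq0 z : Q.[z] != 0 -> diffp z != 0.
Proof.
move=> Qz; apply/eqP => D0.
have E : Q.[z] *: P = P.[z] *: Q.
  have sK q : shiftp (shiftp q z) (- z) = q.
    by rewrite /shiftp -comp_polyA comp_polyD comp_polyX comp_polyC polyCN subrK comp_polyXr.
  have := congr1 (fun q => shiftp q (- z)) D0.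
  rewrite {1}/shiftp comp_polyB !comp_polyZ -!/(shiftp (shiftp _ _) _) !sK.
  by rewrite /shiftp comp_poly0 => /eqP; rewrite subr_eq0 => /eqP.
have QP : Q %| P by rewrite -(dvdpZr _ _ Qz) E -mul_polyC dvdp_mull.
have sQ : size Q = 1%N.
  have : coprimep Q Q by rewrite (coprimep_dvdr QP) ?cPQ.
  by rewrite coprimepp => /eqP.
have sP : (size P <= 1)%N.
  by rewrite -(size_scale _ Qz) E (leq_trans (size_scale_leq _ _)) ?sQ.
have := dPQ; rewrite /rdeg sQ (maxn_idPr _)//.
Qed.

Lemma deriv_eq0_size (q : {poly C}) : q^`() = 0 -> (size q <= 1)%N.
Proof.
move=> q0; rewrite leqNgt; apply/negP => s1.
have := congr1 (fun q : {poly C} => q`_(size q).-2) q0.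
have := congr1 (fun r : {poly C} => r`_(size q).-2) q0.
have sq : (size q).-2.+1 = (size q).-1 by case: (size q) s1 => [|[]].
rewrite coef_deriv coef0 sq -lead_coefE -mulr_natr => /eqP.
rewrite mulf_eq0 lead_coef_eq0 (negPf (natC_neq0 _)) ?orbF => [/eqP q00|].
  by rewrite q00 size_poly0 in s1.
by case: (size q) s1 => [|[]].
Qed.

(** If [P' Q = P Q'], coprimality gives [P | P'] and [Q | Q']; in characteristic zero a polynomial
    that divides its derivative is constant. *)
Lemma wronsk_neq0 : wronsk != 0.
Proof.
apply/eqP => /eqP; rewrite subr_eq0 => /eqP E.
have dvd_deriv (q : {poly C}) : q %| q^`() -> (size q <= 1)%N.
  have [->|q0] := eqVneq q 0; first by rewrite size_poly0.
  move=> /dvdp_leq; have := lt_size_deriv q0.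
  case: (eqVneq q^`() 0) => [/deriv_eq0_size//|_].
  by rewrite ltnNge => /negP h /(_ isT).
have sP : (size P <= 1)%N.
  by apply: dvd_deriv; rewrite -(Gauss_dvdpl _ cPQ) E dvdp_mulr.
have sQ : (size Q <= 1)%N.
  apply: dvd_deriv; have cQP : coprimep Q P by rewrite coprimep_sym cPQ.
  by rewrite -(Gauss_dvdpr _ cQP) -E dvdp_mull.
by have := dPQ; rewrite /rdeg; move: sP sQ; case: (size P) => [|[]]//; case: (size Q) => [|[]].
Qed.

(* Constants for the region [|z| <= M], [|Q z| >= q]: [B] bounds the coefficients of [P] and [Q],
   [L] is a Lipschitz constant of the map, discs of radius [d] stay in the region, and [k] is
   the radius of linearity relative to the distance to the critical points. *)
Record region := Region {
  regM : R; regq : R; regB : R; regL : R; regd : R; regk : R;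
  _ : [/\ 1 <= regM, 0 < regq & 1 <= regB];
  _ : gaussn absv regM P <= regB /\ gaussn absv regM Q <= regB;
  _ : [/\ 1 <= regL, regB ^+ 2 <= regL * regq ^+ 2, 0 < regd & regd <= 1];
  _ : regd * regB <= regq / 2 /\ regL * regd <= 1;
  _ : 0 < regk /\ 2 * regk <= absv ((rdeg P Q)`!)%:R ^+ 2 * regd }.

Lemma region_exists M (q0 : R) : 1 <= M -> 0 < q0 ->
  exists G : region, regM G = M /\ regq G = q0.
Proof.
move=> M1 q00.
pose B := Num.max 1 (Num.max (gaussn absv M P) (gaussn absv M Q)).
pose L := Num.max 1 (B ^+ 2 / q0 ^+ 2).
pose d := Num.min 1 (Num.min (q0 / 2 / B) L^-1).
have B1 : 1 <= B by rewrite le_max lexx.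
have B0 : 0 < B by exact: lt_le_trans B1.
have L1 : 1 <= L by rewrite le_max lexx.
have L0 : 0 < L by exact: lt_le_trans L1.
have d0 : 0 < d by rewrite !lt_min ltr01 divr_gt0 ?divr_gt0 ?invr_gt0.
have m0 : 0 < absv ((rdeg P Q)`!)%:R by rewrite abs_nat_gt0// fact_gt0.
unshelve eexists (@Region M q0 B L d (absv ((rdeg P Q)`!)%:R ^+ 2 * d / 2) _ _ _ _ _); split => //.
- by rewrite !le_max lexx !orbT.
- by rewrite !le_max lexx !orbT.
- by rewrite -ler_pdivrMr ?exprn_gt0// le_max lexx orbT.
- by rewrite ge_min lexx.
- by rewrite -ler_pdivlMr// !ge_min lexx orbT.
- by rewrite mulrC -ler_pdivlMr// div1r !ge_min lexx !orbT.
- by rewrite !mulr_gt0 ?exprn_gt0// invr_gt0.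
- by rewrite mulrC divfK// pnatr_eq0.
Qed.

Section Region.
Variable G : region.
Notation M := (regM G). Notation q0 := (regq G). Notation B := (regB G).
Notation L := (regL G). Notation d := (regd G). Notation k := (regk G).

Definition inG z := absv z <= M /\ q0 <= absv Q.[z].

Lemma regM1 : 1 <= M. Proof. by case: G => ? ? ? ? ? ? [? ? ?] ? ? ? ?. Qed.
Lemma regq0 : 0 < q0. Proof. by case: G => ? ? ? ? ? ? [? ? ?] ? ? ? ?. Qed.
Lemma regB1 : 1 <= B. Proof. by case: G => ? ? ? ? ? ? [? ? ?] ? ? ? ?. Qed.
Lemma regPB : gaussn absv M P <= B. Proof. by case: G => ? ? ? ? ? ? ? [? ?] ? ? ?. Qed.
Lemma regQB : gaussn absv M Q <= B. Proof. by case: G => ? ? ? ? ? ? ? [? ?] ? ? ?. Qed.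
Lemma regL1 : 1 <= L. Proof. by case: G => ? ? ? ? ? ? ? ? [? ? ? ?] ? ?. Qed.
Lemma regBL : B ^+ 2 <= L * q0 ^+ 2. Proof. by case: G => ? ? ? ? ? ? ? ? [? ? ? ?] ? ?. Qed.
Lemma regd0 : 0 < d. Proof. by case: G => ? ? ? ? ? ? ? ? [? ? ? ?] ? ?. Qed.
Lemma regd1 : d <= 1. Proof. by case: G => ? ? ? ? ? ? ? ? [? ? ? ?] ? ?. Qed.
Lemma regdB : d * B <= q0 / 2. Proof. by case: G => ? ? ? ? ? ? ? ? ? [? ?] ?. Qed.
Lemma regLd : L * d <= 1. Proof. by case: G => ? ? ? ? ? ? ? ? ? [? ?] ?. Qed.
Lemma regk0 : 0 < k. Proof. by case: G => ? ? ? ? ? ? ? ? ? ? [? ?]. Qed.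
Lemma regkd : 2 * k <= absv ((rdeg P Q)`!)%:R ^+ 2 * d.
Proof. by case: G => ? ? ? ? ? ? ? ? ? ? [? ?]. Qed.

Lemma regM0 : 0 < M. Proof. exact: lt_le_trans regM1. Qed.
Lemma regB0 : 0 < B. Proof. exact: lt_le_trans regB1. Qed.
Lemma regL0 : 0 < L. Proof. exact: lt_le_trans regL1. Qed.
Hint Resolve regM0 regB0 regL0 regd0 regq0 regk0 : core.

Lemma inG_Q z : inG z -> Q.[z] != 0.
Proof. by move=> [_ h]; rewrite -(abs_gt0 (absv := absv)); exact: lt_le_trans h. Qed.

Lemma gaussn_comp_shift q z : absv z <= M -> gaussn absv 1 (shiftp q z) <= gaussn absv M q.
Proof.
move=> zM; rewrite /shiftp comp_polyE.
have X1 i : gaussn absv 1 (('X + z%:P) ^+ i) <= M ^+ i.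
  elim: i => [|i IH]; first by rewrite !expr0 gaussnC abs1.
  rewrite !exprS (le_trans (gaussnM _ _ ler01))// ler_pM//.
  by rewrite (le_trans (gaussn_X_add _ ler01))// ge_max zM regM1.
elim/big_ind : _ => [|x y xM yM|i _]; first by rewrite gaussn0.
  by rewrite (le_trans (gaussnD _ _ ler01))// ge_max xM.
by rewrite gaussnZ (le_trans _ (gaussn_ge M q i))// ler_wpM2l.
Qed.

Lemma gaussn_shiftQ z : absv z <= M -> gaussn absv 1 (shiftp Q z) <= B.
Proof. by move=> zM; rewrite (le_trans (gaussn_comp_shift _ zM)) ?regQB. Qed.

Lemma gaussn_shiftP z : absv z <= M -> gaussn absv 1 (shiftp P z) <= B.
Proof. by move=> zM; rewrite (le_trans (gaussn_comp_shift _ zM)) ?regPB. Qed.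

Lemma Q_lip z u v : inG z -> absv u <= 1 -> absv v <= 1 ->
  absv (Q.[z + u] - Q.[z + v]) <= B * absv (u - v).
Proof.
move=> [zM _] u1 v1; rewrite -!shiftp_horner.
rewrite (le_trans (gaussn_lip _ ltr01 u1 v1))// divr1 ler_wpM2r//.
exact: gaussn_shiftQ.
Qed.

Lemma Q_near z u : inG z -> absv u <= d -> absv (Q.[z + u] - Q.[z]) <= absv Q.[z] / 2.
Proof.
move=> zG ud; have u1 : absv u <= 1 by rewrite (le_trans ud) ?regd1.
have := @Q_lip z u 0 zG u1; rewrite abs0 ler01 addr0 subr0 => /(_ isT) h.
rewrite (le_trans h)// mulrC (le_trans (ler_wpM2r _ ud)) ?(ltW regB0)//.
by rewrite (le_trans regdB)// ler_pM2r ?invr_gt0//; case: zG.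
Qed.

Lemma Q_abs_near z u : inG z -> absv u <= d -> absv Q.[z + u] = absv Q.[z].
Proof.
move=> zG ud; apply: abs_near; rewrite (le_lt_trans (Q_near zG ud))//.
by rewrite gtr_pMr ?invf_lt1 ?ltr1n// abs_gt0 inG_Q.
Qed.

Lemma inG_near z u : inG z -> absv u <= d -> inG (z + u).
Proof.
move=> zG ud; split; last by rewrite Q_abs_near//; case: zG.
apply: absD_le; first by case: zG.
by rewrite (le_trans ud)// (le_trans regd1) ?regM1.
Qed.

Lemma Q_near_neq0 z u : inG z -> absv u <= d -> Q.[z + u] != 0.
Proof. by move=> zG ud; apply: inG_Q; exact: inG_near. Qed.

(* The radius of the image of the disc of radius [s] around [z]. *)
Definition psi z s := gaussn absv s (diffp z) / absv Q.[z] ^+ 2.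

Lemma psi_ge0 z s : 0 <= psi z s.
Proof. by rewrite divr_ge0 ?exprn_ge0. Qed.

Lemma psi_gt0 z s : inG z -> 0 < s -> 0 < psi z s.
Proof.
move=> zG s0; rewrite divr_gt0 ?exprn_gt0 ?abs_gt0 ?inG_Q//.
by rewrite gaussn_gt0// diffp_neq0// inG_Q.
Qed.

Lemma psi_mono z s t : 0 <= s <= t -> psi z s <= psi z t.
Proof. by move=> st; rewrite ler_wpM2r ?invr_ge0 ?exprn_ge0// gaussn_mono. Qed.

Lemma gaussn_diffp1 z : inG z -> gaussn absv 1 (diffp z) <= B ^+ 2.
Proof.
move=> zG; have [zM zq] := zG.
have PB : absv P.[z] <= B.
  by rewrite (le_trans _ regPB)// gaussn_horner.
have QB : absv Q.[z] <= B.
  by rewrite (le_trans _ regQB)// gaussn_horner.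
rewrite (le_trans (gaussnD _ _ ler01))// gaussnN !gaussnZ expr2 ge_max.
by rewrite !ler_pM ?gaussn_shiftP ?gaussn_shiftQ.
Qed.

Lemma psi_le z s : inG z -> 0 <= s <= 1 -> psi z s <= L * s.
Proof.
move=> zG st; have [zM zq] := zG; have s0 : 0 <= s by case/andP: st.
rewrite ler_pdivrMr ?exprn_gt0 ?abs_gt0 ?inG_Q//.
have := @gaussn_shrink _ _ absv p HC 1 s (diffp z) 1 ler01 st.
rewrite mulr1 expr1 => /(_ _)/le_trans-> => //[[|//] _|]; first exact: diffp_coef0.
rewrite mulrAC [leRHS]mulrC ler_wpM2l// (le_trans (gaussn_diffp1 zG))//.
rewrite (le_trans regBL)// ler_wpM2l ?(ltW regL0)// lerXn2r// ?nnegrE//.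
exact: ltW.
Qed.

Lemma ratf_diff2 z u v : Q.[z] != 0 -> Q.[z + u] != 0 -> Q.[z + v] != 0 ->
  ratf (z + u) - ratf (z + v) =
  (((diffp z).[u] - (diffp z).[v]) * Q.[z + v] - (diffp z).[v] * (Q.[z + u] - Q.[z + v]))
    / (Q.[z] * Q.[z + u] * Q.[z + v]).
Proof.
move=> z0 u0 v0; rewrite !diffp_horner /ratf; field.
by rewrite z0 u0 v0.
Qed.

(** The increment splits into a variation of [diffp z] and a variation of [Q]; the second is
    absorbed because [d * B <= q0 / 2]. *)
Lemma ratf_lip z s u v : inG z -> 0 < s <= d -> absv u <= s -> absv v <= s ->
  absv (ratf (z + u) - ratf (z + v)) <= psi z s / s * absv (u - v).
Proof.
move=> zG /andP[s0 sd] us vs.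
have ud := le_trans us sd; have vd := le_trans vs sd.
have a0 : 0 < absv Q.[z] by rewrite abs_gt0 inG_Q.
rewrite ratf_diff2 ?Q_near_neq0 ?inG_Q// absf_div !absM !Q_abs_near//.
rewrite /psi ler_pdivrMr ?mulr_gt0//.
rewrite (_ : _ * _ * (_ * _ * _) = gaussn absv s (diffp z) / s * absv (u - v) * absv Q.[z]).
  apply: absB_le; rewrite absM.
    by rewrite Q_abs_near// ler_wpM2r// gaussn_lip.
  rewrite mulrAC -mulrA mulrAC -!mulrA; apply: ler_pM => //.
    by rewrite gaussn_horner.
  rewrite (le_trans (@Q_lip _ _ _ zG _ _)) ?(le_trans ud) ?(le_trans vd) ?regd1//.
  rewrite mulrCA mulrC ler_wpM2l// ler_pdivlMr// mulrC.
  rewrite (le_trans (ler_wpM2r _ sd)) ?(ltW regB0)// (le_trans regdB)//.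
  by case: zG => _; apply: le_trans; rewrite ler_piMr ?(ltW regq0)// invf_le1 ?ler1n.
by field; rewrite !gt_eqF.
Qed.

Lemma ratf_near z s u : inG z -> 0 <= s <= d -> absv u <= s ->
  absv (ratf (z + u) - ratf z) <= psi z s.
Proof.
move=> zG /andP[s0 sd] us; have ud := le_trans us sd.
rewrite ratf_diff ?Q_near_neq0 ?inG_Q// absf_div absM Q_abs_near// -expr2.
by rewrite ler_wpM2r ?invr_ge0 ?exprn_ge0// gaussn_horner.
Qed.

Lemma ratf_abs_near z u : inG z -> absv u <= d ->
  absv (ratf (z + u) - ratf z) = absv (diffp z).[u] / absv Q.[z] ^+ 2.
Proof.
by move=> zG ud; rewrite ratf_diff ?Q_near_neq0 ?inG_Q// absf_div absM Q_abs_near// -expr2.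
Qed.

Lemma ratf_contr z u : inG z -> absv u <= d -> absv (ratf (z + u) - ratf z) <= L * absv u.
Proof.
move=> zG ud; rewrite (le_trans (@ratf_near z (absv u) u zG _ _))// ?ud ?andbT//.
by rewrite psi_le// abs_ge0 (le_trans ud)// regd1.
Qed.

(* The roots of the Wronskian are the finite critical points outside the poles. *)
Definition crits : seq C := sval (closed_field_poly_normal wronsk).

Lemma wronskE z : wronsk.[z] = lead_coef wronsk * \prod_(c <- crits) (z - c).
Proof.
rewrite {1}(svalP (closed_field_poly_normal wronsk)) hornerZ horner_prod.
by congr (_ * _); apply: eq_bigr => c _; rewrite !hornerE.
Qed.

Lemma critsP z : (z \in crits) = (wronsk.[z] == 0).
Proof.
rewrite wronskE mulf_eq0 lead_coef_eq0 (negPf wronsk_neq0) /= prodf_seq_eq0.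
apply/idP/hasP => [zc|[c cc]]; first by exists z => //=; rewrite subrr.
by rewrite subr_eq0 => /eqP ->.
Qed.

(** With no root closer than [s], each linear factor [X + (z - c)] has Gauss norm at most [|z - c|],
    its value at the center. *)
Lemma gaussn_shift_wronsk z s : 0 <= s -> (forall c, c \in crits -> s <= absv (z - c)) ->
  gaussn absv s (shiftp wronsk z) <= absv wronsk.[z].
Proof.
move=> s0 h; rewrite wronskE absM.
rewrite /shiftp {1}(svalP (closed_field_poly_normal wronsk)) -/crits.
rewrite comp_polyZ gaussnZ ler_wpM2l//.
rewrite rmorph_prod/=.
elim: crits h => [|c l IH] h; first by rewrite !big_nil gaussnC.
rewrite !big_cons absM (le_trans (gaussnM _ _ s0))// ler_pM//.
  rewrite comp_polyB comp_polyX comp_polyC -addrA -polyCN -polyCD.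
  rewrite (le_trans (gaussn_X_add _ s0))// ge_max lexx.
  by rewrite h// mem_head.
by apply: IH => x xl; rewrite h// in_cons xl orbT.
Qed.

Lemma wronsk_near z u : (forall c, c \in crits -> absv u < absv (z - c)) ->
  absv wronsk.[z + u] = absv wronsk.[z].
Proof.
move=> h; rewrite !wronskE !absM; congr (_ * _).
elim: crits h => [|c l IH] h; first by rewrite !big_nil.
rewrite !big_cons !absM; congr (_ * _).
  by rewrite addrAC [LHS]absDl// h// mem_head.
by apply: IH => x xl; rewrite h// in_cons xl orbT.
Qed.

(** * Linear behaviour of the map away from its critical points *)

Local Notation m0 := (absv ((rdeg P Q)`!)%:R).

Lemma m0_gt0 : 0 < m0.
Proof. by rewrite abs_nat_gt0// fact_gt0. Qed.

Lemma m0_le1 : m0 <= 1. Proof. exact: abs_nat_le1. Qed.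

(* Where the derivative has constant absolute value, the identity [diffp_deriv] bounds all
   Taylor coefficients of the map by the first one, up to the factor [|d!|] coming from
   differentiating monomials. *)
Lemma gaussn_diffp_wronsk z s : inG z -> 0 < s <= d -> s * B < m0 * q0 ->
  (forall c, c \in crits -> s <= absv (z - c)) ->
  m0 * gaussn absv s (diffp z) <= s * absv wronsk.[z].
Proof.
move=> zG /andP[s0 sd] sB zc; have [zM zq] := zG.
have s1 : s <= 1 by rewrite (le_trans sd) ?regd1.
have sW : gaussn absv s (shiftp wronsk z) <= absv wronsk.[z].
  by apply: gaussn_shift_wronsk => //; exact: ltW.
set nu := gaussn absv s (diffp z).
have [nu0|nu0] := eqVneq nu 0; first by rewrite nu0 mulr0 mulr_ge0// ltW.
have nupos : 0 < nu by rewrite lt_def nu0 gaussn_ge0.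
have a0 : 0 < absv Q.[z] by exact: lt_le_trans zq.
have D0 : diffp z != 0 by rewrite diffp_neq0// -abs_gt0.
set nu' := gaussn absv s (diffp z)^`().
have nu'_ge : m0 * nu / s <= nu'.
  have [i isz nui] := gaussn_attained (ltW s0) D0.
  case: i isz nui => [|i] isz nui.
    by move: nu0; rewrite /nu nui diffp_coef0 abs0 mul0r eqxx.
  apply: le_trans (gaussn_ge s (diffp z)^`() i).
  rewrite ler_pdivrMr// -mulrA -exprSr coef_deriv (absMn (diffp z)`_i.+1) mulrAC /nu nui.
  rewrite mulrC ler_wpM2l ?mulr_ge0 ?exprn_ge0 ?(ltW s0)//.
  by apply: abs_fact; rewrite /= -ltnS (leq_trans isz)// size_diffp.
have nu'pos : 0 < nu' by apply: lt_le_trans nu'_ge; rewrite !mulr_gt0 ?invr_gt0 ?m0_gt0.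
have Qz1 := gaussn_shiftQ zM.
(* The last two terms are strictly smaller than [|Q z| nu'], the norm of the left-hand side, so the
   ultrametric inequality leaves only the Wronskian to bound it. *)
have E : Q.[z] *: (diffp z)^`() = Q.[z] *: shiftp wronsk z
   + (diffp z * (shiftp Q z)^`() - (diffp z)^`() * (shiftp Q z - Q.[z]%:P)).
  by rewrite -diffp_deriv -mul_polyC; ring.
have K1 : gaussn absv s (diffp z * (shiftp Q z)^`()) < absv Q.[z] * nu'.
  apply: le_lt_trans (_ : nu * B < _).
    rewrite (le_trans (gaussnM _ _ (ltW s0)))// ler_wpM2l//.
    apply: gaussn_le => [|i _]; first exact: ltW.
    rewrite (le_trans _ Qz1)// (le_trans _ (gaussn_ge 1 _ i.+1))//.
    rewrite expr1n mulr1 coef_deriv (absMn (shiftp Q z)`_i.+1) -[leRHS]mulr1 -mulrA.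
    rewrite ler_wpM2l// mulr_ile1 ?exprn_ge0 ?abs_nat_le1 ?exprn_ile1 ?(ltW s0)//.
  apply: lt_le_trans (_ : q0 * (m0 * nu / s) <= _); last first.
    by apply: ler_pM => //; rewrite ?divr_ge0 ?mulr_ge0 ?ltW// m0_gt0.
  rewrite mulrA ltr_pdivlMr// mulrA mulrC mulrA [ltRHS]mulrC -!mulrA.
  by rewrite mulrCA ltr_pM2l// (mulrC q0).
have K2 : gaussn absv s ((diffp z)^`() * (shiftp Q z - Q.[z]%:P)) < absv Q.[z] * nu'.
  rewrite (le_lt_trans (gaussnM _ _ (ltW s0)))// mulrC ltr_pM2r//.
  apply: le_lt_trans (_ : s * B < _).
    have -> : s = s * 1 by rewrite mulr1.
    have s01 : 0 <= s <= 1 by rewrite ltW.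
    have := @gaussn_shrink _ _ absv p HC 1 s (shiftp Q z - Q.[z]%:P) 1 ler01 s01.
    rewrite expr1 => /(_ _)/le_trans-> => //[[|//] _|].
      by rewrite coefB coefC shiftp_coef0 subrr.
    rewrite mulr1 ler_wpM2l ?(ltW s0)// (le_trans (gaussnD _ _ ler01))//.
    rewrite gaussnN gaussnC ge_max Qz1 (le_trans _ Qz1)//.
    by rewrite -(shiftp_coef0 Q z) -[leLHS]mulr1 -(expr0 1) gaussn_ge.
  rewrite (lt_le_trans sB)// (le_trans _ zq)// ler_piMl ?m0_le1//.
  exact: ltW.
have : absv Q.[z] * nu' <= absv Q.[z] * absv wronsk.[z].
  have : absv Q.[z] * nu' <= Num.max (absv Q.[z] * gaussn absv s (shiftp wronsk z))
      (Num.max (gaussn absv s (diffp z * (shiftp Q z)^`()))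
               (gaussn absv s ((diffp z)^`() * (shiftp Q z - Q.[z]%:P)))).
    rewrite -gaussnZ -gaussnZ E (le_trans (gaussnD _ _ (ltW s0)))//.
    rewrite ge_max !le_max lexx /=.
    have := gaussnD (HC := HC) (diffp z * (shiftp Q z)^`())
      (- ((diffp z)^`() * (shiftp Q z - Q.[z]%:P))) (ltW s0).
    by rewrite gaussnN le_max => /orP[->|->]; rewrite !orbT.
  rewrite !le_max => /orP[h|/orP[]]; last 2 first.
  - by rewrite leNgt K1.
  - by rewrite leNgt K2.
  - by rewrite (le_trans h)// ler_wpM2l.
rewrite ler_pM2l// => h; rewrite -ler_pdivrMl// (le_trans _ h)// (le_trans _ nu'_ge)//.
by rewrite mulrC.
Qed.

Lemma regk_le_d : k <= d.
Proof.
have m1 : m0 ^+ 2 * d <= d by rewrite ler_piMl ?(ltW regd0)// exprn_ile1 ?m0_le1.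
rewrite (le_trans _ (le_trans regkd m1))// ler_peMl ?ler1n//.
exact: ltW.
Qed.

Lemma regk_lt1 : k < 1.
Proof.
have : 2 * k <= 1.
  rewrite (le_trans regkd)// mulr_ile1 ?exprn_ge0 ?(ltW regd0) ?regd1//.
  by rewrite exprn_ile1 ?m0_le1.
by apply: lt_le_trans; rewrite ltr_pMl ?ltr1n.
Qed.

(** On such a disc all distances are multiplied by exactly [|df z|] ([ratf_isom]). Proportionality
    to the distance to the critical points takes the place of a distortion theorem. *)
Definition lin_radius z s := s <= k /\ forall c, c \in crits -> s <= k * absv (z - c).

Lemma lin_radius_le z s t : t <= s -> lin_radius z s -> lin_radius z t.
Proof.
move=> ts [sk h]; split; first exact: le_trans sk.
by move=> c cc; rewrite (le_trans ts)// h.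
Qed.

Lemma lin_radius_wronsk z s : 0 < s -> lin_radius z s -> wronsk.[z] != 0.
Proof.
move=> s0 [_ h]; rewrite -critsP; apply/negP => /h; rewrite subrr abs0 mulr0.
by rewrite leNgt s0.
Qed.

Lemma diffp_lin z s : inG z -> 0 < s -> lin_radius z s ->
  gaussn absv s (diffp z - wronsk.[z] *: 'X) <= s * absv wronsk.[z] / 2.
Proof.
move=> zG s0 [sk sc].
have m00 := m0_gt0; have m01 := m0_le1.
(* On the larger radius [S] the norm is known up to a loss [1 / m0]. The nonlinear part vanishes to
   order 2, so shrinking [S] to [s] gains [(m0 / 2) ^ 2]: one factor [m0 / 2] is the change of
   radius, the other pays for the loss and leaves [1 / 2]. *)
pose S := 2 / m0 * s.
have S0 : 0 < S by rewrite !mulr_gt0 ?invr_gt0.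
have Sk : S <= m0 * d.
  rewrite /S mulrAC ler_pdivrMr// mulrAC -expr2 (le_trans _ regkd)//.
  by rewrite ler_pM2l.
have Sd : S <= d by rewrite (le_trans Sk)// ler_piMl ?(ltW regd0).
have SB : S * B < m0 * q0.
  rewrite (le_lt_trans (ler_wpM2r (ltW regB0) Sk))// -mulrA ltr_pM2l//.
  by rewrite (le_lt_trans regdB)// gtr_pMr// invf_lt1// ltr1n.
have Sc c : c \in crits -> S <= absv (z - c).
  move=> /sc h; rewrite /S (le_trans (ler_wpM2l _ h)) ?divr_ge0 ?(ltW m00)//.
  rewrite mulrA ler_piMl// mulrAC ler_pdivrMr// mul1r (le_trans regkd)//.
  by rewrite -[leRHS]mulr1 expr2 -mulrA ler_wpM2l ?(ltW m00)// mulr_ile1 ?(ltW regd0) ?regd1.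
have SN := @gaussn_diffp_wronsk z S zG _ SB Sc.
rewrite S0 Sd in SN; have {}SN := SN isT.
have SX : m0 * gaussn absv S (diffp z - wronsk.[z] *: 'X) <= S * absv wronsk.[z].
  rewrite mulrC -ler_pdivlMr// (le_trans (gaussnD _ _ (ltW S0)))// ge_max.
  rewrite ler_pdivlMr// mulrC SN/= gaussnN gaussnZ mulrC.
  have X1 : gaussn absv S 'X <= S.
    by have := @gaussn_X_add _ _ absv p HC S 0 (ltW S0); rewrite addr0 abs0 (max_idPr _)// ltW.
  rewrite -mulrA; apply: ler_pM => //.
  by rewrite ler_pdivlMr// ler_piMr.
have tm : 0 <= m0 / 2 <= 1.
  by rewrite divr_ge0//= ler_pdivrMr// mul1r (le_trans m01)// ler1n.
have -> : s = m0 / 2 * S by rewrite /S; field; rewrite gt_eqF.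
have := @gaussn_shrink _ _ absv p HC S (m0 / 2) (diffp z - wronsk.[z] *: 'X) 2 (ltW S0) tm.
move=> /(_ _)/le_trans-> //.
  move=> [|[|//]] _; rewrite coefB coefZ coefX.
    by rewrite diffp_coef0 mulr0 subrr.
  by rewrite diffp_coef1 mulr1 subrr.
rewrite (_ : _ ^+ 2 * _ = m0 / 4 * (m0 * gaussn absv S (diffp z - wronsk.[z] *: 'X))); last first.
  by field.
rewrite (_ : _ * S * _ / 2 = m0 / 4 * (S * absv wronsk.[z])); last by field.
by rewrite ler_wpM2l ?divr_ge0.
Qed.

Lemma ratf_lin z s u v : inG z -> 0 < s -> lin_radius z s -> absv u <= s -> absv v <= s ->
  absv (ratf (z + u) - ratf (z + v) - df z * (u - v)) <= absv (df z) * absv (u - v) / 2.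
Proof.
move=> zG s0 sl us vs; have [sk sc] := sl.
have sd : s <= d by rewrite (le_trans sk) ?regk_le_d.
have ud := le_trans us sd; have vd := le_trans vs sd.
have u1 := le_trans ud regd1; have v1 := le_trans vd regd1.
have z0 := inG_Q zG.
have [uQ vQ] : Q.[z + u] != 0 /\ Q.[z + v] != 0 by rewrite !Q_near_neq0.
have a0 : 0 < absv Q.[z] by rewrite abs_gt0.
pose w := wronsk.[z].
have lin := diffp_lin zG s0 sl.
(* Three errors: the nonlinear part of [diffp z] and two variations of [Q]. Each is at most half of
   the linear term, and in an ultrametric sum the halves do not add up. *)
have E : ratf (z + u) - ratf (z + v) - df z * (u - v) =
  ((((diffp z - w *: 'X).[u] - (diffp z - w *: 'X).[v]) * (Q.[z] * Q.[z + v]))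
   - Q.[z] * (diffp z).[v] * (Q.[z + u] - Q.[z + v])
   - w * (u - v) * Q.[z + v] * (Q.[z + u] - Q.[z])) / (Q.[z] ^+ 2 * Q.[z + u] * Q.[z + v]).
  rewrite ratf_diff2// rat_derivE -/w !(hornerD, hornerN, hornerZ, hornerX). field.
  by rewrite z0 uQ vQ.
rewrite E absf_div (absM _ Q.[z + v]) (absM _ Q.[z + u]) absX !Q_abs_near//.
rewrite rat_derivE absf_div absX -/w.
rewrite ler_pdivrMr ?mulr_gt0 ?exprn_gt0//.
have -> : absv w / absv Q.[z] ^+ 2 * absv (u - v) / 2 *
    (absv Q.[z] ^+ 2 * absv Q.[z] * absv Q.[z])
  = absv w / 2 * absv (u - v) * (absv Q.[z] * absv Q.[z]) by field; rewrite gt_eqF.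
have Bs : B * s <= absv Q.[z] / 2.
  rewrite (le_trans (ler_wpM2l (ltW regB0) sd))// mulrC (le_trans regdB)//.
  by rewrite ler_pM2r ?invr_gt0//; case: zG.
have Nv : absv (diffp z).[v] <= s * absv w.
  rewrite -[diffp z](subrK (w *: 'X)) hornerD hornerZ hornerX absD_le//.
    rewrite (le_trans (gaussn_horner _ vs))// (le_trans lin)// ler_piMr ?mulr_ge0 ?(ltW s0)//.
    by rewrite invf_le1 ?ler1n.
  by rewrite absM mulrC ler_wpM2r.
apply: absB_le; [apply: absB_le|]; rewrite !absM ?Q_abs_near//.
- rewrite ler_wpM2r ?mulr_ge0// (le_trans (gaussn_lip _ s0 us vs))// ler_wpM2r//.
  rewrite ler_pdivrMr// (le_trans lin)// mulrC mulrA -mulrA mulrC.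
  by rewrite [_ / 2 * _]mulrC mulrA.
- rewrite -mulrA [leRHS]mulrCA; apply: ler_pM => //; first by rewrite mulr_ge0.
  rewrite (le_trans (ler_pM _ _ Nv (Q_lip zG u1 v1)))//.
  have -> : s * absv w * (B * absv (u - v)) = absv w * absv (u - v) * (B * s) by ring.
  have -> : absv w / 2 * absv (u - v) * absv Q.[z] = absv w * absv (u - v) * (absv Q.[z] / 2).
    by field.
  by rewrite ler_wpM2l ?mulr_ge0.
- rewrite -mulrA (mulrC _ (absv Q.[z])).
  have -> : absv w / 2 * absv (u - v) * (absv Q.[z] * absv Q.[z])
     = absv w * absv (u - v) * (absv Q.[z] * (absv Q.[z] / 2)) by field.
  rewrite !ler_wpM2l ?mulr_ge0//.
  have := @Q_lip z u 0 zG u1; rewrite abs0 addr0 subr0 => /(_ ler01) h.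
  by rewrite (le_trans h)// (le_trans _ Bs)// ler_wpM2l// ltW.
Qed.

Lemma df_gt0 z s : inG z -> 0 < s -> lin_radius z s -> 0 < absv (df z).
Proof.
move=> zG s0 sl; rewrite rat_derivE absf_div absX divr_gt0 ?exprn_gt0 ?abs_gt0 ?inG_Q//.
exact: lin_radius_wronsk sl.
Qed.

(** The error in [ratf_lin] is strictly smaller than the linear term, so the approximation becomes
    an equality of absolute values. *)
Lemma ratf_isom z s u v : inG z -> 0 < s -> lin_radius z s -> absv u <= s -> absv v <= s ->
  absv (ratf (z + u) - ratf (z + v)) = absv (df z) * absv (u - v).
Proof.
move=> zG s0 sl us vs; have h := ratf_lin zG s0 sl us vs.
have [->|uv] := eqVneq u v; first by rewrite !subrr abs0 mulr0.
have pos : 0 < absv (df z) * absv (u - v).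
  by rewrite mulr_gt0 ?(df_gt0 zG s0 sl)// abs_gt0 subr_eq0.
rewrite -absM; apply: abs_near; rewrite absM (le_lt_trans h)//.
by rewrite gtr_pMr// invf_lt1// ltr1n.
Qed.

Lemma psi_lin z s : inG z -> 0 < s -> lin_radius z s -> psi z s = absv (df z) * s.
Proof.
move=> zG s0 sl; have w0 := lin_radius_wronsk s0 sl.
rewrite /psi rat_derivE absf_div absX mulrAC; congr (_ / _).
have lin := diffp_lin zG s0 sl.
have lt1 : s * absv wronsk.[z] / 2 < s * absv wronsk.[z].
  by rewrite gtr_pMr ?invf_lt1 ?ltr1n// mulr_gt0// abs_gt0.
rewrite mulrC; apply/eqP; rewrite eq_le; apply/andP; split.
  rewrite -[diffp z](subrK (wronsk.[z] *: 'X)) (le_trans (gaussnD _ _ (ltW s0)))//.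
  rewrite ge_max (le_trans lin (ltW lt1))/= gaussnZ mulrC ler_wpM2r//.
  by have := @gaussn_X_add _ _ absv p HC s 0 (ltW s0); rewrite addr0 abs0 (max_idPr _)// ltW.
by rewrite -diffp_coef1 mulrC -[X in _ * X]expr1; exact: gaussn_ge.
Qed.

Lemma df_near z s u : inG z -> 0 < s -> lin_radius z s -> absv u <= s ->
  absv (df (z + u)) = absv (df z).
Proof.
move=> zG s0 [sk sc] us.
have ud : absv u <= d by rewrite (le_trans us)// (le_trans sk) ?regk_le_d.
rewrite !rat_derivE !absf_div !absX Q_abs_near// wronsk_near// => c cc.
rewrite (le_lt_trans us)// (le_lt_trans (sc c cc))// gtr_pMl ?regk_lt1//.
rewrite ltNge; apply/negP => h; have := sc c cc.
by rewrite leNgt (le_lt_trans _ s0)// pmulr_rle0.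
Qed.

End Region.
End RationalMap.
Arguments psi {R C} absv P Q z s.
Arguments region {R C} absv P Q.
Arguments inG {R C absv P Q} G z.
Arguments lin_radius {R C absv P Q} G z s.
#[export] Hint Extern 0 (is_true (0 < regM _)%R) => exact: regM0 : core.
#[export] Hint Extern 0 (is_true (0 < regq _)%R) => exact: regq0 : core.
#[export] Hint Extern 0 (is_true (0 < regB _)%R) => exact: regB0 : core.
#[export] Hint Extern 0 (is_true (0 < regL _)%R) => exact: regL0 : core.
#[export] Hint Extern 0 (is_true (0 < regd _)%R) => exact: regd0 : core.
#[export] Hint Extern 0 (is_true (0 < regk _)%R) => exact: regk0 : core.

(** * Fatou and Julia sets *)

Section Subfield.
Variables (C : closedFieldType) (L : set C).
Hypothesis HL : is_subfield L.
Implicit Types (x y : C) (q : {poly C}).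

Lemma sub0 : L 0. Proof. by case: HL. Qed.
Lemma sub1 : L 1. Proof. by case: HL. Qed.
Lemma subB x y : L x -> L y -> L (x - y). Proof. by case: HL => _ _ h _ _; apply: h. Qed.
Lemma subM x y : L x -> L y -> L (x * y). Proof. by case: HL => _ _ _ h _; apply: h. Qed.
Lemma subV x : L x -> L x^-1. Proof. by case: HL => _ _ _ _ h; apply: h. Qed.
Lemma subN x : L x -> L (- x). Proof. by rewrite -sub0r => /(subB sub0). Qed.
Lemma subD x y : L x -> L y -> L (x + y).
Proof. by move=> Lx Ly; rewrite -[y]opprK; apply: subB => //; exact: subN. Qed.
Lemma sub_div x y : L x -> L y -> L (x / y).
Proof. by move=> Lx Ly; apply: subM => //; exact: subV. Qed.
Lemma subX x n : L x -> L (x ^+ n).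
Proof. by move=> Lx; elim: n => [|n IH]; [exact: sub1|rewrite exprS; exact: subM]. Qed.
Lemma sub_sum (I : Type) (r : seq I) (A : pred I) (F : I -> C) :
  (forall i, A i -> L (F i)) -> L (\sum_(i <- r | A i) F i).
Proof. by move=> h; elim/big_ind : _ => //; [exact: sub0|exact: subD]. Qed.
Lemma sub_nat n : L n%:R.
Proof. by elim: n => [|n IH]; [exact: sub0|rewrite -natr1; apply: subD => //; exact: sub1]. Qed.

Lemma over_horner q x : poly_over L q -> L x -> L q.[x].
Proof. by move=> Lq Lx; rewrite horner_coef; apply: sub_sum => i _; apply: subM => //; exact: subX. Qed.
Lemma overC x : L x -> poly_over L x%:P.
Proof. by move=> Lx i; rewrite coefC; case: eqP => // _; exact: sub0. Qed.
Lemma overX : poly_over L 'X.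
Proof. by move=> i; rewrite coefX; case: eqP => _; [exact: sub1|exact: sub0]. Qed.
Lemma overD q1 q2 : poly_over L q1 -> poly_over L q2 -> poly_over L (q1 + q2).
Proof. by move=> h1 h2 i; rewrite coefD; exact: subD. Qed.
Lemma overB q1 q2 : poly_over L q1 -> poly_over L q2 -> poly_over L (q1 - q2).
Proof. by move=> h1 h2 i; rewrite coefB; exact: subB. Qed.
Lemma overM q1 q2 : poly_over L q1 -> poly_over L q2 -> poly_over L (q1 * q2).
Proof. by move=> h1 h2 i; rewrite coefM; apply: sub_sum => j _; exact: subM. Qed.
Lemma overZ x q : L x -> poly_over L q -> poly_over L (x *: q).
Proof. by move=> h1 h2 i; rewrite coefZ; exact: subM. Qed.
Lemma over_deriv q : poly_over L q -> poly_over L q^`().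
Proof. by move=> h i; rewrite coef_deriv -mulr_natr; apply: subM => //; exact: sub_nat. Qed.
Lemma over_shiftp q x : poly_over L q -> L x -> poly_over L (shiftp q x).
Proof.
move=> Lq Lx; rewrite /shiftp comp_polyE; elim/big_ind : _.
- by move=> i; rewrite coef0; exact: sub0.
- exact: overD.
- move=> i _; apply: overZ => //; elim: (i : nat) => [|n IH].
    by rewrite expr0; apply: overC; exact: sub1.
  by rewrite exprS; apply: overM => //; apply: overD; [exact: overX|exact: overC].
Qed.
Lemma over_diffp P Q x : poly_over L P -> poly_over L Q -> L x -> poly_over L (diffp P Q x).
Proof.
by move=> LP LQ Lx; apply: overB; apply: overZ; do ?[exact: over_horner|exact: over_shiftp].
Qed.
Lemma over_wronsk P Q : poly_over L P -> poly_over L Q -> poly_over L (wronsk P Q).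
Proof.
by move=> LP LQ; apply: overB; apply: overM => //; exact: over_deriv.
Qed.
Lemma sub_ratf P Q x : poly_over L P -> poly_over L Q -> L x -> L (ratf P Q x).
Proof. by move=> LP LQ Lx; apply: sub_div; exact: over_horner. Qed.
Lemma sub_iter_ratf P Q x n : poly_over L P -> poly_over L Q -> L x -> L (iter n (ratf P Q) x).
Proof. by move=> LP LQ Lx; elim: n => //= n; exact: sub_ratf. Qed.
End Subfield.

Lemma poly_over_sub (C : closedFieldType) (K L : set C) (q : {poly C}) :
  K `<=` L -> poly_over K q -> poly_over L q.
Proof. by move=> KL Kq i; exact: KL. Qed.

(** * The chordal metric against the affine one *)

Section Chord.
Context {R : realType} {C : closedFieldType} {absv : C -> R} {p : nat}.
Context {HC : padic_field absv p}.
Implicit Types (a b z : C) (x y : option C) (r s t : R).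
Notation chord := (chord absv).
Notation mx a := (Num.max 1 (absv a)).

Lemma mx_ge1 a : 1 <= mx a. Proof. by rewrite le_max lexx. Qed.
Lemma mx_gt0 a : 0 < mx a. Proof. exact: lt_le_trans (mx_ge1 a). Qed.
Hint Resolve mx_ge1 mx_gt0 : core.

Lemma chord_xx x : chord x x = 0.
Proof. by case: x => [a|]//=; rewrite subrr abs0 mul0r. Qed.

Lemma chord_le a b : chord (Some a) (Some b) <= absv (a - b).
Proof. by rewrite /= ler_pdivrMr ?mulr_gt0// ler_peMr// mulr_ege1. Qed.

Lemma chord_ge (M : R) a b : 1 <= M -> absv a <= M -> absv b <= M ->
  absv (a - b) <= M ^+ 2 * chord (Some a) (Some b).
Proof.
move=> M1 aM bM; rewrite /= mulrA ler_pdivlMr ?mulr_gt0// mulrC ler_wpM2r//.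
by rewrite expr2; apply: ler_pM; rewrite ?(ltW (mx_gt0 _))// ge_max M1.
Qed.

(** If [|b|] exceeds [max 1 |a|], then [|a - b| = |b|] and the chordal distance is exactly
    [1 / max 1 |a|], the same as to infinity. *)
Lemma chord_fin a y : chord (Some a) y < (mx a)^-1 ->
  exists2 b, y = Some b & absv b <= mx a.
Proof.
case: y => [b|] /=; last by rewrite div1r ltxx.
move=> h; exists b => //; rewrite leNgt; apply/negP => ab; move: h.
have a1 : absv a < absv b by rewrite (le_lt_trans _ ab)// le_max lexx orbT.
have b1 : 1 < absv b by rewrite (le_lt_trans _ ab).
rewrite absC absDl ?absN// (max_idPr (ltW b1)) invfM mulrCA divff ?mulr1 ?ltxx//.
by rewrite gt_eqF// (lt_trans _ b1).
Qed.

Lemma chord_fin_near a y r : r <= (mx a)^-1 -> chord (Some a) y < r ->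
  exists2 b, y = Some b & absv (a - b) < mx a ^+ 2 * r.
Proof.
move=> ra h; have [b yb bM] := chord_fin (lt_le_trans h ra).
exists b => //; rewrite (le_lt_trans (chord_ge (mx_ge1 a) _ bM))//.
  by rewrite le_max lexx orbT.
by rewrite ltr_pM2l ?exprn_gt0// -yb.
Qed.

End Chord.
#[export] Hint Extern 0 (is_true (1 <= Num.max 1 _)%R) => exact: mx_ge1 : core.
#[export] Hint Extern 0 (is_true (0 < Num.max 1 _)%R) => exact: mx_gt0 : core.

Section FatouJulia.
Context {R : realType} {C : closedFieldType} {absv : C -> R} {p : nat}.
Context {HC : padic_field absv p}.
Context {P Q : {poly C}} {HPQ : good_map P Q}.
Implicit Types (a b z u v : C) (x y : option C) (r s t e : R).
Notation chord := (chord absv).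
Notation mx a := (Num.max 1 (absv a)).
Notation f := (ratf P Q).
Notation phi := (rat_eval P Q).
Notation Fatou := (Fatou absv P Q).
Notation Julia := (Julia absv P Q).

Lemma rat_evalE z : Q.[z] != 0 -> phi (Some z) = Some (f z).
Proof. by rewrite /= => ->. Qed.

Lemma iter_rat_eval z n : (forall i, (i < n)%N -> Q.[iter i f z] != 0) ->
  iter n phi (Some z) = Some (iter n f z).
Proof.
elim: n => // n IH h; rewrite !iterS IH => [|i ni]; last by rewrite h// ltnS ltnW.
by rewrite rat_evalE// h.
Qed.

Lemma equicont_subset (U V : set (option C)) : V `<=` U ->
  equicont_iter absv P Q U -> equicont_iter absv P Q V.
Proof.
move=> VU UE x /VU Ux e e0; have [d d0 h] := UE x Ux e e0.
by exists d => // y /VU Uy; exact: h.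
Qed.

Lemma Fatou_restrict (L : set C) z : L z -> Fatou setT (Some z) -> Fatou L (Some z).
Proof.
move=> Lz [_ [r r0 h]]; split => //; exists r => //.
apply: equicont_subset h => -[y|] [_ ?]; split => //.
Qed.

(** Equicontinuity on a disc of [C] restricts to its points in [L]. The opposite inclusion is not
    automatic and is replaced by [expansive_Julia]. *)
Lemma Julia_extend (L : set C) z : Julia L (Some z) -> Julia setT (Some z).
Proof.
by move=> [Lz h]; split => // zF; apply: h; exact: Fatou_restrict.
Qed.

Lemma horner_continuous (q : {poly C}) z e : 0 < e ->
  exists2 d : R, 0 < d & forall w, absv (w - z) < d -> absv (q.[w] - q.[z]) < e.
Proof.
move=> e0; pose s := mx z; pose g := gaussn absv s q.
have g1 : 0 < g + 1 by rewrite ltr_wpDl// /g.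
exists (Num.min 1 (s * e / (g + 1))) => [|w].
  by rewrite lt_min ltr01 divr_gt0// mulr_gt0// /s.
rewrite lt_min => /andP[w1 we].
have zs : absv z <= s by rewrite le_max lexx orbT.
have ws : absv w <= s.
  by rewrite -(subrK z w) absD_le// (le_trans (ltW w1))// /s.
rewrite (le_lt_trans (gaussn_lip (absv := absv) _ (mx_gt0 z) ws zs))//.
rewrite (le_lt_trans (_ : _ <= (g + 1) / s * absv (w - z)))//.
  by rewrite ler_wpM2r// ler_wpM2r ?invr_ge0 ?(ltW (mx_gt0 z))// lerDl.
have s0 : 0 < s by exact: mx_gt0.
by rewrite mulrC -ltr_pdivlMr ?divr_gt0// invf_div mulrA (mulrC e).
Qed.

Lemma chord_ball z e : 0 < e -> exists2 r : R, 0 < r &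
  forall y, chord (Some z) y < r -> exists2 b, y = Some b & absv (b - z) < e.
Proof.
move=> e0; pose r := Num.min (mx z)^-1 (e / mx z ^+ 2).
exists r => [|y h]; first by rewrite lt_min invr_gt0 mx_gt0 divr_gt0 ?exprn_gt0.
have rz : r <= (mx z)^-1 by rewrite ge_min lexx.
have [b yb zb] := chord_fin_near (HC := HC) rz h; exists b => //.
by rewrite absC (lt_le_trans zb)// mulrC -ler_pdivlMr ?exprn_gt0// ge_min lexx orbT.
Qed.

Lemma ratf_continuous z e : Q.[z] != 0 -> 0 < e ->
  exists2 d : R, 0 < d & forall w, absv (w - z) < d -> Q.[w] != 0 /\ absv (f w - f z) < e.
Proof.
move=> Qz e0; have a0 : 0 < absv Q.[z] by rewrite abs_gt0.
have P1 : 0 < absv P.[z] + 1 by rewrite ltr_wpDl.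
have [d1 d10 h1] := @horner_continuous P z (e * absv Q.[z]) (mulr_gt0 e0 a0).
have m1 : 0 < Num.min (absv Q.[z]) (e * absv Q.[z] ^+ 2 / (absv P.[z] + 1)).
  by rewrite lt_min a0 divr_gt0 ?mulr_gt0 ?exprn_gt0.
have [d2 d20 h2] := @horner_continuous Q z _ m1.
exists (Num.min d1 d2) => [|w]; first by rewrite lt_min d10.
rewrite lt_min => /andP[/h1 w1 /h2]; rewrite lt_min => /andP[/abs_near w2 w3].
have Qw : Q.[w] != 0 by rewrite -(abs_gt0 (absv := absv)) w2.
split => //.
have -> : f w - f z = ((P.[w] - P.[z]) * Q.[z] - P.[z] * (Q.[w] - Q.[z])) / (Q.[w] * Q.[z]).
  by rewrite /ratf; field; rewrite Qz Qw.
rewrite absf_div absM w2 -expr2 ltr_pdivrMr ?exprn_gt0//.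
rewrite absD_lt ?absN// absM.
  by rewrite expr2 mulrA ltr_pM2r.
rewrite (le_lt_trans (_ : _ <= (absv P.[z] + 1) * absv (Q.[w] - Q.[z])))//.
  by rewrite ler_wpM2r// lerDl.
by rewrite mulrC -ltr_pdivlMr.
Qed.

(* Continuity at poles included, for the chordal metric. *)
Lemma rat_eval_continuous z e : 0 < e ->
  exists2 d : R, 0 < d & forall y, chord (Some z) y < d -> chord (phi (Some z)) (phi y) < e.
Proof.
move=> e0.
suff [d d0 h] : exists2 d : R, 0 < d & forall w, absv (w - z) < d ->
    chord (phi (Some z)) (phi (Some w)) < e.
  have [r r0 hr] := chord_ball z d0.
  by exists r => // y /hr[b -> /h].
have [Qz|Qz] := eqVneq Q.[z] 0; last first.
  have [d d0 h] := ratf_continuous Qz e0; exists d => // w /h[Qw fw].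
  by rewrite !rat_evalE// (le_lt_trans (chord_le _ _))// absC.
have a0 : 0 < absv P.[z].
  rewrite abs_gt0; apply/eqP => Pz.
  have := coprimep_root (cPQ (HPQ := HPQ)) (introT eqP Pz).
  by rewrite Qz eqxx.
have [d1 d10 h1] := @horner_continuous P z (absv P.[z]) a0.
have [d2 d20 h2] := @horner_continuous Q z (e * absv P.[z]) (mulr_gt0 e0 a0).
exists (Num.min d1 d2) => [|w]; first by rewrite lt_min d10.
rewrite lt_min => /andP[/h1/abs_near w1 /h2]; rewrite Qz subr0 => w2.
rewrite /= Qz eqxx /=; case: eqVneq => //= Qw.
rewrite div1r invf_plt ?posrE//; last first.
rewrite lt_max absf_div w1 ltr_pdivlMr ?abs_gt0// mulrC -ltr_pdivlMr ?invr_gt0//.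
by rewrite invrK mulrC w2 orbT.
Qed.

#[global] Arguments Defs.chord : simpl never.

Lemma Fatou_pre z : Fatou setT (phi (Some z)) -> Fatou setT (Some z).
Proof.
move=> [_ [r r0 rE]]; split => //.
have [d d0 hd] := rat_eval_continuous z r0.
have [d1 d10 hd1] := chord_ball z (ltr01 (R := R)).
exists (Num.min d d1) => [|x [_]]; first by rewrite lt_min d0.
rewrite /= lt_min => /andP[/hd zx /hd1[b xb _]] e e0.
have fx y : chord (phi (Some z)) y < r -> (P1_of setT `&` [set y | chord (phi (Some z)) y < r]) y.
  by split => //; case: y H.
have [d2 d20 hd2] := rE _ (fx _ zx) e e0.
(* The family of iterates starts at [n = 1]: that iterate needs the bound [e] itself, and the later
   ones follow from equicontinuity at the image with [d2]. *)
have m0 : 0 < Num.min d2 e by rewrite lt_min d20.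
have [d3 d30 hd3] := rat_eval_continuous b m0.
exists d3 => // y [_ /=]; rewrite lt_min => /andP[/hd zy _].
rewrite xb => /hd3; rewrite lt_min => /andP[xy2 xye] [//|[|n]] _ //.
by rewrite !(iterSr n.+1) -xb; apply: hd2 => //; [exact: fx|rewrite xb].
Qed.

Lemma Fatou_open z : Fatou setT (Some z) ->
  exists2 r : R, 0 < r & forall w, absv (w - z) < r -> Fatou setT (Some w).
Proof.
move=> [_ [r r0 rE]].
have [d d0 hd] := chord_ball z r0.
exists r => // y yz; split => //.
have [d1 d10 hd1] := chord_ball y r0.
exists d1 => //; apply: equicont_subset rE => x [_ /= /hd1[b -> by_]]; split => //.
rewrite /= (le_lt_trans (chord_le _ _))//.
by rewrite (abs_tri_lt (y := y))// absC.
Qed.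

Lemma Fatou_infty_bound : Fatou setT None ->
  exists2 M : R, 1 <= M & forall z, M < absv z -> Fatou setT (Some z).
Proof.
move=> [_ [r r0 rE]]; exists (Num.max 1 r^-1) => [|z]; first by rewrite le_max lexx.
rewrite gt_max => /andP[z1 zr]; split => //.
have z0 : 0 < absv z by exact: lt_trans z1.
have [d d0 hd] := chord_ball z z0.
exists d => //; apply: equicont_subset rE => x [_ /= /hd[b -> bz]]; split => //.
rewrite /= /Defs.chord (abs_near bz) (max_idPr (ltW z1)) div1r invf_plt ?posrE//.
Qed.

(** Poles map to the Fatou point infinity, so Julia points have finite Julia images, of size at most
    [M]. Hence [|P| <= M |Q|] there, and a Bezout identity [A P + B Q = 1] keeps [|Q|] away from
    0. *)
Lemma Julia_region : Fatou setT None -> exists G : region absv P Q,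
  forall z, Julia setT (Some z) -> inG G z /\ Julia setT (Some (f z)).
Proof.
move=> Finf; have [M M1 hM] := Fatou_infty_bound Finf.
have JM z : Julia setT (Some z) -> absv z <= M.
  by move=> [_ zJ]; rewrite leNgt; apply/negP => /hM.
have Jf z : Julia setT (Some z) -> Q.[z] != 0 /\ Julia setT (Some (f z)).
  move=> [_ zJ]; have [Qz|Qz] := eqVneq Q.[z] 0.
    by exfalso; apply: zJ; apply: Fatou_pre; rewrite /= Qz eqxx.
  by split => //; split => // fF; apply: zJ; apply: Fatou_pre; rewrite rat_evalE.
have [[A B] /= AB] := Bezout_eq1_coprimepP _ _ (cPQ (HPQ := HPQ)).
pose E := Num.max 1 (Num.max (gaussn absv M A) (gaussn absv M B)).
have M0 : 0 < M by exact: lt_le_trans M1.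
have E0 : 0 < E by rewrite lt_max ltr01.
have q00 : 0 < (M * E)^-1 by rewrite invr_gt0 mulr_gt0.
have [G [GM Gq]] := region_exists (HC := HC) P Q M1 q00.
exists G => z zJ; have [Qz fzJ] := Jf z zJ; split => //.
split; first by rewrite GM JM.
rewrite Gq -[leLHS]mul1r ler_pdivrMr ?mulr_gt0//.
have : absv (A * P + B * Q).[z] = 1 by rewrite AB hornerC abs1.
rewrite hornerD !hornerM => <-.
have PQz : absv P.[z] <= M * absv Q.[z].
  by rewrite -ler_pdivrMr ?abs_gt0// -absf_div JM.
have AE : absv A.[z] <= E.
  by rewrite (le_trans (gaussn_horner A (JM z zJ)))// !le_max lexx orbT.
have BE : absv B.[z] <= E.
  by rewrite (le_trans (gaussn_horner B (JM z zJ)))// !le_max lexx !orbT.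
apply: absD_le; rewrite absM.
  rewrite (le_trans (ler_pM _ _ AE PQz))// mulrA mulrC ler_wpM2l//.
  by rewrite mulrC.
by rewrite mulrC ler_wpM2l// (le_trans BE)// ler_peMl ?(ltW E0).
Qed.

Lemma Julia_orbit (G : region absv P Q) :
  (forall z, Julia setT (Some z) -> inG G z /\ Julia setT (Some (f z))) ->
  forall z n, Julia setT (Some z) -> Julia setT (Some (iter n f z)).
Proof. by move=> h z n zJ; elim: n => //= n /h[]. Qed.

End FatouJulia.

(** * Radii of iterated images of discs, and expansive points *)

Section Radii.
Context {R : realType} {C : closedFieldType} {absv : C -> R} {p : nat}.
Context {HC : padic_field absv p}.
Context {P Q : {poly C}} {HPQ : good_map P Q}.
Variable G : region absv P Q.
Implicit Types (a b z u v : C) (r s t e : R).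
Notation f := (ratf P Q).
Notation psi := (psi absv P Q).
Notation d := (regd G). Notation L := (regL G). Notation M := (regM G).

Definition inGorb z := forall n, inG G (iter n f z).

(* [disc_rad z s n] is the radius of the image of the disc of radius [s] around [z] under the
   [n]-th iterate, as long as the previous radii are at most [d]. *)
Fixpoint disc_rad z s n := if n is n.+1 then psi (iter n f z) (disc_rad z s n) else s.

(** Stated with Gauss norms instead of equicontinuity, so that it does not depend on a field of
    definition and can be pulled back along orbits ([expansive_pull]). *)
Definition expansive z := inGorb z /\ forall s, 0 < s -> exists n, d < disc_rad z s n.

Lemma rad_shift z s m n : disc_rad z s (m + n) = disc_rad (iter m f z) (disc_rad z s m) n.
Proof. by elim: n => [|n IH]; rewrite ?addn0// addnS /= IH addnC iterD. Qed.

Lemma rad_ge0 z s n : 0 <= s -> 0 <= disc_rad z s n.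
Proof. by case: n => //= n _; exact: psi_ge0. Qed.

Lemma rad_gt0 z s n : inGorb z -> 0 < s -> 0 < disc_rad z s n.
Proof. by move=> zG s0; elim: n => //= n IH; exact: (psi_gt0 (zG n)). Qed.

Lemma rad_mono z s t n : 0 <= s <= t -> disc_rad z s n <= disc_rad z t n.
Proof.
move=> st; elim: n => [|n IH] /=; first by case/andP: st.
by rewrite psi_mono// IH rad_ge0//; case/andP: st.
Qed.

Lemma rad_le_exp z s n : inGorb z -> 0 <= s -> L ^+ n * s <= 1 -> disc_rad z s n <= L ^+ n * s.
Proof.
move=> zG s0; elim: n => [|n IH]; first by rewrite expr0 mul1r.
rewrite exprS -mulrA => h.
have h1 : L ^+ n * s <= 1.
  by rewrite (le_trans _ h)// ler_peMl ?regL1// mulr_ge0// exprn_ge0// ltW.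
rewrite /= (le_trans (psi_le (zG n) _))//.
  by rewrite rad_ge0//= (le_trans (IH h1)).
by rewrite ler_wpM2l ?IH// ltW.
Qed.

Lemma iter_lip z s u v n : inGorb z -> 0 < s -> (forall i, (i < n)%N -> disc_rad z s i <= d) ->
  absv u <= s -> absv v <= s ->
  absv (iter n f (z + u) - iter n f (z + v)) <= disc_rad z s n / s * absv (u - v).
Proof.
move=> zG s0; elim: n u v => [|n IH] u v h us vs.
  by rewrite /= divff ?gt_eqF// mul1r opprD addrACA subrr add0r.
have hn i : (i < n)%N -> disc_rad z s i <= d by move=> ni; rewrite h// ltnS ltnW.
have r0 : 0 < disc_rad z s n by exact: rad_gt0.
have near w : absv w <= s -> absv (iter n f (z + w) - iter n f z) <= disc_rad z s n.
  move=> ws; have := IH w 0 hn ws; rewrite abs0 addr0 subr0 => /(_ (ltW s0)) h1.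
  by rewrite (le_trans h1)// mulrAC ler_pdivrMr// ler_wpM2l// ltW.
have E w : f (iter n f (z + w)) = f (iter n f z + (iter n f (z + w) - iter n f z)).
  by rewrite [_ + (_ - _)]addrC subrK.
rewrite !iterS !E.
rewrite (le_trans (ratf_lip (zG n) _ (near _ us) (near _ vs)))//.
  by rewrite r0 h.
rewrite opprB addrA subrK (le_trans (ler_wpM2l _ (IH u v hn us vs)))//.
  by rewrite divr_ge0 ?psi_ge0// ltW.
by rewrite /= !mulrA divfK ?gt_eqF.
Qed.

Lemma iter_near z s u n : inGorb z -> 0 < s -> (forall i, (i < n)%N -> disc_rad z s i <= d) ->
  absv u <= s -> absv (iter n f (z + u) - iter n f z) <= disc_rad z s n.
Proof.
move=> zG s0 h us; have := @iter_lip z s u 0 n zG s0 h us.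
rewrite abs0 addr0 subr0 => /(_ (ltW s0)) h1; rewrite (le_trans h1)//.
by rewrite mulrAC ler_pdivrMr// ler_wpM2l// rad_ge0// ltW.
Qed.

Lemma expansive_ratf z : expansive z -> expansive (f z).
Proof.
move=> [zG h]; split=> [n|s s0]; first by rewrite -iterSr.
(* At most [d], to exclude exit at time 0; at most [s / L], so that the radius after one step is at
   most [s]. *)
have m0 : 0 < Num.min d (s / L) by rewrite lt_min regd0 divr_gt0.
have [[|n] hn] := h _ m0.
  by move: hn; rewrite /= lt_min ltxx.
exists n; rewrite (lt_le_trans hn)// -add1n rad_shift /= rad_mono// psi_ge0/=.
rewrite (le_trans (psi_le (zG 0) _))//.
  by rewrite (ltW m0)/= ge_min regd1.
by rewrite mulrC -ler_pdivlMr// ge_min lexx orbT.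
Qed.

Lemma expansive_iter z n : expansive z -> expansive (iter n f z).
Proof. by move=> h; elim: n => //= n; exact: expansive_ratf. Qed.

Lemma expansive_pull z n : (forall i, (i < n)%N -> inG G (iter i f z)) ->
  expansive (iter n f z) -> expansive z.
Proof.
move=> zn [h1 h2].
have zG : inGorb z.
  move=> i; have [ni|ni] := ltnP i n; first exact: zn.
  by rewrite -(subnK ni) iterD; exact: h1.
split => // s s0; have [k hk] := h2 _ (rad_gt0 n zG s0).
by exists (n + k)%N; rewrite rad_shift.
Qed.

(** If all radii of some disc stayed below [d], all iterates would be Lipschitz on it with the same
    constant [d / s], and the family would be equicontinuous. *)
Lemma Julia_expansive z :
  (forall z, Julia absv P Q setT (Some z) -> inG G z /\ Julia absv P Q setT (Some (f z))) ->
  Julia absv P Q setT (Some z) -> expansive z.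
Proof.
move=> JG zJ; have zG : inGorb z by move=> n; case: (JG _ (Julia_orbit JG n zJ)).
split => // s s0; apply: contrapT => /forallNP h; case: zJ => _; apply; split => //.
have {}h n : disc_rad z s n <= d by rewrite leNgt; apply/negP.
have sd : s <= d := h 0.
have [r r0 hr] := @chord_ball R C absv p HC z s s0.
have inM u n : absv u <= s -> inG G (iter n f (z + u)).
  move=> us; rewrite -(subrK (iter n f z) (iter n f (z + u))) addrC.
  apply: inG_near (zG n) _; rewrite (le_trans (iter_near zG s0 _ us))//.
exists r => // x [_ /hr[a -> az]] e e0.
have ds0 : 0 < d / s by rewrite divr_gt0.
have c0 : 0 < e / (d / s * M ^+ 2) by rewrite divr_gt0// mulr_gt0// exprn_gt0.
exists (e / (d / s * M ^+ 2)) => // y [_ /hr[b -> bz]] ab n n0.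
have [az' bz'] : absv (a - z) <= s /\ absv (b - z) <= s by rewrite !ltW.
have aE : a = z + (a - z) by rewrite addrC subrK.
have bE : b = z + (b - z) by rewrite addrC subrK.
rewrite !iter_rat_eval => [| i _| i _]; last 2 first.
- by rewrite bE; apply: inG_Q (inM _ _ _).
- by rewrite aE; apply: inG_Q (inM _ _ _).
rewrite (le_lt_trans (chord_le _ _))//.
rewrite {1}aE {1}bE (le_lt_trans (iter_lip zG s0 (fun i _ => h i) az' bz'))//.
rewrite opprB addrA subrK (le_lt_trans (_ : _ <= d / s * absv (a - b)))//.
  by rewrite ler_wpM2r// ler_wpM2r ?h// invr_ge0 ltW.
have aM : absv a <= M by rewrite aE; case: (inM _ 0%N az').
have bM : absv b <= M by rewrite bE; case: (inM _ 0%N bz').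
rewrite (le_lt_trans (ler_wpM2l _ (chord_ge (regM1 G) aM bM)))//.
  by rewrite divr_ge0// ltW.
by rewrite mulrA mulrC -ltr_pdivlMr// mulr_gt0// exprn_gt0.
Qed.

End Radii.
Arguments disc_rad {R C} absv P Q z s n.

(** * Discs of generic radius *)

Lemma first_nat (A : pred nat) : (exists n, A n) ->
  exists2 n, A n & forall i, (i < n)%N -> ~~ A i.
Proof.
move=> h; have [n An hn] := ex_minnP h; exists n => // i ni.
by apply: contraL ni => /hn; rewrite -leqNgt.
Qed.

Lemma seq_pigeonhole (T : eqType) (g : nat -> T) (s : seq T) n : (forall i, g i \in s) ->
  (size s <= n)%N -> exists i j, [/\ (i < j)%N, (j <= n)%N & g i = g j].
Proof.
move=> gs sn; have : ~~ uniq [seq g i | i <- iota 0 n.+1].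
  apply/negP => /uniq_leq_size => /(_ s) h; have := h _; rewrite size_map size_iota.
  rewrite ltnNge sn => H; suff : false by [].
  by apply: H => y /mapP[i _ ->].
move=> /(uniqPn (g 0%N))[i [j [ij]]]; rewrite size_map size_iota => jn.
rewrite !(nth_map 0%N) ?size_iota// ?(ltn_trans ij)// !nth_iota ?(ltn_trans ij)// !add0n => E.
by exists i, j.
Qed.

Section GenericRadii.
Context {R : realType} {C : closedFieldType} {absv : C -> R} {p : nat}.
Context {HC : padic_field absv p}.
Context {P Q : {poly C}} {HPQ : good_map P Q}.
Variable G : region absv P Q.
Implicit Types (a b z u v w : C) (r s t e : R) (q : {poly C}).
Notation f := (ratf P Q).
Notation psi := (psi absv P Q).
Notation rad := (disc_rad absv P Q).
Notation d := (regd G). Notation M := (regM G).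

Variable L : set C.
Hypothesis HL : is_subfield L.
Hypotheses (LP : poly_over L P) (LQ : poly_over L Q).
Variable l : nat.
Hypotheses (hl : prime l) (dl : (rdeg P Q < l)%N).

Definition abs_value s := exists2 a, L a & absv a = s.

(** [i] and [l] are coprime, so [s] is a quotient of a power of [s ^ l] by a power of [s ^ i], and
    the values of [L] form a group. *)
Lemma abs_value_root i s : (0 < i < l)%N -> 0 < s ->
  abs_value (s ^+ i) -> abs_value (s ^+ l) -> abs_value s.
Proof.
move=> /andP[i0 il] s0 [a La ai] [b Lb bl].
have [c _] := Bezoutl i (prime_gt0 hl).
have -> : gcdn l i = 1%N.
  by apply/eqP; rewrite -/(coprime l i) prime_coprime// gtnNdvd.
case/dvdnP => k E.
exists (b ^+ k / a ^+ c); first by apply: sub_div => //; apply: subX.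
rewrite absf_div !absX ai bl -!exprM.
have -> : (l * k = 1 + c * i)%N by rewrite E mulnC.
by rewrite exprD expr1 (mulnC i) mulfK// expf_neq0// gt_eqF.
Qed.

(* No two monomials of small degree have the same absolute value on a circle whose radius
   is an [l]-th root of a value but not a value. *)
Definition generic s := [/\ 0 < s, abs_value (s ^+ l) & ~ abs_value s].

(** A tie between the monomials [i < j] would make [s ^ (j - i)] a value of [L] with
    [0 < j - i < l], against [abs_value_root]. *)
Lemma generic_dominant q s : poly_over L q -> q != 0 -> (size q <= l)%N -> generic s ->
  exists k, [/\ (k < size q)%N, q`_k != 0 & forall i, (i < size q)%N -> i != k ->
    absv q`_i * s ^+ i < absv q`_k * s ^+ k].
Proof.
move=> Lq q0 ql [s0 sl sn].
have [k kq nk] := gaussn_attained (absv := absv) (ltW s0) q0.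
have tie i j : (i < j < l)%N -> q`_j != 0 -> absv q`_i * s ^+ i = absv q`_j * s ^+ j -> False.
  move=> /andP[ij jl] qj E; apply: sn; apply: (@abs_value_root (j - i)) => //.
    by rewrite subn_gt0 ij (leq_ltn_trans (leq_subr _ _)).
  exists (q`_i / q`_j); first by apply: sub_div.
  have sj : s ^+ j = s ^+ (j - i) * s ^+ i by rewrite -exprD subnK// ltnW.
  apply: (mulIf (x := s ^+ i)); first by rewrite expf_neq0// gt_eqF.
  by rewrite -sj absf_div mulrAC E mulrAC divff ?mul1r// gt_eqF// abs_gt0.
have pos : 0 < absv q`_k * s ^+ k by rewrite -nk gaussn_gt0.
have qk : q`_k != 0.
  by apply: contraTneq pos => ->; rewrite abs0 mul0r ltxx.
exists k; split => // i iq ik; rewrite lt_neqAle -nk gaussn_ge andbT nk.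
apply/eqP => E; have [ltik|ltki|eqik] := ltngtP i k; last by rewrite eqik eqxx in ik.
- by apply: (tie i k) => //; rewrite ltik (leq_trans kq).
- apply: (tie k i) => //; first by rewrite ltki (leq_trans iq).
  apply: contraTneq pos => qi; move: E; rewrite qi abs0 mul0r => <-.
  by rewrite ltxx.
Qed.

(** A single monomial [a_k u ^ k] with [0 < k < l] dominates, so the circle maps to the circle of
    radius [|a_k| s ^ k], and this radius is generic because [s] is. *)
Lemma psi_generic z s u : L z -> inG G z -> s <= d -> generic s -> absv u = s ->
  absv (f (z + u) - f z) = psi z s /\ generic (psi z s).
Proof.
move=> Lz zG sd gs us; have [s0 [c Lc cs] sn] := gs.
have Ld : poly_over L (diffp P Q z) by exact: over_diffp.
have dl' : (size (diffp P Q z) <= l)%N by rewrite (leq_trans (size_diffp _ _ _)).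
have d0 : diffp P Q z != 0 by rewrite diffp_neq0// (inG_Q zG).
have [k [kq qk hk]] := generic_dominant Ld d0 dl' gs.
have k0 : (0 < k)%N by rewrite lt0n; apply: contraNneq qk => ->; rewrite diffp_coef0.
have E : psi z s = absv ((diffp P Q z)`_k / Q.[z] ^+ 2) * s ^+ k.
  by rewrite /psi (gaussn_dominant s0 hk) absf_div absX mulrAC.
have Lk : L ((diffp P Q z)`_k / Q.[z] ^+ 2).
  by apply: sub_div => //; apply: subX => //; exact: over_horner.
have kk0 : (diffp P Q z)`_k / Q.[z] ^+ 2 != 0.
  by rewrite mulf_neq0// invr_neq0// expf_neq0// (inG_Q zG).
split.
  rewrite (ratf_abs_near zG) ?us// /psi (gaussn_dominant s0 hk).
  by rewrite (@horner_dominant R C absv p HC _ u k) ?us.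
split; first by rewrite E mulr_gt0 ?abs_gt0 ?exprn_gt0.
  exists (((diffp P Q z)`_k / Q.[z] ^+ 2) ^+ l * c ^+ k).
    by apply: subM => //; apply: subX.
  by rewrite E absM !absX cs exprMn -!exprM mulnC.
move=> [b Lb bE]; apply: sn; apply: (@abs_value_root k) => //.
- by rewrite k0 (leq_trans kq).
- exists (b / ((diffp P Q z)`_k / Q.[z] ^+ 2)); first by apply: sub_div.
  by rewrite absf_div bE E mulrAC divff ?mul1r// gt_eqF// abs_gt0.
- by exists c.
Qed.

Lemma iter_generic z s u n : L z -> inGorb G z -> generic s -> absv u = s ->
  (forall i, (i < n)%N -> rad z s i <= d) ->
  absv (iter n f (z + u) - iter n f z) = rad z s n /\ generic (rad z s n).
Proof.
move=> Lz zG gs us; elim: n => [|n IH] h.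
  by rewrite /= addrAC subrr add0r.
have [|E gn] := IH; first by move=> i ni; rewrite h// ltnS ltnW.
have Ln : L (iter n f z) by exact: sub_iter_ratf.
have := psi_generic Ln (zG n) (h n (ltnSn n)) gn E.
by rewrite [_ + (_ - _)]addrC subrK.
Qed.

(** Multiplying [w] by powers of [p] gives arbitrarily small generic radii. The orbits of [z] and
    [z + u] differ by exactly the disc radius, hence by more than [d] at the first exit, although
    [z + u] is a point of [L'] close to [z]. *)
Lemma expansive_Julia (L' : set C) z w : is_subfield L' -> L `<=` L' ->
  L z -> expansive G z -> L' w -> generic (absv w) -> Julia absv P Q L' (Some z).
Proof.
move=> HL' LL' Lz [zG zE] L'w [w0 [c Lc cw] wn]; split; first exact: LL'.
move=> [_ [r r0 rE]].
have M20 : 0 < M ^+ 2 by rewrite exprn_gt0.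
have zin : (P1_of L' `&` [set y | chord absv (Some z) y < r]) (Some z).
  by split; [exact: LL'|rewrite /= (chord_xx (HC := HC))].
have e0 : 0 < d / M ^+ 2 by rewrite divr_gt0.
have [e1 e10 he1] := rE _ zin _ e0.
have m0 : 0 < Num.min d (Num.min r e1) by rewrite !lt_min regd0 r0.
have [k hk] := abs_p_exp_small (HC := HC) (divr_gt0 m0 w0).
pose u := p%:R ^+ k * w.
have pk0 : 0 < absv (p%:R ^+ k : C) by rewrite absX exprn_gt0// abs_p_gt0.
have Lpk : L (p%:R ^+ k) by apply: subX => //; exact: sub_nat.
have := hk; rewrite ltr_pdivlMr// -absM -/u !lt_min => /and3P[ud ur ue].
have gu : generic (absv u).
  split; first by rewrite absM mulr_gt0.
    exists ((p%:R ^+ k) ^+ l * c); first by apply: subM => //; exact: subX.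
    by rewrite absM cw absM exprMn [in LHS]absX.
  move=> [b Lb bu]; apply: wn; exists (b / p%:R ^+ k); first exact: sub_div.
  by rewrite absf_div bu absM mulrAC divff ?mul1r// gt_eqF.
have [u0 _ _] := gu.
have [n hn hmin] := first_nat (zE _ u0).
have {}hmin i : (i < n)%N -> rad z (absv u) i <= d by move=> /hmin; rewrite -leNgt.
have [E _] := iter_generic Lz zG gu (erefl _) hmin.
have n0 : (0 < n)%N.
  by rewrite lt0n; apply: contraTneq hn => -> /=; rewrite -leNgt ltW.
have zu : chord absv (Some z) (Some (z + u)) <= absv u.
  by rewrite (le_trans (chord_le _ _))// opprD addrA subrr sub0r absN.
have uin : (P1_of L' `&` [set y | chord absv (Some z) y < r]) (Some (z + u)).
  split; last by rewrite /= (le_lt_trans zu).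
  by apply: subD => //; [exact: LL'|apply: subM => //; apply: LL'].
have := he1 _ uin (le_lt_trans zu ue) n n0.
have Gu i : (i < n)%N -> inG G (iter i f (z + u)).
  move=> ni; rewrite -(subrK (iter i f z) (iter i f (z + u))) addrC.
  apply: (inG_near (zG i)); rewrite (le_trans (iter_near zG u0 _ (lexx _))) ?hmin//.
  by move=> j ji; rewrite hmin// (ltn_trans ji).
rewrite !iter_rat_eval => [|i ni|i ni]; last 2 first.
- exact: inG_Q (Gu i ni).
- exact: inG_Q (zG i).
have aM : absv (iter n f z) <= M by case: (zG n).
have bM : absv (iter n f (z + u)) <= M.
  rewrite -(subrK (iter n f z) (iter n f (z + u))) absD_le// E.
  case: n n0 hn hmin {E Gu aM} => // n _ hn hmin.
  have rn := hmin n (ltnSn n).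
  rewrite /= (le_trans (psi_le (zG n) _))//.
    by rewrite rad_ge0 ?(ltW u0)//= (le_trans rn) ?regd1.
  rewrite (le_trans (ler_wpM2l (ltW (regL0 G)) rn))//.
  by rewrite (le_trans (regLd G)) ?regM1.
rewrite ltNge ler_pdivrMr// mulrC => /negP; apply.
by rewrite (le_trans _ (chord_ge (regM1 G) aM bM))// absC E ltW.
Qed.

End GenericRadii.

(** * Finite extensions of the field of p-adic numbers *)

Section AdjoinAlgebraic.
Variables (C : closedFieldType) (K : set C).
Hypothesis HK : is_subfield K.
Implicit Types (q g m a b : {poly C}) (y : C).

Lemma over_lead q : poly_over K q -> K (lead_coef q).
Proof. by move=> h; rewrite lead_coefE. Qed.

Lemma over_Xn n : poly_over K 'X^n.
Proof. by move=> i; rewrite coefXn; case: eqP => _; [exact: sub1|exact: sub0]. Qed.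

Lemma over0 : poly_over K 0.
Proof. by move=> i; rewrite coef0; exact: sub0. Qed.

(** [K] is a subset of [C], so the point is that the quotient has coefficients in [K]; it is built
    by cancelling leading terms. *)
Lemma over_division q g : poly_over K q -> poly_over K g -> g != 0 ->
  exists2 a : {poly C}, poly_over K a & (size (q - a * g)%R < size g)%N.
Proof.
move=> Kq Kg g0; have [n] := ubnP (size q).
elim: n q Kq => // n IH q Kq; rewrite ltnS => qn.
have [qg|gq] := ltnP (size q) (size g).
  by exists 0; [exact: over0|rewrite mul0r subr0].
have q0 : q != 0 by rewrite -size_poly_gt0 (leq_trans _ gq)// size_poly_gt0.
pose k := (size q - size g)%N; pose c := lead_coef q / lead_coef g.
have Kc : poly_over K (c *: 'X^k).
  apply: (overZ HK) (over_Xn _); apply: (sub_div HK); exact: over_lead.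
have [|a Ka aq] := IH (q - c *: 'X^k * g) (overB HK Kq (overM HK Kc Kg)).
  have sg : (0 < size g)%N by rewrite size_poly_gt0.
  have sq : (0 < size q)%N by rewrite size_poly_gt0.
  rewrite (leq_trans _ qn)// -(prednK sq) ltnS; apply/leq_sizeP => j jq.
  rewrite coefB -scalerAl coefZ coefXnM.
  have kj : (k <= j)%N by rewrite (leq_trans _ jq)// /k; lia.
  rewrite ltnNge kj /=; have [jeq|jne] := eqVneq j (size q).-1.
    have -> : (j - k)%N = (size g).-1 by rewrite jeq /k; lia.
    by rewrite jeq -!lead_coefE /c divfK ?subrr// lead_coef_eq0.
  have jlt : (size q <= j)%N by rewrite -(prednK sq) ltn_neqAle eq_sym jne.
  by rewrite !nth_default ?mulr0 ?subrr// leq_subRL// /k subnK.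
exists (a + c *: 'X^k); first exact: (overD HK).
by rewrite mulrDl opprD addrA addrAC.
Qed.

Variable y : C.
Hypothesis Ky : algebraic_over K y.

Definition adjoin : set C := [set x | exists2 q, poly_over K q & x = q.[y]].

Lemma minimal_annihilator : exists m, [/\ m != 0, poly_over K m, root m y &
  forall g, g != 0 -> poly_over K g -> root g y -> (size m <= size g)%N].
Proof.
pose A n := `[< exists g, [/\ g != 0, poly_over K g, root g y & size g = n] >].
have exA : exists n, A n.
  by have [q [q0 Kq qy]] := Ky; exists (size q); apply/asboolP; exists q.
have [n /asboolP[m [m0 Km my mn]] nmin] := ex_minnP exA.
exists m; split => // g g0 Kg gy; rewrite mn; apply: nmin; apply/asboolP.
by exists g.
Qed.

(** An element [g] of least size in the ideal generated over [K] by [q] and a minimal annihilator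
    [m] divides both. Since [g] does not vanish at [y], the cofactor of [g] in [m] does, so by
    minimality of [m] the polynomial [g] is a constant. *)
Lemma adjoin_inv q : poly_over K q -> q.[y] != 0 ->
  exists2 a, poly_over K a & a.[y] * q.[y] = 1.
Proof.
move=> Kq qy; have [m [m0 Km my mmin]] := minimal_annihilator.
pose I g := g != 0 /\ exists a b, [/\ poly_over K a, poly_over K b & g = a * q + b * m].
pose A n := `[< exists2 g, I g & size g = n >].
have q0 : q != 0 by apply: contraNneq qy => ->; rewrite horner0.
have exA : exists n, A n.
  exists (size q); apply/asboolP; exists q => //; split => //; exists 1, 0.
  by rewrite mul1r mul0r addr0; split=> //; [apply: (overC HK); exact: sub1|exact: over0].
have [n /asboolP[g [g0 [a [b [Ka Kb gE]]]] gn] nmin] := ex_minnP exA.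
have Kg : poly_over K g by rewrite gE; apply: (overD HK); exact: (overM HK).
have small r a' b' : poly_over K a' -> poly_over K b' -> r = a' * q + b' * m ->
    (size r < size g)%N -> r = 0.
  move=> Ka' Kb' rE rg; apply/eqP; apply: contraLR rg => r0.
  by rewrite -leqNgt gn nmin//; apply/asboolP; exists r => //; split => //; exists a', b'.
have [h Kh hm] := over_division Km Kg g0.
have [h' Kh' hq] := over_division Kq Kg g0.
have K1 : poly_over K 1%:P by apply: (overC HK); exact: sub1.
have mE : m = h * g.
  apply/eqP; rewrite -subr_eq0; apply/eqP.
  apply: (small _ (0 - h * a) (1%:P - h * b)) hm; rewrite ?gE; last by rewrite polyC1; ring.
  - by apply: (overB HK) over0 _; exact: (overM HK).
  - by apply: (overB HK) K1 _; exact: (overM HK).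
have qE : q = h' * g.
  apply/eqP; rewrite -subr_eq0; apply/eqP.
  apply: (small _ (1%:P - h' * a) (0 - h' * b)) hq; rewrite ?gE; last by rewrite polyC1; ring.
  - by apply: (overB HK) K1 _; exact: (overM HK).
  - by apply: (overB HK) over0 _; exact: (overM HK).
have gy : g.[y] != 0 by apply: contraNneq qy => gy; rewrite qE hornerM gy mulr0.
have h0 : h != 0 by apply: contraNneq m0 => h0; rewrite mE h0 mul0r.
have hy : root h y.
  by move: my; rewrite mE /root hornerM mulf_eq0 (negPf gy) orbF.
have sg : size g = 1%N.
  have := mmin h h0 Kh hy; rewrite {1}mE size_mul//.
  have : (0 < size g)%N by rewrite size_poly_gt0.
  have : (0 < size h)%N by rewrite size_poly_gt0.
  by case: (size h) (size g) => [|i] [|[|j]]//= _ _; lia.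
have /size_poly1P[c c0 gc] : size g == 1%N by rewrite sg.
have Kc : K c by have := Kg 0; rewrite gc coefC eqxx.
exists (c^-1 *: a); first by apply: (overZ HK) Ka; exact: (subV HK).
have E : a.[y] * q.[y] = c.
  have := congr1 (fun q : {poly C} => q.[y]) gE.
  by rewrite gc hornerC hornerD !hornerM (rootP my) mulr0 addr0 => <-.
by rewrite hornerZ -mulrA E mulVf.
Qed.

Lemma adjoin_subfield : is_subfield adjoin.
Proof.
split.
- by exists 0; [exact: over0|rewrite horner0].
- by exists 1%:P; [apply: (overC HK); exact: sub1|rewrite hornerC].
- by move=> _ _ [q Kq ->] [r Kr ->]; exists (q - r); [exact: (overB HK)|rewrite !hornerE].
- by move=> _ _ [q Kq ->] [r Kr ->]; exists (q * r); [exact: (overM HK)|rewrite !hornerE].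
- move=> _ [q Kq ->]; have [->|qy] := eqVneq q.[y] 0.
    by rewrite invr0; exists 0; [exact: over0|rewrite horner0].
  have [a Ka aq] := adjoin_inv Kq qy; exists a => //.
  by apply: (mulIf qy); rewrite mulVf.
Qed.

Lemma adjoin_contains : K `<=` adjoin.
Proof. by move=> x Kx; exists x%:P; [exact: (overC HK)|rewrite hornerC]. Qed.

Lemma adjoin_gen : adjoin y.
Proof. by exists 'X; [exact: (overX HK)|rewrite hornerX]. Qed.

Lemma adjoin_bounded : exists n, forall x, adjoin x ->
  exists2 q, poly_over K q & (size q <= n)%N /\ x = q.[y].
Proof.
have [m [m0 Km my _]] := minimal_annihilator.
exists (size m) => _ [q Kq ->]; have [a Ka am] := over_division Kq Km m0.
exists (q - a * m); first by apply: (overB HK) Kq _; exact: (overM HK).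
by rewrite ltnW// !hornerE (rootP my) mulr0 subr0.
Qed.

End AdjoinAlgebraic.

(** * Local compactness of finite extensions *)

Section Qp.
Context {R : realType} {C : closedFieldType} {absv : C -> R} {p : nat}.
Context {HC : padic_field absv p}.
Implicit Types (a b x y z : C) (r t e : R) (s : seq C).
Notation Qp := (Qp_in absv).

Definition closed_set (S : set C) := forall x,
  (forall e, 0 < e -> exists2 y, S y & absv (x - y) < e) -> S x.

Lemma Qp_closed : closed_set Qp.
Proof.
move=> x h e e0; have [y Sy xy] := h e e0; have [q hq] := Sy e e0.
by exists q; rewrite (abs_tri_lt xy).
Qed.

Definition fraction x := exists (a : int) (b : nat), (0 < b)%N /\ x = a%:~R / b%:R.

Lemma intC_eq0 (a : int) : (a%:~R == 0 :> C) = (a == 0).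
Proof.
case: a => [[|n]|n]; rewrite ?NegzE ?mulrNz ?oppr_eq0.
- by rewrite eqxx.
- by rewrite -pmulrn (negPf (natC_neq0 (HC := HC) _)).
- by rewrite -pmulrn (negPf (natC_neq0 (HC := HC) _)).
Qed.

Lemma fraction_ratr (q : rat) : fraction (ratr q).
Proof.
exists (numq q), `|denq q|%N; split; first by rewrite absz_gt0 denq_neq0.
by rewrite /ratr pmulrn absz_denq.
Qed.

Lemma ratr_fraction x : fraction x -> exists q, x = ratr q.
Proof.
move=> [a [b [b0 ->]]]; exists (a%:~R / b%:R).
pose q : rat := a%:~R / b%:R; rewrite -/q.
have bC : (b%:R : C) != 0 by exact: natC_neq0 b0.
have dC : ((denq q)%:~R : C) != 0 by rewrite intC_eq0 denq_neq0.
have E : (numq q * b%:Z)%R = a * denq q.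
  apply: (@intr_inj rat); rewrite !intrM.
  have bQ : (b%:R : rat) != 0 by rewrite pnatr_eq0 -lt0n.
  have dQ : ((denq q)%:~R : rat) != 0 by rewrite intr_eq0 denq_neq0.
  by rewrite numqE mulrAC {1}/q -pmulrn divfK.
rewrite /ratr; apply: (mulIf bC); rewrite divfK//; apply: (mulIf dC).
have := congr1 (fun z : int => z%:~R : C) E; rewrite !intrM -pmulrn => <-.
by rewrite mulrAC divfK.
Qed.

Lemma QpP x : Qp x <-> forall e, 0 < e -> exists2 y, fraction y & absv (x - y) < e.
Proof.
split=> h e e0; have := h e e0; last first.
  by move=> [y /ratr_fraction[q ->] xq]; exists q.
by move=> [q hq]; exists (ratr q) => //; exact: fraction_ratr.
Qed.

Lemma fraction_Qp x : fraction x -> Qp x.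
Proof. by move=> h; apply/QpP => e e0; exists x => //; rewrite subrr abs0. Qed.

Lemma fractionB x y : fraction x -> fraction y -> fraction (x - y).
Proof.
move=> [a [b [b0 ->]]] [c [e [e0 ->]]].
exists (a * e%:Z - c * b%:Z), (b * e)%N; rewrite muln_gt0 b0; split => //.
rewrite intrB !intrM natrM -!pmulrn; field.
by rewrite !(natC_neq0 (HC := HC)).
Qed.

Lemma fractionM x y : fraction x -> fraction y -> fraction (x * y).
Proof.
move=> [a [b [b0 ->]]] [c [e [e0 ->]]].
exists (a * c), (b * e)%N; rewrite muln_gt0 b0; split => //.
rewrite intrM natrM; field.
by rewrite !(natC_neq0 (HC := HC)).
Qed.

Lemma fractionV x : fraction x -> fraction x^-1.
Proof.
move=> [[[|n]|n] [b [b0 ->]]].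
- by rewrite mul0r invr0; exists 0, 1%N; rewrite mul0r.
- by exists b%:Z, n.+1; rewrite invf_div -!pmulrn.
- by exists (- b%:Z), n.+1; rewrite NegzE !mulrNz -!pmulrn mulNr invrN invf_div mulNr.
Qed.

Lemma fraction_nat n : fraction n%:R.
Proof. by exists n%:Z, 1%N; rewrite divr1 -pmulrn. Qed.

Lemma Qp_subfield : is_subfield Qp.
Proof.
have QB x y : Qp x -> Qp y -> Qp (x - y).
  move=> /QpP hx /QpP hy; apply/QpP => e e0.
  have [x' fx xx] := hx e e0; have [y' fy yy] := hy e e0.
  exists (x' - y'); first exact: fractionB.
  have -> : x - y - (x' - y') = (x - x') - (y - y') by ring.
  by rewrite absD_lt ?absN.
have Q0 : Qp 0 by apply: fraction_Qp; exact: (fraction_nat 0).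
split => //.
- by apply: fraction_Qp; exact: (fraction_nat 1).
- move=> x y /QpP hx /QpP hy; apply/QpP => e e0.
  have y1 : 0 < absv y + 1 by rewrite ltr_wpDl.
  have [x' fx xx] := hx (e / (absv y + 1)) (divr_gt0 e0 y1).
  have x1 : 0 < absv x' + 1 by rewrite ltr_wpDl.
  have [y' fy yy] := hy (e / (absv x' + 1)) (divr_gt0 e0 x1).
  exists (x' * y'); first exact: fractionM.
  have -> : x * y - x' * y' = (x - x') * y + x' * (y - y') by ring.
  have le1 u v : 0 <= absv v -> absv u < e / (absv v + 1) -> absv u * absv v < e.
    move=> v0 h; rewrite (le_lt_trans (_ : _ <= absv u * (absv v + 1)))//.
      by rewrite ler_wpM2l// lerDl.
    by rewrite -ltr_pdivlMr// ltr_wpDl.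
  by rewrite absD_lt// absM ?[absv x' * _]mulrC le1.
- move=> x /QpP hx; have [->|x0] := eqVneq x 0; first by rewrite invr0.
  apply/QpP => e e0; have xp : 0 < absv x by rewrite abs_gt0.
  have m0 : 0 < Num.min (absv x) (e * absv x ^+ 2).
    by rewrite lt_min xp mulr_gt0// exprn_gt0.
  have [y fy] := hx _ m0; rewrite lt_min => /andP[xy1 xy2].
  have yx : absv y = absv x by apply: abs_near; rewrite absC.
  have y0 : y != 0 by rewrite -(abs_gt0 (absv := absv)) yx.
  exists y^-1; first exact: fractionV.
  have -> : x^-1 - y^-1 = (y - x) / (x * y) by field; rewrite x0 y0.
  by rewrite absf_div absM yx -expr2 ltr_pdivrMr ?exprn_gt0// absC.
Qed.

Definition tot_bounded (S : set C) := forall e, 0 < e ->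
  exists2 s : seq C, (forall y, y \in s -> S y) &
    forall x, S x -> exists2 y, y \in s & absv (x - y) < e.

Definition field_ball (S : set C) r := S `&` [set x | absv x <= r].

Lemma abs_int (a : int) : absv a%:~R = absv `|a|%N%:R.
Proof. by case: a => n; rewrite ?NegzE ?mulrNz ?absN -pmulrn ?abszN. Qed.

Lemma abs_int_le1 (a : int) : absv a%:~R <= 1.
Proof. by rewrite abs_int abs_nat_le1. Qed.

Lemma abs_nat_coprime n : (0 < n)%N -> coprime p n -> absv n%:R = 1.
Proof.
move=> n0 pn; rewrite (abs_nat (HC := HC))// logn_coprime ?expr0 ?invr1//.
Qed.

(** In lowest terms the denominator of such an [x] is prime to [p], hence invertible modulo [p ^ m];
    [n] is the residue of the numerator times that inverse. *)
Lemma fraction_mod x m : fraction x -> absv x <= 1 ->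
  exists2 n, (n < p ^ m)%N & absv (x - n%:R) <= absv (p%:R ^+ m).
Proof.
have hp := p_prime (HC := HC); have p0 := prime_gt0 hp.
move=> /ratr_fraction[q ->] q1.
pose b := `|denq q|%N; pose a := numq q.
have b0 : (0 < b)%N by rewrite absz_gt0 denq_neq0.
have qE : ratr q = a%:~R / b%:R :> C by rewrite /ratr /a /b pmulrn absz_denq.
have pb : coprime p b.
  rewrite prime_coprime//; apply/negP => pb; move: q1.
  have pa : absv (a%:~R : C) = 1.
    rewrite abs_int abs_nat_coprime//.
      rewrite lt0n; apply: contraL (coprime_num_den q) => /eqP a0.
      rewrite /coprime -/a a0 gcd0n; apply: contraL pb => /eqP b1.
      by rewrite /b b1 dvdn1; case: (p) hp => [|[]].
    rewrite prime_coprime//; apply/negP => pa.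
    have : (p %| gcdn `|numq q| `|denq q|)%N by rewrite dvdn_gcd pa pb.
    rewrite (eqP (coprime_num_den q)) dvdn1; by case: (p) hp => [|[]].
  rewrite qE absf_div pa div1r leNgt invf_gt1 ?abs_nat_gt0//.
  case/dvdnP: pb => k ->; rewrite natrM absM.
  by rewrite (le_lt_trans (ler_wpM2r _ (abs_nat_le1 _)))// mul1r abs_p_lt1.
have /coprimezP[[u v] /= uv] : coprimez (p ^ m)%N b%:Z.
  by rewrite /coprimez /gcdz /= (eqP (coprimeXl m pb)).
have pm0 : (p ^ m)%N%:Z != 0 :> int by rewrite eqz_nat expn_eq0 negb_and -lt0n p0.
pose n := `|(a * v %% (p ^ m)%N)%Z|%N.
have nE : n%:Z = (a * v %% (p ^ m)%N)%Z by rewrite /n gez0_abs// modz_ge0.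
exists n.
  by rewrite -ltz_nat nE ltz_pmod// ltz_nat expn_gt0 p0.
have : a - n%:Z * b%:Z = (p ^ m)%N%:Z * (a * u + (a * v %/ (p ^ m)%N)%Z * b%:Z).
  have := divz_eq (a * v) (p ^ m)%N; rewrite -nE => E.
  have {}E : n%:Z = a * v - (a * v %/ (p ^ m)%N)%Z * (p ^ m)%N by rewrite {1}E addrC addKr.
  have aE : a = a * (u * (p ^ m)%N + v * b) by rewrite uv mulr1.
  rewrite E {1}aE; ring.
move=> /(congr1 (fun z : int => z%:~R : C)); rewrite intrB !intrM -!pmulrn => E.
have bC : (b%:R : C) != 0 by exact: natC_neq0 b0.
have -> : (ratr q : C) - n%:R = (a%:~R - n%:R * b%:R) / b%:R by rewrite qE mulrBl mulfK.
rewrite E absf_div abs_nat_coprime// divr1 absM natrX ler_piMr//.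
exact: abs_int_le1.
Qed.

(** Any point of an ultrametric disc is a center of it, so centers can be moved into [S] without
    enlarging the radius. *)
Lemma tot_bounded_weak (S : set C) :
  (forall e, 0 < e -> exists s : seq C, forall x, S x -> exists2 y, y \in s & absv (x - y) < e) ->
  tot_bounded S.
Proof.
move=> h e e0; have [s hs] := h e e0.
pose A y := [set x | S x /\ absv (x - y) < e].
exists [seq xget 0 (A y) | y <- s & `[< A y !=set0 >]] => [y /mapP[x]|x Sx].
  rewrite mem_filter => /andP[/asboolP[w Aw] _] ->.
  by have [] := xgetPex 0 (ex_intro _ w Aw).
have [y ys xy] := hs x Sx.
have Ax : A y x by split.
exists (xget 0 (A y)).
  by apply/mapP; exists y => //; rewrite mem_filter ys andbT; apply/asboolP; exists x.
have [_ h1] := xgetPex 0 (ex_intro _ x Ax).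
by rewrite (abs_tri_lt xy)// absC.
Qed.

Lemma tot_bounded_subset (S T : set C) : S `<=` T -> tot_bounded T -> tot_bounded S.
Proof.
move=> ST h; apply: tot_bounded_weak => e e0; have [s _ hs] := h e e0.
by exists s => x /ST; exact: hs.
Qed.

Lemma Qp_ball1_tot_bounded : tot_bounded (field_ball Qp 1).
Proof.
move=> e e0; have [m hm] := abs_p_exp_small (HC := HC) e0.
exists [seq n%:R | n <- iota 0 (p ^ m)%N] => [y /mapP[n _ ->]|x [Qx x1]].
  by split; [apply: fraction_Qp; exact: fraction_nat|exact: abs_nat_le1].
have pm0 : 0 < absv (p%:R ^+ m : C) by rewrite absX exprn_gt0// abs_p_gt0.
have [q fq xq] := (QpP x).1 Qx _ pm0.
have q1 : absv q <= 1.
  rewrite -(subrK x q) absD_le// absC (le_trans (ltW xq))// absX exprn_ile1//.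
  exact: abs_nat_le1.
have [n np qn] := fraction_mod m fq q1.
exists n%:R; first by apply/mapP; exists n => //; rewrite mem_iota.
by rewrite (le_lt_trans _ hm)// (abs_tri_le (ltW xq) qn).
Qed.

Lemma Qp_ball_tot_bounded r : tot_bounded (field_ball Qp r).
Proof.
apply: tot_bounded_weak => e e0; have QF := Qp_subfield.
have r1 : 0 < (Num.max 1 r)^-1 by rewrite invr_gt0 lt_max ltr01.
have [k hk] := abs_p_exp_small (HC := HC) r1.
have pk0 : (p%:R ^+ k : C) != 0.
  by rewrite expf_neq0// -(abs_gt0 (absv := absv)) abs_p_gt0.
have ak0 : 0 < absv (p%:R ^+ k : C) by rewrite abs_gt0.
have [s _ hs] := Qp_ball1_tot_bounded (mulr_gt0 e0 ak0).
exists [seq y / p%:R ^+ k | y <- s] => x [Qx xr].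
have [|y ys xy] := hs (x * p%:R ^+ k).
  split.
    by apply: (subM QF) => //; apply: (subX QF); exact: (sub_nat QF).
  have r0 : 0 < Num.max 1 r by rewrite lt_max ltr01.
  have xr' : absv x <= Num.max 1 r by rewrite le_max xr orbT.
  rewrite /= absM (le_trans (ler_pM _ _ xr' (ltW hk)))//.
  by rewrite divff// gt_eqF.
exists (y / p%:R ^+ k); first by apply/mapP; exists y.
have -> : x - y / p%:R ^+ k = (x * p%:R ^+ k - y) / p%:R ^+ k by rewrite mulrBl mulfK.
by rewrite absf_div ltr_pdivrMr.
Qed.

Definition span (s : seq C) : set C := [set x | exists c : nat -> C,
  (forall i, Qp (c i)) /\ x = \sum_(i < size s) c i * s`_i].

Lemma span_nil x : span [::] x <-> x = 0.
Proof.
split=> [[c [_ ->]]|->]; first by rewrite big_ord0.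
by exists (fun=> 0); split; [move=> _; exact: (sub0 Qp_subfield)|rewrite big_ord0].
Qed.

Lemma span_cons b s x : span (b :: s) x <-> exists a y, [/\ Qp a, span s y & x = a * b + y].
Proof.
split=> [[c [Qc ->]]|[a [y [Qa [c [Qc ->]] ->]]]].
  exists (c 0), (\sum_(i < size s) c i.+1 * s`_i); rewrite big_ord_recl; split => //.
  by exists (fun i => c i.+1).
exists (fun i => if i is i.+1 then c i else a); split; first by case.
by rewrite big_ord_recl.
Qed.

Lemma span0 s : span s 0.
Proof.
exists (fun=> 0); split; first by move=> _; exact: (sub0 Qp_subfield).
by rewrite big1// => i _; rewrite mul0r.
Qed.

Lemma spanD s x y : span s x -> span s y -> span s (x + y).
Proof.
move=> [c [Qc ->]] [e [Qe ->]]; exists (fun i => c i + e i); split.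
  by move=> i; exact: (subD Qp_subfield).
by rewrite -big_split; apply: eq_bigr => i _; rewrite mulrDl.
Qed.

Lemma spanZ s a x : Qp a -> span s x -> span s (a * x).
Proof.
move=> Qa [c [Qc ->]]; exists (fun i => a * c i); split.
  by move=> i; exact: (subM Qp_subfield).
by rewrite mulr_sumr; apply: eq_bigr => i _; rewrite mulrA.
Qed.

Lemma spanN s x : span s x -> span s (- x).
Proof.
by rewrite -mulN1r; apply: spanZ; apply: (subN Qp_subfield); exact: (sub1 Qp_subfield).
Qed.

Lemma span_mem s b : b \in s -> span s b.
Proof.
elim: s => // c s IH; rewrite in_cons => /orP[/eqP ->|/IH bs]; apply/span_cons.
  exists 1, 0; rewrite mul1r addr0; split => //; last exact: span0.
  exact: (sub1 Qp_subfield).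
by exists 0, b; rewrite mul0r add0r; split => //; exact: (sub0 Qp_subfield).
Qed.

Lemma span_sum s (I : Type) (l : seq I) (A : pred I) (F : I -> C) :
  (forall i, A i -> span s (F i)) -> span s (\sum_(i <- l | A i) F i).
Proof. by move=> h; elim/big_ind : _ => //; [exact: span0|exact: spanD]. Qed.

Lemma tot_bounded_scale (S : set C) b : tot_bounded S -> tot_bounded [set b * x | x in S].
Proof.
move=> h; apply: tot_bounded_weak => e e0.
have b1 : 0 < absv b + 1 by rewrite ltr_wpDl.
have [s _ hs] := h _ (divr_gt0 e0 b1).
exists [seq b * y | y <- s] => _ [x Sx <-]; have [y ys xy] := hs x Sx.
exists (b * y); first by apply/mapP; exists y.
rewrite -mulrBr absM (le_lt_trans (_ : _ <= (absv b + 1) * absv (x - y)))//.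
  by rewrite ler_wpM2r// lerDl.
by rewrite mulrC -ltr_pdivlMr.
Qed.

Lemma tot_boundedD (S T : set C) : tot_bounded S -> tot_bounded T ->
  tot_bounded [set z | exists x y, [/\ S x, T y & z = x + y]].
Proof.
move=> hS hT; apply: tot_bounded_weak => e e0.
have [s _ hs] := hS e e0; have [t _ ht] := hT e e0.
exists [seq x + y | x <- s, y <- t] => _ [x [y [Sx Ty ->]]].
have [x' x's xx] := hs x Sx; have [y' y't yy] := ht y Ty.
exists (x' + y'); first by apply/allpairsP; exists (x', y').
by rewrite opprD addrACA absD_lt.
Qed.

Definition abs_cauchy (u : nat -> C) := forall e, 0 < e -> exists N, forall m n,
  (N <= m)%N -> (N <= n)%N -> absv (u m - u n) < e.

Definition abs_tends (u : nat -> C) l := forall e, 0 < e -> exists N, forall n,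
  (N <= n)%N -> absv (u n - l) < e.

Lemma complete u : abs_cauchy u -> exists l, abs_tends u l.
Proof. by case: HC => _ [_ _ h _]; exact: h. Qed.

Lemma closed_seq (S : set C) u l : closed_set S -> (forall n, S (u n)) -> abs_tends u l -> S l.
Proof.
move=> cS Su ul; apply: cS => e e0; have [N hN] := ul e e0.
by exists (u N) => //; rewrite absC hN.
Qed.

Lemma eps_gt0 n : 0 < absv (p%:R : C) ^+ n.
Proof. by rewrite exprn_gt0// abs_p_gt0. Qed.

Lemma seq_limit (S : set C) x : (forall e, 0 < e -> exists2 y, S y & absv (x - y) < e) ->
  exists2 u : nat -> C, (forall n, S (u n)) & abs_tends u x.
Proof.
move=> h.
have /choice[u hu] : forall n : nat, exists y, S y /\ absv (x - y) < absv (p%:R : C) ^+ n.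
  by move=> n; have [y Sy xy] := h _ (eps_gt0 n); exists y.
exists u => [n|e e0]; first by case: (hu n).
have [k hk] := abs_p_exp_small (HC := HC) e0; exists k => n kn.
rewrite absC (lt_trans (hu n).2)// (le_lt_trans _ hk)// absX.
by rewrite ler_wiXn2l// abs_nat_le1.
Qed.

Lemma tends_cauchy u x : abs_tends u x -> abs_cauchy u.
Proof.
move=> ux e e0; have [N hN] := ux e e0; exists N => m n Nm Nn.
by rewrite (abs_tri_lt (hN m Nm))// absC hN.
Qed.

Definition loc_compact (S : set C) := closed_set S /\ forall r, tot_bounded (field_ball S r).

Lemma closed_dist (S : set C) x : closed_set S -> ~ S x ->
  exists2 r, 0 < r & forall y, S y -> r <= absv (x - y).
Proof.
move=> cS Sx; apply: contrapT => h; apply: Sx; apply: cS => e e0.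
apply: contrapT => h'; apply: h; exists e => // y Sy.
by rewrite leNgt; apply/negP => xy; apply: h'; exists y.
Qed.

(** Induction on the generators. A generator already in the span of the others is dropped; otherwise
    its coordinate is controlled by the norm, as in the proof that norms on a finite-dimensional
    space are equivalent. *)
Lemma span_loc_compact s : loc_compact (span s).
Proof.
have QF := Qp_subfield.
elim: s => [|b s [cs ts]].
  split=> [x h|r].
    apply/span_nil/eqP; apply: contrapT => /negP; rewrite -(abs_gt0 (absv := absv)) => x0.
    by have [y /span_nil -> ] := h _ x0; rewrite subr0 ltxx.
  apply: tot_bounded_weak => e e0; exists [:: 0] => x [/span_nil -> _].
  by exists 0; rewrite ?inE// subrr abs0.
have [bs|bs] := pselect (span s b).
  suff -> : span (b :: s) = span s by [].
  apply/predeqP => x; split=> [/span_cons[a [y [Qa sy ->]]]|sx].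
    by apply: spanD => //; exact: spanZ.
  by apply/span_cons; exists 0, x; rewrite mul0r add0r; split => //; exact: (sub0 QF).
(* The distance from [b] to the closed set [span s]; it bounds the coefficient of [b] in [key]. *)
have [r r0 hr] := closed_dist cs bs.
have key a y : Qp a -> span s y -> r * absv a <= absv (a * b + y).
  move=> Qa sy; have [->|a0] := eqVneq a 0; first by rewrite abs0 mulr0.
  have -> : a * b + y = a * (b - (- (a^-1 * y))) by field.
  rewrite absM mulrC ler_wpM2l// hr//; apply: spanN; apply: spanZ => //.
  exact: (subV QF).
split=> [x h|t].
  have [u su ux] := seq_limit h.
  have /choice[v hv] : forall n, exists ay, [/\ Qp ay.1, span s ay.2 & u n = ay.1 * b + ay.2].
    by move=> n; have /span_cons[a [y [Qa sy uE]]] := su n; exists (a, y).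
  have va : abs_cauchy (fun n => (v n).1).
    move=> e e0; have [N hN] := tends_cauchy ux (mulr_gt0 r0 e0); exists N => m n Nm Nn.
    have [Qm sm um] := hv m; have [Qn sn un] := hv n.
    rewrite -(ltr_pM2l r0) (le_lt_trans _ (hN m n Nm Nn))// um un.
    have -> : (v m).1 * b + (v m).2 - ((v n).1 * b + (v n).2) =
      ((v m).1 - (v n).1) * b + ((v m).2 - (v n).2) by ring.
    by apply: key; [exact: (subB QF)|apply: spanD => //; exact: spanN].
  have [a ua] := complete va.
  have Qa : Qp a by apply: (closed_seq Qp_closed) ua => n; case: (hv n).
  apply/span_cons; exists a, (x - a * b); split => //; last by rewrite addrC subrK.
  apply: (closed_seq (u := fun n => (v n).2) cs) => [n|e e0]; first by case: (hv n).
  have b1 : 0 < absv b + 1 by rewrite ltr_wpDl.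
  have [N1 h1] := ux _ e0; have [N2 h2] := ua _ (divr_gt0 e0 b1).
  exists (maxn N1 N2) => n; rewrite geq_max => /andP[n1 n2].
  have [_ _ un] := hv n.
  have -> : (v n).2 - (x - a * b) = (u n - x) - ((v n).1 - a) * b by rewrite un; ring.
  apply: absD_lt; first exact: h1.
  rewrite absN absM (le_lt_trans (_ : _ <= absv ((v n).1 - a) * (absv b + 1)))//.
    by rewrite ler_wpM2l// lerDl.
  by rewrite -ltr_pdivlMr// h2.
have tb := tot_boundedD (tot_bounded_scale b (Qp_ball_tot_bounded (t / r)))
  (ts (Num.max t (t / r * absv b))).
apply: tot_bounded_subset tb => x [/span_cons[a [y [Qa sy xE]]] xt].
have ar : absv a <= t / r.
  by rewrite ler_pdivlMr// mulrC (le_trans (key a y Qa sy))// -xE.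
exists (b * a), y; split; first by exists a.
  split => //=; have -> : y = x - a * b by rewrite xE addrAC subrr add0r.
  by apply: absB_le; rewrite le_max ?xt// absM ler_wpM2r ?orbT.
by rewrite mulrC.
Qed.

Lemma finite_ext_span (L : set C) : finite_ext_Qp absv L -> exists s, L = span s.
Proof.
move=> [LF QL [s [sL Ls]]]; exists s; apply/predeqP => x; split=> [/Ls//|[c [Qc ->]]].
apply: (sub_sum LF) => i _; apply: (subM LF); first exact: QL.
by apply: sL; rewrite mem_nth.
Qed.

Lemma finite_ext_loc_compact (L : set C) : finite_ext_Qp absv L -> loc_compact L.
Proof. by move=> /finite_ext_span[s ->]; exact: span_loc_compact. Qed.

Lemma adjoin_finite (K : set C) y : finite_ext_Qp absv K -> algebraic_over K y ->
  finite_ext_Qp absv (adjoin K y).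
Proof.
move=> KE Ky; have [KF QK [s [sK Ks]]] := KE.
have KL := @adjoin_contains _ _ KF y.
have LF := adjoin_subfield KF Ky.
split => //; first by move=> x /QK/KL.
have [n hn] := adjoin_bounded KF Ky.
exists [seq b * y ^+ i | b <- s, i <- iota 0 n]; split=> [x /allpairsP[[b i] /= [bs _ ->]]|x Lx].
  apply: (subM LF); first by apply: KL; exact: sK.
  by apply: (subX LF); exact: (adjoin_gen KF).
have [q Kq [qn ->]] := hn x Lx.
have -> : q.[y] = \sum_(i < n) q`_i * y ^+ i.
  rewrite horner_coef (big_ord_widen n (fun i => q`_i * y ^+ i) qn) [RHS](bigID (fun i : 'I_n => (i < size q)%N)) /=.
  rewrite [X in _ = _ + X]big1 ?addr0// => i; rewrite -leqNgt => iq.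
  by rewrite nth_default// mul0r.
apply: span_sum => i _; have [c [Qc ->]] := Ks _ (Kq i).
rewrite mulr_suml; apply: span_sum => j _; rewrite -mulrA; apply: spanZ => //.
apply: span_mem; apply/allpairsP; exists (s`_j, nat_of_ord i).
by split; rewrite /= ?mem_nth// mem_iota /= add0n.
Qed.

Lemma algebraic_over_subset (K L : set C) y : K `<=` L -> algebraic_over K y -> algebraic_over L y.
Proof. by move=> KL [q [q0 Kq qy]]; exists q; split => // i; exact: KL. Qed.

Lemma adjoin_seq (K : set C) s : finite_ext_Qp absv K ->
  (forall y, y \in s -> algebraic_over K y) ->
  exists L, [/\ finite_ext_Qp absv L, K `<=` L & forall y, y \in s -> L y].
Proof.
move=> KE; elim: s => [|y s IH] h; first by exists K; split.
have [|L [LE KL sL]] := IH; first by move=> x xs; apply: h; rewrite in_cons xs orbT.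
have Ly : algebraic_over L y by apply: algebraic_over_subset KL _; apply: h; rewrite mem_head.
have LF : is_subfield L by case: LE.
have LL := @adjoin_contains _ _ LF y.
exists (adjoin L y); split; first exact: adjoin_finite.
  by move=> x /KL/LL.
by move=> x; rewrite in_cons => /orP[/eqP ->|/sL/LL//]; exact: (adjoin_gen LF).
Qed.

(** Heine-Borel for discs whose radius depends on the center, the form in which pointwise expansion
    is made uniform. *)
Definition disc_compact (S : set C) := forall r : C -> R, (forall x, S x -> 0 < r x) ->
  exists2 s : seq C, (forall y, y \in s -> S y) &
    forall x, S x -> exists2 y, y \in s & absv (x - y) < r y.

(** Without a finite subcover there are nested pieces of radius [|p| ^ n] without one. Their limit
    point lies in [S], and its own disc covers a late piece. *)
Lemma closed_tot_bounded_compact (S : set C) : closed_set S -> tot_bounded S -> disc_compact S.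
Proof.
move=> cS tS r r0; apply: contrapT => nS.
pose bad (T : set C) := ~ exists2 s : seq C, (forall y, y \in s -> S y) &
    forall x, T x -> exists2 y, y \in s & absv (x - y) < r y.
have split_bad T e : 0 < e -> T `<=` S -> bad T ->
    exists y, S y /\ bad (T `&` [set x | absv (x - y) < e]).
  move=> e0 TS Tbad; apply: contrapT => h; apply: Tbad.
  have [s sS hs] := tS e e0.
  have /choice[F hF] : forall y, exists t : seq C, S y -> (forall x, x \in t -> S x) /\
      forall x, T x -> absv (x - y) < e -> exists2 z, z \in t & absv (x - z) < r z.
    move=> y; have [Sy|nSy] := pselect (S y); last by exists [::].
    apply: contrapT => h'; apply: h; exists y; split => // -[t tS' ht]; apply: h'.
    by exists t => _; split => // x Tx xy; apply: ht.
  exists (flatten [seq F y | y <- s]) => [z /flatten_mapP[y ys zF]|x Tx].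
    by have [h1 _] := hF y (sS y ys); exact: h1.
  have [y ys xy] := hs x (TS x Tx); have [_ h2] := hF y (sS y ys).
  by have [z zF xz] := h2 x Tx xy; exists z => //; apply/flatten_mapP; exists y.
pose Y T e := xget 0 [set y | S y /\ bad (T `&` [set x | absv (x - y) < e])].
pose fix T n := if n is n.+1 then
  T n `&` [set x | absv (x - Y (T n) (absv (p%:R : C) ^+ n)) < absv (p%:R : C) ^+ n] else S.
have Tbad n : T n `<=` S /\ bad (T n).
  elim: n => [|n [h1 h2]]; first by split.
  have [y hy] := split_bad _ _ (eps_gt0 n) h1 h2.
  have ex : exists y, [set y | S y /\ bad (T n `&` [set x | absv (x - y) <
    absv (p%:R : C) ^+ n])] y by exists y.
  have [_ h3] := xgetPex 0 ex.
  by split => //= x [/h1].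
have Tne n : exists x, T n x.
  have [_ h] := Tbad n; apply: contrapT => h'; apply: h; exists [::] => // x Tx.
  by case: h'; exists x.
have /choice[u hu] := Tne.
have Tmono m n : (m <= n)%N -> T n `<=` T m.
  by move=> mn; rewrite -(subnK mn); elim: (n - m)%N => // k IH x; rewrite addSn => -[/IH].
have Tclose m n x y : (m < n)%N -> T n x -> T m.+1 y -> absv (x - y) < absv (p%:R : C) ^+ m.
  by move=> mn /(Tmono _ _ mn)[_ /= h1] [_ /= h2]; rewrite (abs_tri_lt h1)// absC.
have cu : abs_cauchy u.
  move=> e e0; have [k hk] := abs_p_exp_small (HC := HC) e0; exists k.+1 => m n km kn.
  rewrite (lt_trans _ hk)// absX (Tclose k m)//.
  exact: Tmono kn _ (hu n).
have [l ul] := complete cu.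
have Sl : S l by apply: (closed_seq cS) ul => n; case: (Tbad n) => h _; exact: h.
have [k hk] := abs_p_exp_small (HC := HC) (r0 l Sl).
have [_ h] := Tbad k.+1; apply: h; exists [:: l] => [y|x Tx]; first by rewrite inE => /eqP ->.
exists l; first by rewrite inE.
rewrite (lt_trans _ hk)// absX.
have [N hN] := ul _ (eps_gt0 k).
have h1 : absv (u (maxn N k.+1) - l) < absv (p%:R : C) ^+ k by rewrite hN// leq_maxl.
rewrite (abs_tri_lt _ h1)// absC (Tclose k (maxn N k.+1))//.
by rewrite leq_maxr.
Qed.

End Qp.
Arguments closed_set {R C} absv S.
Arguments tot_bounded {R C} absv S.
Arguments loc_compact {R C} absv S.
Arguments disc_compact {R C} absv S.
Arguments abs_cauchy {R C} absv u.
Arguments abs_tends {R C} absv u l.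
Arguments field_ball {R C} absv S r.
Arguments span {R C} absv s.

(** * Local degree and univalent discs *)

Section LocalDegree.
Context {R : realType} {C : closedFieldType} {absv : C -> R} {p : nat}.
Context {HC : padic_field absv p}.
Context {P Q : {poly C}} {HPQ : good_map P Q}.
Variable G : region absv P Q.
Implicit Types (a b x y z u v w : C) (r s t e : R).
Notation f := (ratf P Q).
Notation df := (rat_deriv P Q).
Notation psi := (psi absv P Q).
Notation d := (regd G).
Notation B := (regB G). Notation q0 := (regq G).
Notation m0 := (absv ((rdeg P Q)`!)%:R).
Notation W := (wronsk P Q).

Lemma gaussn_deriv1 (q : {poly C}) : gaussn absv 1 q^`() <= gaussn absv 1 q.
Proof.
apply: gaussn_le => // i _; rewrite (le_trans _ (gaussn_ge 1 q i.+1))//.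
rewrite !expr1n !mulr1 coef_deriv (absMn (HC := HC) q`_i.+1) -[leRHS]mulr1.
by rewrite ler_wpM2l// abs_nat_le1.
Qed.

(** The ramification index: the order of vanishing of [f - f a] at [a]. *)
Definition locdeg a : nat := find (fun c => c != 0) (diffp P Q a).
Definition loccoef a : R := absv (diffp P Q a)`_(locdeg a) / absv Q.[a] ^+ 2.

Lemma locdeg_bound a : inG G a -> (0 < locdeg a <= rdeg P Q)%N.
Proof.
move=> aG; have D0 : diffp P Q a != 0 by rewrite diffp_neq0// (inG_Q aG).
have hD : has (fun c => c != 0) (diffp P Q a).
  apply/hasP; exists (lead_coef (diffp P Q a)); last by rewrite lead_coef_eq0.
  by rewrite lead_coefE mem_nth// prednK ?size_poly_gt0.
have lt : (locdeg a < size (diffp P Q a))%N by rewrite -has_find.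
apply/andP; split; last by rewrite -ltnS (leq_trans lt)// size_diffp.
rewrite lt0n; apply/negP => /eqP e0; have := nth_find 0 hD.
by rewrite -/(locdeg a) e0 diffp_coef0 eqxx.
Qed.

Lemma locdeg_neq0 a : inG G a -> (diffp P Q a)`_(locdeg a) != 0.
Proof.
move=> aG; have D0 : diffp P Q a != 0 by rewrite diffp_neq0// (inG_Q aG).
apply: (nth_find 0 (a := fun c => c != 0)); apply/hasP.
exists (lead_coef (diffp P Q a)); last by rewrite lead_coef_eq0.
by rewrite lead_coefE mem_nth// prednK ?size_poly_gt0.
Qed.

Lemma locdeg_before a i : (i < locdeg a)%N -> (diffp P Q a)`_i = 0.
Proof. by move=> /(before_find 0)/negbFE/eqP. Qed.

Lemma locdeg1 a : inG G a -> W.[a] != 0 -> locdeg a = 1%N.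
Proof.
move=> aG Wa; have /andP[e0 _] := locdeg_bound aG; apply/eqP; rewrite eqn_leq e0 andbT.
by rewrite leqNgt; apply: contra Wa => /locdeg_before; rewrite diffp_coef1 => ->.
Qed.

Lemma loccoef_gt0 a : inG G a -> 0 < loccoef a.
Proof.
by move=> aG; rewrite divr_gt0 ?exprn_gt0 ?abs_gt0 ?(locdeg_neq0 aG) ?(inG_Q aG).
Qed.

Lemma abs_locdeg_ge a : inG G a -> m0 <= absv (locdeg a)%:R.
Proof. by move=> /locdeg_bound h; exact: abs_fact. Qed.

(** The three values are those of a monomial [b u ^ e]. In the last one [|e|] is less than 1 when
    [p] divides [e]: the derivative may be smaller than the ratio of radii. *)
Definition normal_at a e := forall u, absv u <= e ->
  [/\ psi a (absv u) = loccoef a * absv u ^+ locdeg a,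
      absv (f (a + u) - f a) = loccoef a * absv u ^+ locdeg a &
      absv (df (a + u)) * absv u =
        absv (locdeg a)%:R * (loccoef a * absv u ^+ locdeg a)].

(* Close to a point, the map is governed by the first nonzero Taylor coefficient. *)
Lemma normal_exists a : inG G a -> exists2 e : R, 0 < e <= d & normal_at a e.
Proof.
move=> aG; have [aM aq] := aG; set j := locdeg a; set N := diffp P Q a.
have /andP[j0 jd] := locdeg_bound aG; have nj : 0 < absv N`_j by rewrite abs_gt0 locdeg_neq0.
have m00 := m0_gt0 (HC := HC) P Q; have m01 := m0_le1 (HC := HC) P Q.
(* The second entry makes the higher monomials smaller by a factor [m0], so the leading one still
   dominates after differentiation; the third makes the term with the derivative of [Q] in the
   quotient rule negligible. *)
pose e := Num.min d (Num.min (m0 * absv N`_j / 2 / B ^+ 2) (m0 * q0 / 2 / B)).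
have e0 : 0 < e by rewrite !lt_min regd0 !divr_gt0 ?exprn_gt0 ?mulr_gt0.
have ed : e <= d by rewrite ge_min lexx.
have eN : e * B ^+ 2 < m0 * absv N`_j.
  rewrite (@le_lt_trans _ _ (m0 * absv N`_j / 2))//.
    by rewrite -ler_pdivlMr ?exprn_gt0// !ge_min lexx !orbT.
  by rewrite gtr_pMr ?invf_lt1 ?ltr1n// mulr_gt0.
have eQ : e * B < m0 * q0.
  rewrite (@le_lt_trans _ _ (m0 * q0 / 2))//.
    by rewrite -ler_pdivlMr// !ge_min lexx !orbT.
  by rewrite gtr_pMr ?invf_lt1 ?ltr1n// mulr_gt0.
exists e; first by rewrite e0.
move=> u ue; have ud := le_trans ue ed; have u1 := le_trans ud (regd1 G).
have [->|u0] := eqVneq u 0.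
  rewrite addr0 subrr abs0 expr0n eqn0Ngt j0 !mulr0; split => //.
  apply/eqP; rewrite eq_le psi_ge0 andbT.
  by have := @psi_le _ _ _ _ HC _ _ G a 0 aG; rewrite lexx ler01 mulr0; apply.
have up : 0 < absv u by rewrite abs_gt0.
have small i : (j < i)%N -> absv N`_i * absv u ^+ i < m0 * absv N`_j * absv u ^+ j.
  move=> ji; have -> : i = ((i - j.+1).+1 + j)%N by rewrite addSnnS subnK.
  rewrite exprD mulrA ltr_pM2r ?exprn_gt0// (le_lt_trans _ eN)// exprS mulrC -mulrA.
  rewrite (le_trans (ler_wpM2r _ ue)) ?mulr_ge0 ?exprn_ge0// ler_wpM2l ?(ltW e0)//.
  rewrite (le_trans _ (gaussn_diffp1 aG))// (le_trans _ (gaussn_ge 1 N ((i - j.+1).+1 + j)%N))//.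
  by rewrite expr1n mulr1 ler_piMl// exprn_ile1.
have dom i : (i < size N)%N -> i != j -> absv N`_i * absv u ^+ i < absv N`_j * absv u ^+ j.
  move=> _ ij; have [ltij|ltji|E] := ltngtP i j; last by rewrite E eqxx in ij.
    by rewrite locdeg_before// abs0 mul0r mulr_gt0 ?exprn_gt0.
  rewrite (lt_le_trans (small i ltji))// -mulrA ler_piMl// mulr_ge0 ?exprn_ge0//.
have Nu : absv N.[u] = absv N`_j * absv u ^+ j.
  by apply: (horner_dominant up dom); rewrite -(abs_gt0 (absv := absv)).
have E1 : loccoef a * absv u ^+ j = absv N`_j * absv u ^+ j / absv Q.[a] ^+ 2.
  by rewrite /loccoef mulrAC.
split.
- by rewrite /psi (gaussn_dominant up dom) E1.
- by rewrite (ratf_abs_near aG ud) Nu E1.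
- rewrite rat_derivE absf_div absX (Q_abs_near aG ud) E1 mulrAC mulrA; congr (_ / _).
  have a0 : 0 < absv Q.[a] by rewrite abs_gt0 (inG_Q aG).
  apply: (mulfI (x := absv Q.[a])); first by rewrite gt_eqF.
  have I : Q.[a] * W.[a + u] = N^`().[u] * Q.[a + u] - N.[u] * (shiftp Q a)^`().[u].
    rewrite -(shiftp_horner W) -hornerZ -diffp_deriv hornerD hornerN !hornerM.
    by rewrite shiftp_horner.
  transitivity (absv (u * (N^`().[u] * Q.[a + u] - N.[u] * (shiftp Q a)^`().[u]))).
    by rewrite -I !absM; ring.
  rewrite mulrBr.
  have N'u : absv (u * N^`().[u]) = absv j%:R * (absv N`_j * absv u ^+ j).
    rewrite absM.
    have dom' i : (i < size N^`())%N -> i != j.-1 ->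
        absv N^`()`_i * absv u ^+ i < absv N^`()`_j.-1 * absv u ^+ j.-1.
      move=> _ ij; rewrite !coef_deriv prednK// -(ltr_pM2r up) -!mulrA -!exprSr prednK//.
      rewrite (absMn (HC := HC) N`_i.+1) (absMn (HC := HC) N`_j).
      have [ltij|leji] := ltnP i.+1 j.
        rewrite locdeg_before// abs0 !mul0r mulr_gt0 ?mulr_gt0 ?exprn_gt0//.
        by rewrite abs_nat_gt0.
      have ji : (j < i.+1)%N.
        by rewrite ltn_neqAle leji andbT; apply: contra ij => /eqP ->.
      rewrite (le_lt_trans (_ : _ <= absv N`_i.+1 * absv u ^+ i.+1))//.
        by rewrite mulrAC ler_piMr ?mulr_ge0 ?exprn_ge0// abs_nat_le1.
      rewrite (lt_le_trans (small _ ji))// ler_wpM2r ?exprn_ge0// mulrC ler_wpM2l//.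
      exact: abs_locdeg_ge.
    rewrite (horner_dominant up dom').
      rewrite coef_deriv prednK// (absMn (HC := HC) N`_j) mulrC -!mulrA -exprSr prednK//.
      by rewrite mulrCA.
    rewrite coef_deriv prednK// -mulr_natr mulf_neq0 ?natC_neq0//.
    by rewrite -(abs_gt0 (absv := absv)).
  have big : absv (u * (N^`().[u] * Q.[a + u])) =
      absv j%:R * (absv N`_j * absv u ^+ j) * absv Q.[a].
    by rewrite [X in absv X]mulrA [LHS]absM N'u (Q_abs_near aG ud).
  rewrite [LHS]absDl big; first by rewrite mulrC.
  rewrite absN !absM Nu.
  have Q'u : absv (shiftp Q a)^`().[u] <= B.
    rewrite (le_trans (gaussn_horner _ u1))// (le_trans (gaussn_deriv1 _))//.
    exact: gaussn_shiftQ.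
  set X := absv N`_j * absv u ^+ j; have X0 : 0 < X by rewrite mulr_gt0 ?exprn_gt0.
  rewrite (_ : absv u * (X * _) = X * (absv u * absv (shiftp Q a)^`().[u])); last by rewrite mulrCA.
  rewrite (_ : _ * X * _ = X * (absv j%:R * absv Q.[a])); last by rewrite mulrAC mulrC.
  rewrite ltr_pM2l//.
  rewrite (le_lt_trans (ler_pM _ _ ue Q'u))// (lt_le_trans eQ)//.
  by rewrite ler_pM ?(ltW m00) ?(ltW (regq0 G))// abs_locdeg_ge.
Qed.

Lemma normal_le a e e' : e' <= e -> normal_at a e -> normal_at a e'.
Proof. by move=> ee h u ue; apply: h; exact: le_trans ee. Qed.

End LocalDegree.
Arguments locdeg {C} P Q a.
Arguments loccoef {R C} absv P Q a.
Arguments normal_at {R C} absv P Q a e.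

(** * Derivatives and linear discs along orbits *)

Section Derivatives.
Context {R : realType} {C : closedFieldType} {absv : C -> R} {p : nat}.
Context {HC : padic_field absv p}.
Context {P Q : {poly C}} {HPQ : good_map P Q}.
Variable G : region absv P Q.
Implicit Types (a b x y z u v w : C) (r s t e : R).
Notation f := (ratf P Q).
Notation df := (rat_deriv P Q).
Notation psi := (psi absv P Q).
Notation rad := (disc_rad absv P Q).
Notation d := (regd G). Notation L := (regL G).
Notation k := (regk G).
Notation m0 := (absv ((rdeg P Q)`!)%:R).
Notation W := (wronsk P Q).

Lemma seq_radius (T : eqType) (s : seq T) (A : T -> R -> Prop) :
  (forall (x : T) e e', 0 < e' <= e -> A x e -> A x e') ->
  (forall x : T, x \in s -> exists2 e : R, 0 < e & A x e) ->
  exists2 e : R, 0 < e & forall x : T, x \in s -> A x e.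
Proof.
move=> mono; elim: s => [|x s IH] h; first by exists 1.
have [|e e0 he] := IH; first by move=> y ys; apply: h; rewrite in_cons ys orbT.
have [e' e'0 he'] := h x (mem_head _ _).
have m0 : 0 < Num.min e e' by rewrite lt_min e0.
exists (Num.min e e') => // y; rewrite in_cons => /orP[/eqP ->|ys].
  by apply: mono he'; rewrite m0 ge_min lexx orbT.
by apply: mono (he y ys); rewrite m0 ge_min lexx.
Qed.

(* By the chain rule, the absolute value of the derivative of the [n]-th iterate. *)
Fixpoint gder z n : R := if n is n.+1 then gder z n * absv (df (iter n f z)) else 1.

Lemma gder_shift z m n : gder z (m + n) = gder z m * gder (iter m f z) n.
Proof. by elim: n => [|n IH]; rewrite ?addn0 ?mulr1// addnS /= IH mulrA addnC iterD. Qed.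

Lemma gder_ge0 z n : 0 <= gder z n.
Proof. by elim: n => //= n IH; rewrite mulr_ge0. Qed.

Lemma gder_S z n : gder z n.+1 = absv (df z) * gder (f z) n.
Proof. by rewrite -add1n gder_shift /= mul1r. Qed.

Lemma gder_gt0 z n : (forall i, (i < n)%N -> inG G (iter i f z) /\ W.[iter i f z] != 0) ->
  0 < gder z n.
Proof.
elim: n => //= n IH h; rewrite mulr_gt0//; first by apply: IH => i ni; apply: h; rewrite ltnS ltnW.
have [zG Wz] := h n (ltnSn n).
by rewrite rat_derivE absf_div absX divr_gt0 ?exprn_gt0 ?abs_gt0// (inG_Q zG).
Qed.

(** The successive images of the disc are discs of radius [gder z i * s] on which the map is linear,
    so the [n]-th iterate is a similarity of ratio [gder z n] ([lin_orbit_isom]). *)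
Definition lin_orbit z s n := forall i, (i < n)%N -> lin_radius G (iter i f z) (gder z i * s).

Lemma lin_orbitW z s m n : (m <= n)%N -> lin_orbit z s n -> lin_orbit z s m.
Proof. by move=> mn h i im; apply: h; exact: leq_trans mn. Qed.

Lemma lin_orbit_gt0 z s n : inGorb G z -> 0 < s -> lin_orbit z s n -> 0 < gder z n.
Proof.
move=> zG s0; elim: n => //= n IH h.
have gn : 0 < gder z n by apply: IH => i ni; rewrite /lin_radius; apply: h; rewrite ltnS ltnW.
by rewrite mulr_gt0// (df_gt0 (zG n) _ (h n (ltnSn n)))// mulr_gt0.
Qed.

Lemma lin_orbit_rad z s n : inGorb G z -> 0 < s -> lin_orbit z s n -> rad z s n = gder z n * s.
Proof.
move=> zG s0; elim: n => [|n IH] h; first by rewrite /= mul1r.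
have hn := lin_orbitW (leqnSn n) h.
rewrite /= IH// (psi_lin (zG n) _ (h n (ltnSn n))).
  by rewrite mulrCA mulrA.
by rewrite mulr_gt0// (lin_orbit_gt0 zG s0 hn).
Qed.

Lemma lin_orbit_isom z s n u v : inGorb G z -> 0 < s -> lin_orbit z s n ->
  absv u <= s -> absv v <= s ->
  absv (iter n f (z + u) - iter n f (z + v)) = gder z n * absv (u - v).
Proof.
move=> zG s0; elim: n u v => [|n IH] u v h us vs.
  by rewrite /= mul1r opprD addrACA subrr add0r.
have hn := lin_orbitW (leqnSn n) h.
have gn := lin_orbit_gt0 zG s0 hn.
have near w : absv w <= s -> absv (iter n f (z + w) - iter n f z) <= gder z n * s.
  move=> ws; have := IH w 0 hn ws; rewrite abs0 addr0 subr0 => /(_ (ltW s0)) ->.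
  by rewrite ler_wpM2l// ltW.
have E w : f (iter n f (z + w)) = f (iter n f z + (iter n f (z + w) - iter n f z)).
  by rewrite [_ + (_ - _)]addrC subrK.
rewrite !iterS !E (ratf_isom (zG n) _ (h n (ltnSn n)) (near u us) (near v vs)).
  by rewrite opprB addrA subrK IH// mulrCA mulrA.
by rewrite mulr_gt0.
Qed.

Lemma lin_orbit_near z s n u : inGorb G z -> 0 < s -> lin_orbit z s n ->
  absv u <= s -> absv (iter n f (z + u) - iter n f z) = gder z n * absv u.
Proof.
move=> zG s0 h us; have := lin_orbit_isom zG s0 h us (v := 0).
by rewrite abs0 addr0 subr0 => /(_ (ltW s0)).
Qed.

Lemma lin_orbit_gder z s n u : inGorb G z -> 0 < s -> lin_orbit z s n ->
  absv u <= s -> gder (z + u) n = gder z n.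
Proof.
move=> zG s0; elim: n => //= n IH h us.
have hn := lin_orbitW (leqnSn n) h; have gn := lin_orbit_gt0 zG s0 hn.
rewrite IH//; congr (_ * _); rewrite -(subrK (iter n f z) (iter n f (z + u))) addrC.
apply: (df_near (zG n) _ (h n (ltnSn n))); first by rewrite mulr_gt0.
by rewrite (lin_orbit_near zG s0 hn us) ler_wpM2l// ltW.
Qed.

Lemma lin_orbit_inG z s n u : inGorb G z -> 0 < s -> lin_orbit z s n ->
  absv u <= s -> forall i, (i < n)%N -> inG G (iter i f (z + u)).
Proof.
move=> zG s0 h us i ni; rewrite -(subrK (iter i f z) (iter i f (z + u))) addrC.
have hi := lin_orbitW (ltnW ni) h; have gi := lin_orbit_gt0 zG s0 hi.
apply: (inG_near (zG i)); rewrite (lin_orbit_near zG s0 hi us).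
have [hk _] := h i ni.
by rewrite (le_trans _ (regk_le_d G))// (le_trans _ hk)// ler_wpM2l// ltW.
Qed.

(* Small discs shrink along a superattracting cycle. *)
Lemma expansive_periodic z n : (0 < n)%N -> iter n f z = z -> expansive G z -> W.[z] != 0.
Proof.
move=> n0 zn [zG zE]; apply/negP => /eqP Wz.
have psi2 s : 0 <= s <= 1 -> psi z s <= L * s ^+ 2.
  move=> s01; rewrite /psi ler_pdivrMr ?exprn_gt0 ?abs_gt0 ?(inG_Q (zG 0%N))//.
  have := @gaussn_shrink _ _ absv p HC 1 s (diffp P Q z) 2 ler01 s01.
  rewrite mulr1 => /(_ _)/le_trans -> //.
    by move=> [|[|//]] _; rewrite ?diffp_coef0// diffp_coef1.
  rewrite [leRHS](_ : _ = s ^+ 2 * (L * absv Q.[z] ^+ 2)); last by ring.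
  rewrite ler_wpM2l ?exprn_ge0//; first by case/andP: s01.
  rewrite (le_trans (gaussn_diffp1 (zG 0%N)))// (le_trans (regBL G))//.
  rewrite ler_wpM2l ?(ltW (regL0 G))// lerXn2r// ?nnegrE ?(ltW (regq0 G))//.
  by case: (zG 0%N).
have Ln i : 0 < L ^+ i by rewrite exprn_gt0.
have L1 i : 1 <= L ^+ i by rewrite exprn_ege1// regL1.
(* With [L ^ n s = d], one quadratic step, bounded by [L s ^ 2], and [n - 1] Lipschitz steps give a
   radius at most [d s <= s]: the disc returns no larger than it was. *)
pose s := d / L ^+ n.
have s0 : 0 < s by rewrite divr_gt0.
have Ls : L ^+ n * s = d by rewrite mulrC divfK// gt_eqF.
have sd i : (i <= n)%N -> L ^+ i * s <= d.
  move=> i_n; rewrite -Ls ler_wpM2r ?(ltW s0)// -(subnK i_n) exprD.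
  by rewrite ler_peMl ?(ltW (Ln _)).
have s1 : s <= 1 by have := sd 0%N isT; rewrite expr0 mul1r => /le_trans->//; exact: regd1.
have back : rad z s n <= s.
  case: n n0 zn Ln L1 @s s0 Ls sd s1 => // n _ zn Ln L1 s s0 Ls sd s1.
  rewrite -add1n rad_shift /=.
  have p1 : psi z s <= L * s ^+ 2 by apply: psi2; rewrite ltW.
  have h1 : L ^+ n * psi z s <= s.
    rewrite (le_trans (ler_wpM2l (ltW (Ln _)) p1))// mulrA -exprSr expr2 mulrA Ls.
    by rewrite ler_piMl ?(ltW s0) ?regd1.
  have zG' : inGorb G (f z) by move=> i; rewrite -iterSr.
  by rewrite (le_trans (rad_le_exp zG' _ (le_trans h1 s1)))// psi_ge0.
have all m : rad z s (m * n) <= s.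
  elim: m => // m IH; rewrite mulSn addnC rad_shift.
  have -> : iter (m * n) f z = z by elim: (m) => //= m' IH'; rewrite mulSn iterD IH'.
  by rewrite (le_trans _ back)// rad_mono// rad_ge0 ?IH// ltW.
have [j] := zE s s0; rewrite (divn_eq j n) rad_shift.
have -> : iter (j %/ n * n) f z = z by elim: (j %/ n)%N => //= m' IH'; rewrite mulSn iterD IH'.
rewrite ltNge => /negP; apply.
have jn : (j %% n <= n)%N by rewrite ltnW// ltn_pmod.
have rj : 0 <= rad z s (j %/ n * n) <= s by rewrite all rad_ge0// ltW.
rewrite (le_trans (rad_mono z (j %% n) rj))//.
rewrite (le_trans (rad_le_exp zG (ltW s0) _)) ?sd//.
by rewrite (le_trans (sd _ jn)) ?regd1.
Qed.

Section InvariantSet.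
Variable A : seq C.
Hypothesis AE : forall a, a \in A -> expansive G a.
Hypothesis Af : forall a, a \in A -> f a \in A.

Lemma A_iter a n : a \in A -> iter n f a \in A.
Proof. by move=> aA; elim: n => //= n; exact: Af. Qed.

Lemma A_inG a : a \in A -> inG G a.
Proof. by move=> /AE[h _]; exact: (h 0%N). Qed.

(** After [size A] steps the orbit is on its cycle, and an expansive cycle contains no critical
    point. *)
Lemma locdeg_late a n : a \in A -> (size A <= n)%N -> locdeg P Q (iter n f a) = 1%N.
Proof.
move=> aA An; apply: (locdeg1 (A_inG (A_iter n aA))).
have [i [j [ij jn' E]]] := seq_pigeonhole (fun i => A_iter i aA) An.
apply: (@expansive_periodic _ (j - i)%N); rewrite ?subn_gt0//; last first.
  by apply: expansive_iter; exact: AE.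
have En : iter n f a = iter (n - j) f (iter i f a) by rewrite E -iterD subnK.
by rewrite {1}En -!iterD; congr iter; lia.
Qed.

(** The accumulated gap between derivative and ratio of radii along the orbit of [a]; by
    [locdeg_late] only its first [size A] factors can differ from 1. *)
Definition emul a n := \prod_(i < n) absv (locdeg P Q (iter i f a))%:R.

Lemma emulS a n : emul a n.+1 = emul a n * absv (locdeg P Q (iter n f a))%:R.
Proof. by rewrite /emul big_ord_recr. Qed.

Lemma emul_ge0 a n : 0 <= emul a n.
Proof. by apply: prodr_ge0. Qed.

Lemma emul_le1 a n : emul a n <= 1.
Proof.
elim: n => [|n IH]; first by rewrite /emul big_ord0.
by rewrite emulS mulr_ile1 ?emul_ge0 ?abs_nat_le1.
Qed.

Lemma emul_ge a n : a \in A -> m0 ^+ size A <= emul a n.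
Proof.
move=> aA; have m00 := m0_gt0 (HC := HC) P Q; have m01 := m0_le1 (HC := HC) P Q.
rewrite (@le_trans _ _ (m0 ^+ minn n (size A)))//.
  by rewrite ler_wiXn2l ?(ltW m00)// geq_minr.
elim: n => [|n IH]; first by rewrite min0n expr0 /emul big_ord0.
rewrite emulS; have [nA|An] := ltnP n (size A).
  rewrite (minn_idPl nA) exprSr ler_pM ?exprn_ge0 ?(ltW m00)//.
    by move: IH; rewrite (minn_idPl (ltnW nA)).
  by apply: abs_locdeg_ge; apply: A_inG; exact: A_iter.
rewrite (minn_idPr (leqW An)) locdeg_late// abs1 mulr1.
by move: IH; rewrite (minn_idPr An).
Qed.

Variable eA : R.
Hypotheses (eA0 : 0 < eA) (eAd : eA <= d).
Hypothesis Anormal : forall a, a \in A -> normal_at absv P Q a eA.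

Lemma follow a u n : a \in A -> (forall i, (i < n)%N -> rad a (absv u) i <= eA) ->
  absv (iter n f (a + u) - iter n f a) = rad a (absv u) n /\
  gder (a + u) n * absv u = emul a n * rad a (absv u) n.
Proof.
move=> aA; elim: n => [|n IH] h.
  by rewrite /= addrAC subrr add0r /emul big_ord0.
have [|E1 E2] := IH; first by move=> i ni; apply: h; rewrite ltnS ltnW.
have En : iter n f (a + u) = iter n f a + (iter n f (a + u) - iter n f a).
  by rewrite [_ + (_ - _)]addrC subrK.
have Un : absv (iter n f (a + u) - iter n f a) <= eA by rewrite E1 h.
have [F1 F2 F3] := Anormal (A_iter n aA) Un.
rewrite /= -E1 F1 {1}En F2; split => //.
rewrite -En in F3.
by rewrite emulS mulrAC E2 -E1 -[LHS]mulrA [X in _ * X = _]mulrC F3 mulrA.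
Qed.

Lemma exit_time a s : a \in A -> 0 < s -> exists2 n, eA < rad a s n &
  forall i, (i < n)%N -> rad a s i <= eA.
Proof.
move=> aA s0; have [_ aE] := AE aA; have [m hm] := aE s s0.
have [|n hn hmin] := @first_nat (fun n => eA < rad a s n).
  by exists m; rewrite (le_lt_trans eAd).
by exists n => // i /hmin; rewrite -leNgt.
Qed.

Hypothesis Acrit : forall a c, a \in A -> c \in crits P Q -> c != a -> eA < absv (a - c).

(* Univalent discs around [x] can be pushed forward to a definite size: the first obstruction
   is a critical point [c] in [A] very close to the orbit, and then the disc of radius
   proportional to the distance to [c] is carried along the orbit of [c] until it gets
   large, because [c] is expansive. *)
Lemma univalent_to_scale x : expansive G x -> (forall n, iter n f x \notin A) ->
  (forall n c, c \in crits P Q -> absv (iter n f x - c) < eA -> c \in A) ->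
  exists2 d1 : R, 0 < d1 & forall s0 : R, 0 < s0 -> exists s n,
    [/\ 0 < s, s <= s0, lin_orbit x s n & d1 <= gder x n * s].
Proof.
move=> [xG xE] xA xc.
have m00 := m0_gt0 (HC := HC) P Q; have m01 := m0_le1 (HC := HC) P Q.
have eA1 : eA <= 1 := le_trans eAd (regd1 G).
have k0 := regk0 G.
have mA : 0 < m0 ^+ size A by rewrite exprn_gt0.
have mA1 : m0 ^+ size A <= 1 by rewrite exprn_ile1// ltW.
(* Small enough for each of the three endings: the disc has exceeded size [k]; the obstructing
   critical point is at distance at least [eA]; or a point of [A] is followed until it exits [eA],
   at a loss of at most [m0 ^+ size A]. *)
exists (k * (m0 ^+ size A * eA)); first by rewrite !mulr_gt0.
move=> s0 s00.
have ex : exists n, `[< ~ lin_radius G (iter n f x) (gder x n * s0) >].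
  apply: contrapT => h; have [n] := xE s0 s00.
  have lin m : lin_orbit x s0 m.
    move=> i _; apply: contrapT => h'; apply: h; exists i; exact/asboolP.
  rewrite (lin_orbit_rad xG s00 (lin n)) ltNge => /negP; apply.
  by have [h1 _] := lin n.+1 n (ltnSn n); rewrite (le_trans h1)// regk_le_d.
have [n /asboolP nl hn] := first_nat ex.
have lin : lin_orbit x s0 n.
  by move=> i /hn/asboolPn; exact: contrapT.
have gn := lin_orbit_gt0 xG s00 lin.
have [kg|kg] := ltP k (gder x n * s0).
  exists s0, n; split => //; rewrite (le_trans _ (ltW kg))// ler_piMr ?(ltW k0)//.
  by rewrite mulr_ile1// ltW.
have [c cc hc] : exists2 c, c \in crits P Q & k * absv (iter n f x - c) < gder x n * s0.
  apply: contrapT => h; apply: nl; split => // c cc.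
  by rewrite leNgt; apply/negP => h'; apply: h; exists c.
have [far|near] := leP eA (absv (iter n f x - c)).
  exists s0, n; split => //; rewrite (le_trans _ (ltW hc))// ler_pM2l//.
  by rewrite (le_trans _ far)// ler_piMl// ltW.
have cA := xc n c cc near.
set u := iter n f x - c.
have xn : iter n f x = c + u by rewrite /u addrC subrK.
have u0 : 0 < absv u.
  rewrite abs_gt0 subr_eq0; apply/eqP => E; have := xA n; rewrite E.
  by rewrite cA.
have [m hm hmin] := exit_time cA u0.
(* The largest radius that [c] permits at time [n]: the image disc then has radius [k |u|]. *)
pose s := k * absv u / gder x n.
have s_gt0 : 0 < s by rewrite divr_gt0 ?mulr_gt0.
have gs : gder x n * s = k * absv u by rewrite mulrC divfK// gt_eqF.
have ss0 : s <= s0 by rewrite /s ler_pdivrMr// [leRHS]mulrC ltW.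
have follow_i i : (i <= m)%N -> absv (iter i f (c + u) - iter i f c) = rad c (absv u) i /\
    gder x (n + i) * s = k * (emul c i * rad c (absv u) i).
  move=> im; have [|h1 h2] := @follow c u i cA; first by move=> j ji; apply: hmin; exact: leq_trans im.
  split => //; rewrite gder_shift mulrAC gs xn -h2 -!mulrA; congr (_ * _).
  by rewrite mulrC.
exists s, (n + m)%N; split => //; last first.
  have [_ ->] := follow_i m (leqnn m).
  rewrite ler_pM2l//; apply: ler_pM; rewrite ?(ltW mA) ?(ltW eA0) ?(ltW hm)//.
  exact: emul_ge.
move=> i im; have [ni|ni] := ltnP i n.
  by apply: lin_radius_le (lin i ni); rewrite ler_wpM2l// gder_ge0.
have ji : (i - n < m)%N by rewrite ltn_subLR.
have [h1 h2] := follow_i (i - n)%N (ltnW ji).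
rewrite subnKC// in h2; set j := (i - n)%N in ji h1 h2.
have rj := hmin j ji.
have rj0 : 0 <= rad c (absv u) j by rewrite rad_ge0.
have ek : emul c j * rad c (absv u) j <= rad c (absv u) j by rewrite ler_piMl// emul_le1.
have xi : iter i f x = iter j f (c + u) by rewrite -xn -iterD subnK.
split.
  by rewrite h2 ler_piMr ?(ltW k0)// (le_trans ek)// (le_trans rj).
move=> c' cc'; rewrite h2 ler_pM2l// (le_trans ek)// xi.
(* Either the critical point is [f^j c], at distance exactly the current radius, or it is further
   than [eA] from [f^j c], hence further than that radius. *)
have [->|nc] := eqVneq c' (iter j f c); first by rewrite h1.
have far := Acrit (A_iter j cA) cc' nc.
have rlt : rad c (absv u) j < absv (iter j f c - c') by exact: le_lt_trans far.
rewrite (_ : _ - c' = (iter j f c - c') + (iter j f (c + u) - iter j f c)); last by ring.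
by rewrite absDl ?h1// ltW.
Qed.

End InvariantSet.

(** * Newton iteration and preimages in a closed subfield *)

Lemma half_exp_small t e : 0 < e -> exists N, t / 2 ^+ N < e.
Proof.
move=> e0; have t1 : 0 < `|t| + 1 by rewrite ltr_wpDl.
have [|N hN] := @exp_small _ (2^-1 : R) _ _ (divr_gt0 e0 t1).
  by rewrite invr_ge0 ler0n invf_lt1// ltr1n.
exists N; rewrite (@le_lt_trans _ _ ((`|t| + 1) / 2 ^+ N))//.
  by rewrite ler_wpM2r ?invr_ge0 ?exprn_ge0// (le_trans (ler_norm _))// lerDl.
by rewrite mulrC -ltr_pdivlMr// -exprVn.
Qed.

(** Newton iteration with the fixed slope [D]: the linearization bound halves the error at every
    step, and closedness keeps the limit in [K]. *)
Lemma hensel (K : set C) (F : C -> C) (D : C) s : is_subfield K -> closed_set absv K ->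
  0 < s -> K D -> D != 0 -> (forall u, K u -> absv u <= s -> K (F u)) ->
  (forall u v, absv u <= s -> absv v <= s ->
     absv (F u - F v - D * (u - v)) <= absv D * absv (u - v) / 2) ->
  absv (F 0) <= absv D * s -> exists u, [/\ K u, absv u <= s & F u = 0].
Proof.
move=> HK cK s0 KD D0 KF lin F0.
have D1 : 0 < absv D by rewrite abs_gt0.
pose u := fix u n := if n is n.+1 then u n - F (u n) / D else 0.
have inv n : [/\ K (u n), absv (u n) <= s & absv (F (u n)) <= absv D * s / 2 ^+ n].
  elim: n => [|n [h1 h2 h3]].
    by rewrite /= abs0 expr0 divr1; split => //; [exact: sub0|exact: ltW].
  have h4 : absv (F (u n) / D) <= s.
    rewrite absf_div ler_pdivrMr// mulrC (le_trans h3)// ler_piMr ?mulr_ge0 ?(ltW s0)//.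
    by rewrite invf_le1 ?exprn_gt0// exprn_ege1// ler1n.
  have h5 : absv (u n.+1) <= s by rewrite absB_le.
  have uS : u n.+1 - u n = - (F (u n) / D) by rewrite /= addrAC subrr add0r.
  split => //.
    by apply: subB => //; apply: sub_div => //; exact: KF.
  have := lin _ _ h5 h2.
  have -> : F (u n.+1) - F (u n) - D * (u n.+1 - u n) = F (u n.+1).
    by rewrite uS mulrN mulrCA divff// mulr1 opprK subrK.
  move=> h; rewrite (le_trans h)// uS absN absf_div.
  rewrite mulrCA divff ?gt_eqF// mulr1 exprS invfM.
  by rewrite [2^-1 * _]mulrC mulrA ler_wpM2r ?invr_ge0.
have step n : absv (u n.+1 - u n) <= s / 2 ^+ n.
  have [_ _ h] := inv n; rewrite /= addrAC subrr add0r absN absf_div ler_pdivrMr//.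
  by rewrite (le_trans h)// mulrAC mulrC mulrA [leRHS]mulrAC.
have close n m : (n <= m)%N -> absv (u m - u n) <= s / 2 ^+ n.
  move=> nm; rewrite -(subnK nm); elim: (m - n)%N => [|j IH].
    by rewrite subrr abs0 divr_ge0 ?exprn_ge0// ltW.
  rewrite addSn (abs_tri_le _ IH)// (le_trans (step _))// ler_wpM2l ?(ltW s0)//.
  by rewrite lef_pV2 ?posrE ?exprn_gt0// ler_weXn2l ?ler1n// leq_addl.
have cu : abs_cauchy absv u.
  move=> e e0; have [N hN] := half_exp_small s e0; exists N => m n Nm Nn.
  rewrite (le_lt_trans _ hN)// (abs_tri_le (close _ _ Nm))// absC.
  exact: close.
have [l ul] := complete (HC := HC) cu.
have Kl : K l by apply: (closed_seq (HC := HC) cK _ ul) => n; case: (inv n).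
have [N hN] := ul s s0.
have ls : absv l <= s.
  rewrite -(subrK (u N) l) absD_le//; first by rewrite absC ltW// hN.
  by case: (inv N).
exists l; split => //; apply/eqP; apply: contrapT => /negP.
rewrite -(abs_gt0 (absv := absv)) => Fl.
have [N1 hN1] := half_exp_small (absv D * s) Fl.
have [N2 hN2] := ul _ (divr_gt0 Fl D1).
pose n := maxn N1 N2; have [_ un Fn] := inv n.
have h1 : absv (F (u n)) < absv (F l).
  rewrite (le_lt_trans Fn)// (le_lt_trans _ hN1)// ler_wpM2l ?mulr_ge0 ?(ltW s0)//.
  by rewrite lef_pV2 ?posrE ?exprn_gt0// ler_weXn2l ?ler1n// leq_maxl.
have h2 : absv (F (u n) - F l) < absv (F l).
  have h3 : absv (D * (u n - l)) < absv (F l).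
    by rewrite absM mulrC -ltr_pdivlMr// hN2// leq_maxr.
  rewrite -(subrK (D * (u n - l)) (F (u n) - F l)) absD_lt//.
  rewrite (le_lt_trans (lin _ _ un ls))// -absM (le_lt_trans _ h3)//.
  by rewrite ler_piMr// invf_le1// ler1n.
have : absv (F l) < absv (F l).
  rewrite -{1}(subrK (F (u n)) (F l)) absD_lt//.
  by rewrite absC.
by rewrite ltxx.
Qed.

Lemma ratf_onto (K : set C) z s (t : C) : is_subfield K -> closed_set absv K ->
  poly_over K P -> poly_over K Q -> K z -> inG G z -> 0 < s -> lin_radius G z s ->
  K t -> absv (t - f z) <= absv (df z) * s ->
  exists u, [/\ K u, absv u <= s & f (z + u) = t].
Proof.
move=> HK cK KP KQ Kz zG s0 sl Kt tz.
have df0 : 0 < absv (df z) by exact: df_gt0 zG s0 sl.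
have Kdf : K (df z).
  rewrite rat_derivE; apply: sub_div => //.
    by apply: over_horner => //; exact: over_wronsk.
  by apply: subX => //; exact: over_horner.
have [||||u [Ku us Fu]] := @hensel K (fun u => f (z + u) - t) (df z) s HK cK s0 Kdf.
- by rewrite -(abs_gt0 (absv := absv)).
- by move=> u Ku _; apply: subB => //; apply: sub_ratf => //; exact: subD.
- by move=> u v us vs; rewrite opprB addrA subrK; exact: ratf_lin zG s0 sl us vs.
- by rewrite addr0 absC.
by exists u; split => //; apply/eqP; rewrite -subr_eq0; exact/eqP.
Qed.

Lemma lin_orbit_onto (K : set C) x s n (t : C) : is_subfield K -> closed_set absv K ->
  poly_over K P -> poly_over K Q -> K x -> inGorb G x -> 0 < s -> lin_orbit x s n ->
  K t -> absv (t - iter n f x) <= gder x n * s ->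
  exists y, [/\ K y, absv (y - x) <= s & iter n f y = t].
Proof.
move=> HK cK KP KQ Kx xG s0; elim: n t => [|n IH] t h Kt.
  by rewrite /= mul1r => tx; exists t.
have hn := lin_orbitW (leqnSn n) h; have gn := lin_orbit_gt0 xG s0 hn.
move=> tx; have s'0 : 0 < gder x n * s by rewrite mulr_gt0.
have Kz : K (iter n f x) by exact: sub_iter_ratf.
have tz : absv (t - f (iter n f x)) <= absv (df (iter n f x)) * (gder x n * s).
  by rewrite (le_trans tx)// /= mulrAC mulrC.
have [u [Ku us fu]] := ratf_onto HK cK KP KQ Kz (xG n) s'0 (h n (ltnSn n)) Kt tz.
have [|y [Ky ys yn]] := IH _ hn (subD HK Kz Ku).
  by rewrite addrAC subrr add0r.
by exists y; split => //=; rewrite yn.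
Qed.

End Derivatives.
Arguments gder {R C} absv P Q z n.

(** * Orbits and generic elements *)

Section Orbits.
Context {C : closedFieldType} {P Q : {poly C}}.
Implicit Types (z a r : C) (A s : seq C).
Notation f := (ratf P Q).

Definition preperiodic z := exists m n, (0 < n)%N /\ iter (m + n) f z = iter m f z.

Lemma preperiodicP z : (forall i, Q.[iter i f z] != 0) ->
  eventually_periodic P Q (Some z) <-> preperiodic z.
Proof.
move=> h; split=> -[m [n [n0 E]]]; exists m, n; split => //.
  by move: E; rewrite !iter_rat_eval => // -[].
by rewrite !iter_rat_eval => //; rewrite E.
Qed.

Lemma preperiodic_iter z n : preperiodic (iter n f z) -> preperiodic z.
Proof.
move=> [m [k [k0 E]]]; exists (m + n)%N, k; split => //.
by rewrite addnAC iterD E -iterD.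
Qed.

Lemma not_preperiodic_inj z : ~ preperiodic z -> injective (fun n => iter n f z).
Proof.
move=> h; suff H m n : (m < n)%N -> iter m f z = iter n f z -> False.
  move=> m n E; have [/H|/H|//] := ltngtP m n; first by move/(_ E).
  by move/(_ (esym E)).
move=> mn E; apply: h; exists m, (n - m)%N; rewrite subn_gt0; split => //.
by rewrite subnKC// ltnW.
Qed.

Lemma finite_preperiodic A a : (forall b, b \in A -> f b \in A) -> a \in A -> preperiodic a.
Proof.
move=> Af aA; have Ai i : iter i f a \in A by elim: i => //= i; exact: Af.
have [i [j [ij _ E]]] := seq_pigeonhole Ai (leqnn _).
exists i, (j - i)%N; rewrite subn_gt0; split => //.
by rewrite subnKC ?(ltnW ij).
Qed.

Lemma preperiodic_orbits s : (forall r, r \in s -> preperiodic r) ->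
  exists A, [/\ forall r, r \in s -> r \in A, forall a, a \in A -> f a \in A &
    forall a, a \in A -> exists2 r, r \in s & exists n, a = iter n f r].
Proof.
elim: s => [|r s IH] h; first by exists [::].
have [|A [sA Af As]] := IH; first by move=> x xs; apply: h; rewrite in_cons xs orbT.
have [m [n [n0 E]]] := h r (mem_head _ _).
exists ([seq iter i f r | i <- iota 0 (m + n)] ++ A); split.
- move=> x; rewrite in_cons mem_cat => /orP[/eqP ->|/sA ->]; last by rewrite orbT.
  apply/orP; left; apply/mapP; exists 0%N => //.
  by rewrite mem_iota leq0n add0n addn_gt0 n0 orbT.
- move=> a; rewrite !mem_cat => /orP[/mapP[i]|/Af ->]; last by rewrite orbT.
  rewrite mem_iota/= add0n => imn ->; apply/orP; left; apply/mapP.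
  have [lt|ge] := ltnP i.+1 (m + n); first by exists i.+1; rewrite ?mem_iota.
  exists m; first by rewrite mem_iota/= add0n -addn1 leq_add2l.
  have {imn ge} im : i.+1 = (m + n)%N by apply/eqP; rewrite eqn_leq ge imn.
  by rewrite -E -im.
- move=> a; rewrite mem_cat => /orP[/mapP[i _ ->]|/As[x xs [i ->]]].
    by exists r; [exact: mem_head|exists i].
  by exists x; [rewrite in_cons xs orbT|exists i].
Qed.

End Orbits.
Arguments preperiodic {C} P Q z.

(** * Roots, approximate cluster points and generic elements *)

Section Existence.
Context {R : realType} {C : closedFieldType} {absv : C -> R} {p : nat}.
Context {HC : padic_field absv p}.
Implicit Types (a b x y z u v w : C) (r s t e : R).

Lemma exists_root n a : (0 < n)%N -> exists w, w ^+ n = a.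
Proof.
case: n => // n _.
have [w hw] := @GRing.solve_monicpoly C n.+1 (fun i => if i == 0%N then a else 0) isT.
exists w; rewrite hw big_ord_recl /= expr0 mulr1 big1 ?addr0// => i _.
by rewrite mul0r.
Qed.

Lemma root_algebraic (K : set C) n a w : is_subfield K -> K a -> (0 < n)%N -> w ^+ n = a ->
  algebraic_over K w.
Proof.
move=> HK Ka n0 wa; exists ('X^n - a%:P); split.
- by rewrite -size_poly_eq0 size_XnsubC.
- by apply: (overB HK); [exact: over_Xn|exact: overC].
- by rewrite /root hornerD hornerN hornerXn hornerC wa subrr.
Qed.

Lemma tot_bounded_pigeonhole (S : set C) (u : nat -> C) e : tot_bounded absv S ->
  (forall n, S (u n)) -> 0 < e -> exists i j, (i < j)%N /\ absv (u i - u j) < e.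
Proof.
move=> tS Su e0; have [s _ hs] := tS e e0.
have /choice[g hg] : forall n, exists y, y \in s /\ absv (u n - y) < e.
  by move=> n; have [y ys uy] := hs _ (Su n); exists y.
have [i [j [ij _ E]]] := seq_pigeonhole (fun n => (hg n).1) (leqnn _).
exists i, j; split => //; rewrite (abs_tri_lt (hg i).2)// E absC.
by case: (hg j).
Qed.

(** A cluster point at the fixed scale [e] only: some point of a finite [e]-net is approached
    infinitely often. *)
Lemma tot_bounded_cluster (S : set C) (u : nat -> C) e : tot_bounded absv S ->
  (forall n, S (u n)) -> 0 < e -> exists2 g, S g &
  forall N, exists2 i, (N <= i)%N & absv (u i - g) < e.
Proof.
move=> tS Su e0; have [s sS hs] := tS e e0.
apply: contrapT => h.
have {}h g : g \in s -> exists N, forall i, (N <= i)%N -> e <= absv (u i - g).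
  move=> gs; apply: contrapT => h'; apply: h; exists g; first exact: sS.
  move=> N; apply: contrapT => h''; apply: h'; exists N => i Ni.
  by rewrite leNgt; apply/negP => ui; apply: h''; exists i.
have [N hN] : exists N, forall g, g \in s -> forall i, (N <= i)%N -> e <= absv (u i - g).
  elim: s {sS hs} h => [|g s IH] h; first by exists 0%N.
  have [|N hN] := IH; first by move=> x xs; apply: h; rewrite in_cons xs orbT.
  have [N' hN'] := h g (mem_head _ _); exists (maxn N N') => x; rewrite in_cons.
  move=> /orP[/eqP ->|xs] i; rewrite geq_max => /andP[h1 h2]; first exact: hN'.
  exact: hN.
have [g gs ug] := hs _ (Su N); have := hN g gs N (leqnn N).
by rewrite leNgt ug.
Qed.

Lemma seq_separated z (s : seq C) :
  exists2 r : R, 0 < r & forall y, y \in s -> y != z -> r < absv (z - y).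
Proof.
apply: (@seq_radius _ _ s (fun y r => y != z -> r < absv (z - y))).
  by move=> y r r' /andP[_ rr] h yz; rewrite (le_lt_trans rr)// h.
move=> y _; have [->|yz] := eqVneq y z; first by exists 1.
have h : 0 < absv (z - y) by rewrite abs_gt0 subr_eq0 eq_sym.
by exists (absv (z - y) / 2); rewrite ?divr_gt0// gtr_pMr// invf_lt1// ltr1n.
Qed.

(* A finite extension is discretely valued, so some element has no root of its absolute
   value. *)
Lemma exists_generic (L : set C) l : finite_ext_Qp absv L -> prime l ->
  exists w, [/\ algebraic_over L w & generic (absv := absv) L l (absv w)].
Proof.
move=> LE hl; have LF : is_subfield L by case: LE.
have l0 := prime_gt0 hl; have l1 := prime_gt1 hl.
apply: contrapT => h.
have key a : L a -> a != 0 -> exists b, [/\ L b, b != 0 & absv b ^+ l = absv a].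
  move=> La a0; have [w wa] := exists_root a l0; apply: contrapT => h'; apply: h.
  have w0 : 0 < absv w.
    by rewrite abs_gt0; apply: contraNneq a0 => w0; rewrite -wa w0 expr0n eqn0Ngt l0.
  exists w; split; first exact: (root_algebraic LF La l0 wa).
  split => //; first by exists a => //; rewrite -wa absX.
  move=> [b Lb bw]; apply: h'; exists b; split => //; last by rewrite bw -absX wa.
  by rewrite -(abs_gt0 (absv := absv)) bw.
have /choice[g hg] : forall a, exists b, L a -> a != 0 -> [/\ L b, b != 0 & absv b ^+ l = absv a].
  move=> a; have [La|] := pselect (L a); last by exists 0.
  have [->|a0] := eqVneq a 0; first by exists 0.
  by have [b hb] := key a La a0; exists b.
(* Elements of [L] whose values are iterated [l]-th roots of [|p|]. These values increase strictly
   inside [[|p|, 1)], so any two such elements are at distance at least [|p|], against total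
   boundedness. *)
pose u n := iter n g p%:R.
have pp : (p%:R : C) != 0 by rewrite -(abs_gt0 (absv := absv)) abs_p_gt0.
have inv n : [/\ L (u n), u n != 0, absv (p%:R : C) <= absv (u n) & absv (u n) < 1].
  elim: n => [|n [h1 h2 h3 h4]].
    by split => //; [exact: sub_nat|exact: abs_p_lt1].
  have [g1 g2 g3] := hg _ h1 h2; split => //.
    have gl : absv (g (u n)) <= 1.
      rewrite leNgt; apply/negP => g4; move: h4; rewrite -g3 ltNge => /negP; apply.
      by rewrite exprn_ege1// ltW.
    by rewrite (le_trans h3)// -g3 -[leRHS]expr1 ler_wiXn2l.
  by rewrite ltNge; apply/negP => g4; move: h4; rewrite -g3 ltNge exprn_ege1.
have incr n : absv (u n) < absv (u n.+1).
  have [h1 h2 h3 h4] := inv n; have [_ _ _ g4] := inv n.+1.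
  have [g1 g2 g3] := hg _ h1 h2; rewrite -g3 /= -[ltRHS]expr1.
  by rewrite ltr_iXn2l// abs_gt0.
have mono i j : (i < j)%N -> absv (u i) < absv (u j).
  elim: j => // j IH; rewrite ltnS leq_eqVlt => /orP[/eqP ->//|/IH ij].
  exact: lt_trans ij (incr j).
have [_ tL] := finite_ext_loc_compact (HC := HC) LE.
have [i [j [ij]]] := tot_bounded_pigeonhole (tL 1) (u := u)
  (fun n => let: And4 h1 _ _ h4 := inv n in conj h1 (ltW h4)) (abs_p_gt0 (HC := HC)).
rewrite absC absDl ?absN ?mono// ltNge.
by case: (inv j) => _ _ ->.
Qed.

End Existence.

(** * Expanding maps are subhyperbolic *)

Section Necessity.
Context {R : realType} {C : closedFieldType} {absv : C -> R} {p : nat}.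
Context {HC : padic_field absv p}.
Context {P Q : {poly C}} {HPQ : good_map P Q}.
Variable G : region absv P Q.
Implicit Types (a b x y z u v w : C) (r s t e : R).
Notation f := (ratf P Q).
Notation df := (rat_deriv P Q).
Notation d := (regd G). Notation L := (regL G). Notation B := (regB G).
Notation q0 := (regq G). Notation k := (regk G).
Notation W := (wronsk P Q).
Notation gder := (gder absv P Q).
Notation Julia := (Julia absv P Q).

Lemma df_le z : inG G z -> absv (df z) <= L.
Proof.
move=> zG; have Qz : 0 < absv Q.[z] by rewrite abs_gt0 (inG_Q zG).
rewrite rat_derivE absf_div absX ler_pdivrMr ?exprn_gt0// -diffp_coef1.
have := gaussn_ge (HC := HC) 1 (diffp P Q z) 1; rewrite expr1n mulr1 => h.
rewrite (le_trans h)// (le_trans (gaussn_diffp1 zG))// (le_trans (regBL G))// ler_wpM2l ?(ltW (regL0 G))//.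
by rewrite lerXn2r// ?nnegrE ?(ltW (regq0 G))//; case: zG.
Qed.

Lemma gder_le z n : (forall i, (i < n)%N -> inG G (iter i f z)) -> gder z n <= L ^+ n.
Proof.
elim: n => [|n IH] h; first by rewrite expr0.
rewrite exprSr /=; apply: ler_pM; rewrite ?gder_ge0//; last by apply: df_le; exact: h.
by apply: IH => i ni; apply: h; rewrite ltnS ltnW.
Qed.

(** By [normal_exists], a point close to but different from a given point of the region, even a
    critical one, has a different image. *)
Lemma iter_punctured c n e : inGorb G c -> 0 < e -> exists2 r : R, 0 < r &
  forall z, z != c -> absv (z - c) < r ->
    iter n f z != iter n f c /\ absv (iter n f z - iter n f c) < e.
Proof.
move=> cG; elim: n e => [|n IH] e e0; first by exists e.
have [e1 /andP[e10 e1d] he1] := normal_exists (HC := HC) (HPQ := HPQ) (cG n).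
have m0 : 0 < Num.min e1 (e / L) by rewrite lt_min e10 divr_gt0.
have [r r0 hr] := IH _ m0; exists r => // z zc zr.
have [nz] := hr z zc zr; rewrite lt_min => /andP[z1 z2].
rewrite !iterS; set b := iter n f z in nz z1 z2 *; set a := iter n f c in he1 nz z1 z2 *.
have -> : b = a + (b - a) by rewrite addrC subrK.
split; last first.
  rewrite (le_lt_trans (ratf_contr (cG n) _))//.
    by rewrite (le_trans _ e1d)// ltW.
  by rewrite mulrC -ltr_pdivlMr.
rewrite -subr_eq0 -(abs_gt0 (absv := absv)); have [_ -> _] := he1 _ (ltW z1).
by rewrite mulr_gt0 ?(loccoef_gt0 (cG n))// exprn_gt0// abs_gt0 subr_eq0.
Qed.

Lemma orbit_leaves c (s : seq C) : ~ preperiodic P Q c ->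
  exists n, forall m, (n <= m)%N -> iter m f c \notin s.
Proof.
move=> /not_preperiodic_inj cI; elim: s => [|y s [n hn]]; first by exists 0%N.
have [[m cm]|h] := pselect (exists m, iter m f c = y); last first.
  exists n => m nm; rewrite in_cons negb_or hn// andbT; apply/eqP => E; apply: h.
  by exists m.
exists (maxn n m.+1) => m'; rewrite geq_max => /andP[nm mm].
rewrite in_cons negb_or hn// andbT -cm; apply/eqP => /cI E.
by rewrite E ltnn in mm.
Qed.

Hypothesis JG : forall z, Julia setT (Some z) -> inG G z /\ Julia setT (Some (f z)).

Lemma expanding_noncritical (F : set C) c : is_subfield F -> poly_over F P -> poly_over F Q ->
  expanding_admissible absv P Q F -> F c -> Julia setT (Some c) -> W.[c] = 0 ->
  ~ preperiodic P Q c ->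
  ~ (forall e, 0 < e -> exists z, [/\ z != c, absv (z - c) < e &
      forall n, Julia F (Some (iter n f z))]).
Proof.
move=> FF FP FQ [V [rho [zs [[[oV JV cV] [c0 c00 rc0] _ rinf _] [lam lam1 hexp]]]]] Fc cJ Wc cN acc.
have cJn n := Julia_orbit JG n cJ.
have cG : inGorb G c by move=> n; case: (JG (cJn n)).
(* At time [m] the orbit of [c] has left the exceptional points for good, so [rho] is finite there;
   [m >= 1] lets the small derivative near [c] enter [gder z m]. *)
have [m0 hm0] := orbit_leaves zs cN; pose m := m0.+1.
have Vm : V (iter m f c) by apply: JV => //; exact: sub_iter_ratf.
have fin z : V z -> z \notin zs -> exists2 r : R, rho z = r%:E & c0 <= r.
  move=> Vz zz; have := rc0 z Vz; have := rinf z Vz.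
  case E : (rho z) => [r| |] h1 h2; first by exists r => //; rewrite -lee_fin.
    by have := h1 erefl; rewrite (negPf zz).
  by rewrite leeNy_eq in h2.
have [r0 rm r0c] := fin _ Vm (hm0 m (leqnSn _)).
have := cV _ Vm; rewrite rm => /(_ 1 ltr01)[d1 d10 hd1].
(* Before time [m] the orbit of [c] may meet exceptional points. That of a nearby [z <> c] does not:
   its iterates are close to those of [c] but distinct from them. *)
have near i : exists2 e, 0 < e & forall z, z != c -> absv (z - c) < e ->
    iter i f z \notin zs /\ absv (iter i f z - iter i f c) < d1.
  have [e e0 he] := seq_separated (HC := HC) (iter i f c) zs; have e1 : 0 < Num.min e d1 by rewrite lt_min e0.
  have [r r0' hr] := iter_punctured i cG e1; exists r => // z zc zr.
  have [h1] := hr z zc zr; rewrite lt_min => /andP[h2 h3]; split => //.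
  by apply/negP => zz; have := he _ zz h1; rewrite absC ltNge ltW.
have [e1 e10 he1] := @seq_radius R _ (iota 0 m.+1) (fun i e => forall z, z != c -> absv (z - c) < e ->
    iter i f z \notin zs /\ absv (iter i f z - iter i f c) < d1)
    (fun i e e' ee h z zc ze => h z zc (lt_le_trans ze (proj2 (andP ee)))) (fun i _ => near i).
have r00 : 0 < r0 + 1 by rewrite addr_gt0// (lt_le_trans c00).
have Ln : 0 < L ^+ m0 by rewrite exprn_gt0.
(* With [|W z|] below this bound, [|df z|] times at most [L ^ m0] for the remaining steps is less
   than [c0 / (r0 + 1)], which contradicts [c0 <= rho * gder] at time [m]. *)
have K0 : 0 < c0 / (r0 + 1) / L ^+ m0 * q0 ^+ 2 by rewrite !mulr_gt0 ?invr_gt0 ?exprn_gt0.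
have [e2 e20 he2] := @horner_continuous _ _ absv p HC W c _ K0.
have e30 : 0 < Num.min e1 e2 by rewrite lt_min e10.
have [z [zc ze zJ]] := acc _ e30.
move: ze; rewrite lt_min => /andP[ze1 /he2]; rewrite Wc subr0 => Wz.
have zG i : inG G (iter i f z) by case: (JG (Julia_extend (zJ i))).
have zV i : V (iter i f z) by apply: JV; [case: (zJ i)|exact: Julia_extend (zJ i)].
have znot i : (i <= m)%N -> iter i f z \notin zs.
  by move=> im; case: (he1 i _ z zc ze1) => //; rewrite mem_iota.
have chain i : (i <= m)%N -> exists2 r, rho (iter i f z) = r%:E & c0 <= r * gder z i.
  elim: i => [|i IH] im.
    by have [r hr rc] := fin _ (zV 0%N) (znot 0%N isT); exists r => //; rewrite mulr1.
  have [r hr rc] := IH (ltnW im).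
  have [r' hr' rc'] := fin _ (zV i.+1) (znot i.+1 im); exists r' => //.
  have Qz : Q.[iter i f z] != 0 by exact: inG_Q (zG i).
  have := hexp _ _ (zJ i) (rat_evalE Qz) (znot i (ltnW im)) (znot i.+1 im).
  rewrite -iterS hr hr' -!EFinM lee_fin => h.
  have r1 : 0 <= r.
    by have [r1 hr1 c1] := fin _ (zV i) (znot i (ltnW im)); move: hr; rewrite hr1 => -[<-];
      rewrite (le_trans (ltW c00)).
  rewrite (le_trans rc)//= [leRHS]mulrCA [leLHS]mulrC ler_wpM2l ?gder_ge0//.
  by rewrite (le_trans _ h)// ler_peMl// ltW.
have [r hr rc] := chain m (leqnn m).
have rlt : r < r0 + 1.
  have [|_ h] := he1 m _ z zc ze1; first by rewrite mem_iota add0n ltnSn.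
  by have [_] := hd1 _ (zV m) h; rewrite hr lte_fin.
have gm : gder z m < c0 / (r0 + 1).
  have fz : gder (f z) m0 <= L ^+ m0.
    by apply: gder_le => i _; rewrite -iterSr.
  have dz : absv (df z) < c0 / (r0 + 1) / L ^+ m0.
    rewrite rat_derivE absf_div absX ltr_pdivrMr ?exprn_gt0 ?abs_gt0 ?(inG_Q (zG 0%N))//.
    rewrite (lt_le_trans Wz)// ler_wpM2l ?divr_ge0 ?(ltW c00) ?(ltW r00) ?(ltW Ln)//.
    by rewrite lerXn2r ?nnegrE ?(ltW (regq0 G))//; case: (zG 0%N).
  by rewrite gder_S (le_lt_trans (ler_wpM2l _ fz))// -ltr_pdivlMr.
move: rc; rewrite leNgt => /negP; apply.
rewrite (le_lt_trans (ler_wpM2r (gder_ge0 _ _) (ltW rlt)))//.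
by rewrite mulrC -ltr_pdivlMr.
Qed.

Lemma scale_unit v (t : C) : v != 0 -> absv v <= 1 -> 0 < absv t < 1 -> exists n,
  absv t < absv (v / t ^+ n) <= 1.
Proof.
move=> v0 v1 /andP[t0 t1]; have va : 0 < absv v by rewrite abs_gt0.
have [|n hn hmin] := @first_nat (fun n => absv t ^+ n.+1 < absv v).
  have [|n hn] := exp_small _ va (t := absv t); first by rewrite abs_ge0.
  by exists n; rewrite exprS (le_lt_trans _ hn)// ler_piMl ?exprn_ge0// ltW.
exists n; rewrite absf_div absX ltr_pdivlMr ?exprn_gt0// ler_pdivrMr ?exprn_gt0// -exprS hn.
rewrite mul1r; case: n hmin {hn} => [|n] hmin; first by rewrite expr0.
by rewrite leNgt hmin.
Qed.

Lemma ratf_leading a u : inG G a -> absv u <= d ->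
  absv (f (a + u) - f a - (diffp P Q a)`_(locdeg P Q a) / Q.[a] ^+ 2 * u ^+ locdeg P Q a) <=
  B ^+ 3 / q0 ^+ 3 * absv u ^+ (locdeg P Q a).+1.
Proof.
move=> aG ud; have u1 := le_trans ud (regd1 G).
have [aM aq] := aG; have Qa : Q.[a] != 0 by exact: inG_Q aG.
have Qu : Q.[a + u] != 0 by exact: Q_near_neq0 aG ud.
set e := locdeg P Q a; set N := diffp P Q a; set D := N`_e.
have qa : absv Q.[a] <= B by rewrite (le_trans (gaussn_horner _ aM)) ?regQB.
have B0 := regB0 G.
have NB : gaussn absv 1 N <= B ^+ 2 by exact: gaussn_diffp1.
have DB : absv D <= B ^+ 2.
  by have := gaussn_ge (HC := HC) 1 N e; rewrite expr1n mulr1 => /le_trans; apply.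
have hN : absv (N.[u] - D * u ^+ e) <= B ^+ 2 * absv u ^+ e.+1.
  have -> : N.[u] - D * u ^+ e = (N - D *: 'X^e).[u] by rewrite (hornerD N) (hornerN (D *: 'X^e)) hornerZ hornerXn.
  rewrite (le_trans (gaussn_horner (s := absv u) _ _))//.
  have := @gaussn_shrink _ _ absv p HC 1 (absv u) (N - D *: 'X^e) e.+1 ler01.
  rewrite mulr1 abs_ge0 u1 => /(_ isT _)/le_trans -> //.
    move=> i; rewrite ltnS leq_eqVlt coefB coefZ coefXn => /orP[/eqP ->|ie].
      by rewrite eqxx mulr1 subrr.
    by rewrite (ltn_eqF ie) mulr0 subr0 locdeg_before.
  rewrite mulrC ler_wpM2r ?exprn_ge0// gaussn_le ?exprn_ge0 ?(ltW B0)// => i _.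
  rewrite expr1n mulr1 coefB coefZ coefXn; case: eqP => [->|_].
    by rewrite mulr1 subrr abs0 exprn_ge0 ?(ltW B0).
  rewrite mulr0 subr0 (le_trans _ NB)//.
  by have := gaussn_ge (HC := HC) 1 N i; rewrite expr1n mulr1.
have -> : f (a + u) - f a - D / Q.[a] ^+ 2 * u ^+ e =
   ((N.[u] - D * u ^+ e) * Q.[a] - D * u ^+ e * (Q.[a + u] - Q.[a])) / (Q.[a] ^+ 2 * Q.[a + u]).
  rewrite ratf_diff// -/N; move: (N.[u]) (D) (u ^+ e) => X Y Z.
  by field; rewrite Qa Qu.
rewrite absf_div absM absX (Q_abs_near aG ud) -exprSr.
have U0 : 0 <= absv u ^+ e.+1 by rewrite exprn_ge0.
rewrite [leRHS]mulrAC ler_pM ?invr_ge0 ?exprn_ge0//; last first.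
  rewrite lef_pV2 ?posrE ?exprn_gt0 ?regq0 ?abs_gt0//.
  by rewrite lerXn2r ?nnegrE ?(ltW (regq0 G)).
apply: absB_le; rewrite !absM.
  rewrite (le_trans (ler_pM _ _ hN qa))//.
  by rewrite mulrAC -exprSr.
have hQ : absv (Q.[a + u] - Q.[a]) <= B * absv u.
  have := @Q_lip _ _ _ _ HC _ _ G a u 0 aG u1; rewrite abs0 addr0 subr0; apply.
  exact: ler01.
rewrite absX (le_trans (ler_pM _ _ (ler_wpM2r _ DB) hQ)) ?mulr_ge0 ?exprn_ge0//.
by rewrite mulrACA -!exprSr.
Qed.

(* Near a critical point [c] the map looks like [u |-> b u ^ e], so the preimages of points
   [y] of [K] tending to [f c] need [e]-th roots. A cluster point of the normalized
   differences [(y - f c) / b] provides one finite extension that contains infinitely many of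
   them. *)
Lemma lift_through_critical (K : set C) c : finite_ext_Qp absv K ->
  poly_over K P -> poly_over K Q -> K c -> inG G c ->
  (forall r, 0 < r -> exists y, [/\ K y, y != f c, absv (y - f c) <= r & expansive G y]) ->
  exists F, [/\ finite_ext_Qp absv F, K `<=` F & forall r, 0 < r ->
    exists z, [/\ F z, z != c, absv (z - c) < r & expansive G z]].
Proof.
move=> KE KP KQ Kc cG hy; have KF : is_subfield K by case: KE.
set e := locdeg P Q c; have /andP[e_gt0 ed] := locdeg_bound (HC := HC) (HPQ := HPQ) cG.
have Qc : Q.[c] != 0 by exact: inG_Q cG.
have D0 : (diffp P Q c)`_e != 0 by exact: locdeg_neq0 cG.
pose b := (diffp P Q c)`_e / Q.[c] ^+ 2.
have b0 : b != 0 by rewrite mulf_neq0// invr_neq0// expf_neq0.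
have Kb : K b.
  by apply: (sub_div KF); [exact: (over_diffp KF)|apply: (subX KF); exact: (over_horner KF)].
have bA : absv b = loccoef absv P Q c by rewrite absf_div absX.
have ab : 0 < absv b by rewrite abs_gt0.
have p0 : 0 < absv (p%:R : C) by exact: abs_p_gt0.
have p1 : absv (p%:R : C) < 1 by exact: abs_p_lt1.
(* Rescaling by powers of [p ^ e] needs no extension, since [t ^ n] has the [e]-th root [p ^ n]. *)
pose t : C := p%:R ^+ e; have t0 : 0 < absv t by rewrite absX exprn_gt0.
have t1 : absv t < 1 by rewrite absX exprn_ilt1// -lt0n.
have tn0 : t != 0 by rewrite -(abs_gt0 (absv := absv)).
have Kt : K t by apply: (subX KF); exact: sub_nat.
have key i : exists yn : C * nat, [/\ K yn.1, yn.1 != f c, absv ((yn.1 - f c) / b) <= absv t ^+ i,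
    expansive G yn.1 & absv t < absv ((yn.1 - f c) / b / t ^+ yn.2) <= 1].
  have r0 : 0 < absv b * absv t ^+ i by rewrite mulr_gt0// exprn_gt0.
  have [y [Ky yc yr yE]] := hy _ r0.
  have v0 : (y - f c) / b != 0 by rewrite mulf_neq0 ?invr_neq0// subr_eq0.
  have vi : absv ((y - f c) / b) <= absv t ^+ i by rewrite absf_div ler_pdivrMr// mulrC.
  have v1 : absv ((y - f c) / b) <= 1 by rewrite (le_trans vi)// exprn_ile1// ltW.
  have [|n hn] := scale_unit v0 v1 (t := t); first by rewrite t0.
  by exists (y, n).
have /choice[g hg] := key.
pose v i := ((g i).1 - f c) / b; pose v' i := v i / t ^+ (g i).2.
have [_ tK] := finite_ext_loc_compact (HC := HC) KE.
have Kf : K (f c) by exact: (sub_ratf KF).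
have Kv i : field_ball absv K 1 (v' i).
  have [h1 h2 h3 h4 /andP[h5 h6]] := hg i; split => //.
  by apply: (sub_div KF); [apply: (sub_div KF) => //; exact: (subB KF)|exact: (subX KF)].
have e1 : 0 < absv (e%:R : C) by exact: abs_nat_gt0.
have kap0 : 0 < k * absv (e%:R : C) by rewrite mulr_gt0.
have kap1 : k * absv (e%:R : C) <= 1 by rewrite mulr_ile1 ?abs_nat_le1// ltW// regk_lt1.
(* This tolerance matches the image of the disc of radius [k |u|] around [c + u], whose radius is
   [k |e| |b| |u| ^ e]; the factor [|t|] is the lower bound of the normalized differences. *)
have [x [Kx _] xcl] := tot_bounded_cluster (tK 1) Kv (mulr_gt0 kap0 t0).
have [w wx] := exists_root x e_gt0.
have wK : algebraic_over K w by exact: (root_algebraic KF Kx e_gt0 wx).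
exists (adjoin K w); have FE := adjoin_finite (HC := HC) KE wK.
have FF : is_subfield (adjoin K w) by exact: adjoin_subfield.
have KF' : K `<=` adjoin K w by exact: adjoin_contains.
split => // r r_gt0.
have [en /andP[en0 end_] hen] := normal_exists (HC := HC) (HPQ := HPQ) cG.
have [es es0 hes] := seq_separated (HC := HC) c (crits P Q).
have C0 : 0 < B ^+ 3 / q0 ^+ 3 by rewrite divr_gt0 ?exprn_gt0// ?regB0 ?regq0.
pose del := Num.min r (Num.min en (Num.min es (k * absv (e%:R : C) * absv b / (B ^+ 3 / q0 ^+ 3)))).
have del0 : 0 < del by rewrite !lt_min r_gt0 en0 es0 divr_gt0// mulr_gt0.
have [|N hN] := @exp_small _ (absv t) (del ^+ e) _ (exprn_gt0 _ del0); first by rewrite abs_ge0.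
have [i Ni xi] := xcl N; have [Ky yc vi yE] := hg i.
rewrite -/(v i) -/(v' i) in vi * => /andP[v'1 v'2].
set y := (g i).1 in Ky yc yE; set m := (g i).2.
have tm0 : 0 < absv t ^+ m by rewrite exprn_gt0.
have vE : v i = v' i * t ^+ m by rewrite divfK// expf_neq0.
have xv : absv x = absv (v' i).
  apply: abs_near; rewrite absC (lt_trans xi)// (le_lt_trans _ v'1)//.
  by rewrite ler_piMl// ltW.
pose u := w * p%:R ^+ m.
have ue : u ^+ e = x * t ^+ m by rewrite exprMn wx -!exprM mulnC.
have uv : absv (u ^+ e) = absv (v i) by rewrite ue vE (absM x) (absM (v' i)) xv.
have vN0 : 0 < absv (v i) by rewrite vE absM absX mulr_gt0// (lt_trans t0).
have u0 : 0 < absv u.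
  by rewrite abs_gt0; apply: contraTneq vN0 => u0; rewrite -uv u0 expr0n eqn0Ngt e_gt0 abs0 ltxx.
have ud : absv u < del.
  rewrite ltNge; apply/negP => du; move: hN; rewrite ltNge => /negP; apply.
  rewrite (@le_trans _ _ (absv u ^+ e)) ?lerXn2r ?nnegrE ?(ltW del0) ?(ltW u0)//.
  rewrite -absX uv (le_trans vi)//.
  by rewrite ler_wiXn2l// ltW.
move: ud; rewrite !lt_min => /and4P[ur un us uC].
have ud : absv u <= d by rewrite (le_trans (ltW un)).
have u1 : absv u <= 1 by rewrite (le_trans ud) ?regd1.
have zG : inG G (c + u) by exact: inG_near.
have Fu : adjoin K w u.
  by apply: (subM FF); [exact: adjoin_gen|apply: (subX FF); exact: sub_nat].
have ku0 : 0 < k * absv u by rewrite mulr_gt0.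
have lin : lin_radius G (c + u) (k * absv u).
  split; first by rewrite ler_piMr// ltW.
  move=> c' cc'; rewrite ler_pM2l//; have [->|c'c] := eqVneq c' c.
    by rewrite addrAC subrr add0r.
  by rewrite addrAC absDl ?ltW// (lt_trans us) ?hes// hes.
have [_ _ dfu] := hen u (ltW un).
have small : absv (y - f (c + u)) <= absv (df (c + u)) * (k * absv u).
  have -> : absv (df (c + u)) * (k * absv u) = k * absv (e%:R : C) * (absv b * absv u ^+ e).
    by rewrite mulrCA dfu bA -[RHS]mulrA.
  have -> : y - f (c + u) = b * (v i - u ^+ e) - (f (c + u) - f c - b * u ^+ e).
    have bv : b * v i = y - f c by rewrite /v mulrC divfK.
    have E (a1 a2 a3 a4 : C) : a1 - a2 = (a1 - a3 - a4) - (a2 - a3 - a4) by ring.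
    by rewrite mulrBr bv; exact: E.
  apply: absB_le.
    rewrite absM mulrCA ler_wpM2l// ue vE -mulrBl absM -absX ue absM.
    rewrite mulrA; apply: ler_pM => //.
    by rewrite (le_trans (ltW xi))// ler_wpM2l ?(ltW kap0)// xv ltW.
  rewrite (le_trans (ratf_leading cG ud))// -/e [absv u ^+ _]exprS [leLHS]mulrA.
  rewrite [leRHS]mulrA ler_wpM2r ?exprn_ge0//.
  by rewrite mulrC -ler_pdivlMr// ltW.
have [u' [Fu' u'u fy]] := ratf_onto FF (finite_ext_loc_compact (HC := HC) FE).1
  (poly_over_sub KF' KP) (poly_over_sub KF' KQ) (subD FF (KF' _ Kc) Fu) zG ku0 lin (KF' _ Ky) small.
have u'lt : absv u' < absv u by rewrite (le_lt_trans u'u)// gtr_pMl// regk_lt1.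
have E3 (a1 a2 a3 : C) : a1 + a2 + a3 - a1 = a2 + a3 by ring.
have zc := E3 c u u'.
exists (c + u + u'); split.
- by apply: (subD FF) => //; apply: (subD FF) => //; exact: KF'.
- by rewrite -subr_eq0 zc -(abs_gt0 (absv := absv)) absDl.
- by rewrite zc absDl.
- apply: (@expansive_pull _ _ _ _ HC _ _ HPQ G _ 1%N) => /=; last by rewrite fy.
  case=> // _ /=; apply: inG_near zG _.
  by rewrite (le_trans (ltW u'lt)).
Qed.

(* Discs around an aperiodic point [x] that are univalent up to a definite size at arbitrarily
   late times [n] can be mapped to each other: two of the points [f^n x] are close, and pulling
   one of them back along the orbit of the other produces a point close to [x]. *)
Lemma recurrent_preimages (K : set C) x (d1 : R) : finite_ext_Qp absv K ->
  poly_over K P -> poly_over K Q -> K x -> expansive G x -> ~ preperiodic P Q x -> 0 < d1 ->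
  (forall s0, 0 < s0 -> exists s n, [/\ 0 < s, s <= s0, lin_orbit G x s n & d1 <= gder x n * s]) ->
  forall r, 0 < r -> exists y, [/\ K y, y != x, absv (y - x) <= r & expansive G y].
Proof.
move=> KE KP KQ Kx xE xN d10 hs r r0; have KF : is_subfield K by case: KE.
have [cK tK] := finite_ext_loc_compact (HC := HC) KE.
have xG : inGorb G x by case: xE.
have /choice[g hg] : forall N : nat, exists sn : R * nat, [/\ (N < sn.2)%N, 0 < sn.1 <= r,
    lin_orbit G x sn.1 sn.2 & d1 <= gder x sn.2 * sn.1].
  move=> N; have LN : 0 < L ^+ N by rewrite exprn_gt0.
  (* Since [gder x n <= L ^ n], reaching size [d1] from such a small radius takes more than [N]
     steps. *)
  have s00 : 0 < Num.min r (d1 / 2 / L ^+ N) by rewrite lt_min r0 !divr_gt0.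
  have [s [n [s0]]] := hs _ s00; rewrite le_min => /andP[sr sd] lin big.
  exists (s, n); split => //=; last by rewrite s0.
  rewrite ltnNge; apply/negP => nN; move: big; rewrite leNgt => /negP; apply.
  rewrite (@le_lt_trans _ _ (L ^+ N * s))//.
    have gn : gder x n <= L ^+ n by apply: gder_le => i _; exact: xG.
    by rewrite ler_wpM2r ?(ltW s0)// (le_trans gn)// ler_weXn2l ?regL1.
  rewrite mulrC (le_lt_trans (ler_wpM2r (ltW LN) sd))// divfK ?gt_eqF//.
  by rewrite gtr_pMr// invf_lt1// ltr1n.
pose m i := iter i (fun N => (g N).2) 0%N.
have mS i : (m i < m i.+1)%N by have [] := hg (m i).
have mm i j : (i < j)%N -> (m i < m j)%N.
  elim: j => // j IH; rewrite ltnS leq_eqVlt => /orP[/eqP ->|/IH/ltn_trans]; first exact: mS.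
  by apply; exact: mS.
have xK i : field_ball absv K (regM G) (iter (m i.+1) f x).
  by split; [exact: sub_iter_ratf|case: (xG (m i.+1))].
have [i [j [ij xij]]] := tot_bounded_pigeonhole (HC := HC) (tK (regM G)) xK d10.
have [_ /andP[s0 sr] lin big] := hg (m i).
have [|y [Ky ys fy]] := lin_orbit_onto KF cK KP KQ Kx xG s0 lin (xK j).1.
  by rewrite absC (le_trans (ltW xij)).
exists y; split => //; last 2 first.
- exact: le_trans sr.
- apply: (@expansive_pull _ _ _ _ HC _ _ HPQ G _ (g (m i)).2).
    move=> l lm; have -> : y = x + (y - x) by rewrite addrC subrK.
    exact: (lin_orbit_inG xG s0 lin).
  by rewrite fy; exact: expansive_iter.
apply: contraPneq fy => -> /(not_preperiodic_inj xN) E.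
have := mm i.+1 j.+1 ij; rewrite -E ltnn.
by [].
Qed.

Lemma aperiodic_critical_approached (K : set C) c : finite_ext_Qp absv K ->
  poly_over K P -> poly_over K Q -> (forall c, c \in crits P Q -> K c) ->
  c \in crits P Q -> Julia setT (Some c) -> ~ preperiodic P Q c ->
  exists F c', [/\ finite_ext_Qp absv F, K `<=` F &
    [/\ c' \in crits P Q, Julia setT (Some c'), ~ preperiodic P Q c' &
    forall r, 0 < r -> exists z, [/\ F z, z != c', absv (z - c') < r & expansive G z]]].
Proof.
move=> KE KP KQ Kcr cc cJ cN; have KF : is_subfield K by case: KE.
pose wild c := [/\ c \in crits P Q, Julia setT (Some c) & ~ preperiodic P Q c].
have [[c1 [c2 [[h1 h2 h3] [g1 g2 g3] acc]]]|isol] := pselect (exists c1 c2, [/\ wild c1, wild c2 &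
    forall r, 0 < r -> exists n, iter n f c2 != c1 /\ absv (iter n f c2 - c1) < r]).
  exists K, c1; split => //; split => // r /acc[n [n1 n2]]; exists (iter n f c2); split => //.
    by apply: sub_iter_ratf => //; exact: Kcr.
  by apply: expansive_iter; exact: Julia_expansive.
(* Pass to the last critical point of the forward orbit: from [f c] on, no critical point is met. *)
have {c cc cJ cN} [c [[cc cJ cN] last]] : exists c, wild c /\
    forall n, iter n f (f c) \notin crits P Q.
  have [n0 hn0] := orbit_leaves (crits P Q) cN.
  have [|n /asboolP hn hmin] := @first_nat (fun n => `[< forall m, (n <= m)%N ->
    iter m f c \notin crits P Q >]); first by exists n0; exact/asboolP.
  case: n hn hmin => [|n] hn hmin; first by have := hn 0%N isT; rewrite /= cc.
  exists (iter n f c); split; last by move=> m; rewrite -iterS -iterD hn// leq_addl.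
  split; last 2 first.
  - exact: (Julia_orbit JG n cJ).
  - by move/preperiodic_iter.
  apply: contraT => cn; have /asboolPn := hmin n (ltnSn n); case=> m.
  by rewrite leq_eqVlt => /orP[/eqP <-//|]; exact: hn.
have cG : inG G c by case: (JG cJ).
have fJ : Julia setT (Some (f c)) by case: (JG cJ).
have fE : expansive G (f c) by exact: Julia_expansive.
have fN : ~ preperiodic P Q (f c) by move/(preperiodic_iter (n := 1)).
pose s := [seq a <- crits P Q | `[< Julia setT (Some a) /\ preperiodic P Q a >]].
have [|A [sA Af As]] := @preperiodic_orbits _ P Q s.
  by move=> a; rewrite mem_filter => /andP[/asboolP[]].
have AE a : a \in A -> expansive G a.
  move=> /As[r]; rewrite mem_filter => /andP[/asboolP[rJ _] _] [n ->].
  by apply: expansive_iter; exact: Julia_expansive.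
have [e1 e10 he1] : exists2 e, 0 < e & forall a, a \in A -> normal_at absv P Q a e.
  apply: (@seq_radius _ _ A (fun a e => normal_at absv P Q a e)).
    by move=> a e e' /andP[_ ee]; exact: normal_le.
  move=> a /AE[aG _]; have [e /andP[e0 ed] he] := normal_exists (HC := HC) (HPQ := HPQ) (aG 0%N).
  by exists e.
have [e2 e20 he2] : exists2 e, 0 < e & forall a, a \in A -> forall c', c' \in crits P Q ->
    c' != a -> e < absv (a - c').
  apply: (@seq_radius _ _ A (fun a e => forall c', c' \in crits P Q -> c' != a -> e < absv (a - c'))).
    by move=> a e e' /andP[_ ee] h c' cc' c'a; rewrite (le_lt_trans ee)// h.
  by move=> a _; exact: seq_separated.
(* The orbit of [f c] stays away from critical points outside [A]: Fatou ones have Fatou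
   neighbourhoods, preperiodic Julia ones lie in [A], and the others would give an accumulation
   excluded by [isol]. *)
have [e3 e30 he3] : exists2 e, 0 < e & forall c', c' \in crits P Q -> c' \notin A ->
    forall n, e <= absv (iter n f (f c) - c').
  apply: (@seq_radius _ _ (crits P Q) (fun c' e => c' \notin A ->
    forall n, e <= absv (iter n f (f c) - c'))).
    by move=> c' e e' /andP[_ ee] h c'A n; rewrite (le_trans ee)// h.
  move=> c' cc'; have [c'F|nF] := pselect (Fatou absv P Q setT (Some c')).
    have [r r0 hr] := Fatou_open (HC := HC) c'F; exists r => // _ n.
    rewrite leNgt; apply/negP => /hr; have [_] := Julia_orbit JG n fJ.
    by apply.
  have c'J : Julia setT (Some c') by split.
  have [c'p|c'N] := pselect (preperiodic P Q c').
    exists 1 => //; rewrite sA// mem_filter cc' andbT; exact/asboolP.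
  apply: contrapT => h; apply: isol; exists c', c; split => // r r0.
  apply: contrapT => h'; apply: h; exists r => // _ n; rewrite leNgt; apply/negP => cr.
  apply: h'; exists n.+1; rewrite iterSr; split => //.
  by apply: contraNneq (last n) => ->.
pose eA := Num.min d (Num.min e1 (Num.min e2 e3)).
have eA0 : 0 < eA by rewrite !lt_min regd0 e10 e20.
have [eAd eA1 eA2 eA3] : [/\ eA <= d, eA <= e1, eA <= e2 & eA <= e3].
  by split; rewrite !ge_min lexx ?orbT.
have Kfc : K (f c) by apply: sub_ratf => //; exact: Kcr.
have Acrit a c' : a \in A -> c' \in crits P Q -> c' != a -> eA < absv (a - c').
  by move=> aA cc' c'a; rewrite (le_lt_trans eA2)// he2.
have xA n : iter n f (f c) \notin A.
  by apply/negP => /(finite_preperiodic Af)/preperiodic_iter; exact: fN.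
have xc n c' : c' \in crits P Q -> absv (iter n f (f c) - c') < eA -> c' \in A.
  by move=> cc' cx; apply: contraTT cx => c'A; rewrite -leNgt (le_trans eA3)// he3.
have [d1 d10 hd1] := univalent_to_scale (HC := HC) (HPQ := HPQ) AE Af eA0 eAd
  (fun a aA => normal_le eA1 (he1 a aA)) Acrit fE xA xc.
have pre := recurrent_preimages KE KP KQ Kfc fE fN d10 hd1.
have [F [FE KFF hF]] := lift_through_critical KE KP KQ (Kcr c cc) cG pre.
by exists F, c; split.
Qed.

Lemma expanding_subhyperbolic (K : set C) c : finite_ext_Qp absv K ->
  poly_over K P -> poly_over K Q ->
  (forall F, finite_ext_Qp absv F -> K `<=` F -> expanding_admissible absv P Q F) ->
  c \in crits P Q -> Julia setT (Some c) -> preperiodic P Q c.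
Proof.
move=> KE KP KQ hexp cc cJ; apply: contrapT => cN; have KF : is_subfield K by case: KE.
have [|K' [K'E KK' K'c]] := adjoin_seq (s := crits P Q) KE.
  move=> y; rewrite critsP => yr; exists W; split => //; first exact: wronsk_neq0.
  exact: (over_wronsk KF).
have K'P := poly_over_sub KK' KP; have K'Q := poly_over_sub KK' KQ.
have [F [c' [FE KF' [c'c c'J c'N acc]]]] := aperiodic_critical_approached K'E K'P K'Q K'c cc cJ cN.
have FF : is_subfield F by case: FE.
have FP := poly_over_sub KF' K'P; have FQ := poly_over_sub KF' K'Q.
(* The approximating points are only known to be expansive. A generic element in one more extension
   makes their whole orbits Julia points over that field, as the expansion inequality requires. *)
have [l dl pl] := prime_above (rdeg P Q).
have [w [wF gw]] := exists_generic (HC := HC) FE pl.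
have EE : finite_ext_Qp absv (adjoin F w) by exact: adjoin_finite.
have EF : is_subfield (adjoin F w) by case: EE.
have FE' := @adjoin_contains _ _ FF w.
apply: (expanding_noncritical EF (poly_over_sub FE' FP) (poly_over_sub FE' FQ)
  (hexp _ EE _) _ c'J _ c'N).
- by move=> x /KK'/KF'/FE'.
- by apply: FE'; apply: KF'; exact: K'c.
- by apply/eqP; rewrite -critsP.
move=> e /acc[z [Fz zc ze zE]]; exists z; split => // n.
apply: (expansive_Julia FF FP FQ pl dl EF FE' _ (expansive_iter n zE) _ gw).
  exact: sub_iter_ratf.
exact: (adjoin_gen FF).
Qed.

End Necessity.

(** * Subhyperbolic maps are expanding *)

Section Weight.
Context {R : realType} {C : closedFieldType} {absv : C -> R} {p : nat}.
Context {HC : padic_field absv p}.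
Context {P Q : {poly C}} {HPQ : good_map P Q}.
Variable G : region absv P Q.
Implicit Types (a b c x y z u v w : C) (r s t e : R).
Notation f := (ratf P Q).
Notation df := (rat_deriv P Q).
Notation rad := (disc_rad absv P Q).
Notation d := (regd G). Notation L := (regL G). Notation B := (regB G).
Notation k := (regk G).
Notation m0 := (absv ((rdeg P Q)`!)%:R).
Notation W := (wronsk P Q).
Notation gder := (gder absv P Q).
Notation locdeg := (locdeg P Q).
Notation loccoef := (loccoef absv P Q).

Variables (X : set C) (A : seq C) (eA : R).
Hypothesis Xf : forall x, X x -> X (f x).
Hypothesis XE : forall x, X x -> expansive G x.
Hypothesis AX : forall a, a \in A -> X a.
Hypothesis Af : forall a, a \in A -> f a \in A.
Hypotheses (eA0 : 0 < eA) (eAd : eA <= d).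
Hypothesis Anormal : forall a, a \in A -> normal_at absv P Q a eA.
Hypothesis Acrit : forall a c, a \in A -> c \in crits P Q -> c != a -> eA < absv (a - c).
Hypothesis Asep : forall a b, a \in A -> b \in A -> b != a -> eA < absv (a - b).
Hypothesis Xcrit : forall x c, X x -> c \in crits P Q -> absv (x - c) < eA -> c \in A.

Lemma AE a : a \in A -> expansive G a. Proof. by move=> /AX/XE. Qed.

Lemma X_iter x n : X x -> X (iter n f x). Proof. by move=> xX; elim: n => //= n; exact: Xf. Qed.

Lemma X_inG x : X x -> inG G x. Proof. by move=> /XE[h _]; exact: (h 0%N). Qed.

Lemma eA_le1 : eA <= 1. Proof. by rewrite (le_trans eAd) ?regd1. Qed.

(** [gam a] is [eta] times [size A] local degrees, each at most the degree. Hence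
    [eta <= gam a <= 1/2], and the poles of the weight have orders between [1/2] and [1 - eta]. *)
Definition eta : R := (2 * (rdeg P Q)%:R ^+ size A)^-1.

(* The exponents are chosen so that [locdeg a * gam (f a) = gam a]: the singular weight
   [|z - a| ^ (gam a - 1)] is then multiplied by a constant along the orbit of [a]. *)
Definition gam a : R := eta * (\prod_(i < size A) locdeg (iter i f a))%:R.

Lemma rdeg_gt0 : 0 < (rdeg P Q)%:R :> R.
Proof. by rewrite ltr0n (leq_trans _ (dPQ (HPQ := HPQ))). Qed.

Lemma eta_gt0 : 0 < eta.
Proof. by rewrite invr_gt0 mulr_gt0// exprn_gt0// rdeg_gt0. Qed.

Lemma locdeg_gt0 a n : a \in A -> (0 < locdeg (iter n f a) <= rdeg P Q)%N.
Proof. by move=> aA; apply: (locdeg_bound (X_inG (X_iter n (AX aA)))). Qed.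

Lemma gam_ge a : a \in A -> eta <= gam a.
Proof.
move=> aA; rewrite ler_peMr ?(ltW eta_gt0)// ler1n prodn_gt0// => i.
by case/andP: (locdeg_gt0 i aA).
Qed.

Lemma gam_gt0 a : a \in A -> 0 < gam a.
Proof. by move=> aA; rewrite (lt_le_trans eta_gt0) ?gam_ge. Qed.

Lemma gam_le a : a \in A -> gam a <= 2^-1.
Proof.
move=> aA; rewrite /gam /eta invfM -mulrA ler_piMr// mulrC ler_pdivrMr ?exprn_gt0 ?rdeg_gt0//.
rewrite mul1r natr_prod -[X in _ ^+ X]card_ord -prodr_const ler_prod// => i _.
by rewrite ler0n ler_nat; case/andP: (locdeg_gt0 i aA).
Qed.

Lemma gam_le1 a : a \in A -> gam a <= 1.
Proof. by move=> /gam_le/le_trans-> //; rewrite invf_le1// ler1n. Qed.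

(** Passing from [a] to [f a] drops the factor [locdeg a] and adds the local degree after [size A]
    steps, which is 1. *)
Lemma gam_f a : a \in A -> (locdeg a)%:R * gam (f a) = gam a.
Proof.
move=> aA; rewrite /gam mulrCA; congr (_ * _); rewrite -natrM; congr (_%:R).
transitivity (\prod_(i < (size A).+1) locdeg (iter i f a))%N.
  by rewrite big_ord_recl; congr (_ * _)%N; apply: eq_bigr => i _; rewrite -iterSr.
by rewrite big_ord_recr/= (locdeg_late AE Af aA (leqnn _)) muln1.
Qed.

Definition sing a t := t `^ gam a / t.

Lemma sing_ge1 a t : a \in A -> 0 < t <= 1 -> 1 <= sing a t.
Proof.
move=> aA t01; have /andP[t0 _] := t01.
by rewrite /sing ler_pdivlMr// mul1r ger1_powR// gam_le1.
Qed.

Lemma sing_le a t : a \in A -> 0 < t <= 1 -> sing a t <= (t `^ (1 - eta))^-1.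
Proof.
move=> aA t01; have /andP[t0 _] := t01.
have tE : t = t `^ eta * t `^ (1 - eta).
  by rewrite -powRD ?(gt_eqF t0) ?implybT// addrC subrK powRr1// ltW.
rewrite /sing ler_pdivrMr// {3}tE [leRHS]mulrCA mulVf ?mulr1 ?gt_eqF ?powR_gt0//.
by apply: ger_powR => //; exact: gam_ge.
Qed.

(** By [Asep] at most one [a] contributes. On [A] itself the value is an artefact of division by 0;
    the final metric is [+oo] there. *)
Definition weight z : R :=
  \big[Num.max/1]_(a <- A | absv (z - a) <= eA) sing a (absv (z - a)).

Lemma weight_ge1 z : 1 <= weight z.
Proof. by rewrite /weight; elim/big_rec : _ => // a x _; rewrite le_max => ->; rewrite orbT. Qed.

Lemma weight_gt0 z : 0 < weight z.
Proof. exact: lt_le_trans (weight_ge1 z). Qed.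

Lemma weight_far z : (forall a, a \in A -> eA < absv (z - a)) -> weight z = 1.
Proof.
move=> h; rewrite /weight big_seq_cond big_pred0// => a; apply/negP => /andP[/h].
by rewrite leNgt => ->.
Qed.

Lemma weight_near a z : a \in A -> z != a -> absv (z - a) <= eA ->
  weight z = sing a (absv (z - a)).
Proof.
move=> aA za zeA; have z0 : 0 < absv (z - a) by rewrite abs_gt0 subr_eq0.
apply/eqP; rewrite eq_le; apply/andP; split; last first.
  exact: (@le_bigmax_seq _ _ _ _ _ _ _ (fun a => sing a (absv (z - a)))).
rewrite /weight big_seq_cond; apply: bigmax_le => [|b /andP[bA zb]].
  by rewrite sing_ge1// z0 (le_trans zeA) ?eA_le1.
have [->//|ba] := eqVneq b a.
have := Asep aA bA ba; rewrite ltNge => /negP; case.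
by rewrite (abs_tri_le (y := z))// absC.
Qed.

Lemma near_or_far z : (exists2 a, a \in A & absv (z - a) <= eA) \/
  (forall a, a \in A -> eA < absv (z - a)).
Proof.
have [h|h] := pselect (exists2 a, a \in A & absv (z - a) <= eA); [by left|right => a aA].
by rewrite ltNge; apply/negP => za; apply: h; exists a.
Qed.

Lemma weight_near_const z : z \notin A -> exists2 r : R, 0 < r &
  forall w, absv (w - z) <= r -> weight w = weight z.
Proof.
move=> zA; have [r r0 hr] := seq_separated (HC := HC) z A; exists r => // w wz.
have E a : a \in A -> absv (w - a) = absv (z - a).
  move=> aA; rewrite (_ : w - a = (z - a) + (w - z)); last by ring.
  rewrite absDl// (le_lt_trans wz)// hr//.
  by apply: contraNneq zA => <-.
rewrite /weight big_seq_cond [RHS]big_seq_cond; apply: eq_big => [a|a /andP[aA _]].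
  by have [/E ->|//] := boolP (a \in A).
by rewrite E.
Qed.

Lemma weight_le z : z \notin A -> weight z <= 1 \/
  exists2 a, a \in A & weight z <= (absv (z - a) `^ (1 - eta))^-1.
Proof.
move=> zA; have [[a aA za]|h] := near_or_far z; last by left; rewrite weight_far.
right; exists a => //; have nza : z != a by apply: contraNneq zA => ->.
rewrite (weight_near aA nza za) sing_le// abs_gt0 subr_eq0 nza (le_trans za)//.
exact: eA_le1.
Qed.

Definition drift a n : R := \prod_(i < n) loccoef (iter i f a) `^ gam (iter i.+1 f a).

Lemma drift_gt0 a n : a \in A -> 0 < drift a n.
Proof.
move=> aA; apply: prodr_gt0 => i _; apply: powR_gt0; apply: (loccoef_gt0 (G := G)).
exact: X_inG (X_iter i (AX aA)).
Qed.

(** A step maps the radius [t] to [b t ^ e]; raised to the exponent [gam], this becomes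
    multiplication by a constant, by [gam_f]. *)
Lemma rad_power a u n : a \in A -> (forall i, (i < n)%N -> rad a (absv u) i <= eA) ->
  rad a (absv u) n `^ gam (iter n f a) = drift a n * absv u `^ gam a.
Proof.
move=> aA; elim: n => [|n IH] h; first by rewrite /drift big_ord0 mul1r.
have hn i : (i < n)%N -> rad a (absv u) i <= eA by move=> ni; rewrite h// ltnS ltnW.
have [E _] := follow Af Anormal aA hn.
have En : absv (iter n f (a + u) - iter n f a) <= eA by rewrite E h.
have [F1 _ _] := Anormal (A_iter Af n aA) En.
rewrite /drift big_ord_recr /= -/(drift a n) -E F1 E.
have an := A_iter Af n aA.
rewrite powRM ?exprn_ge0 ?rad_ge0//; last first.
  by rewrite ltW// (loccoef_gt0 (X_inG (AX an))).
rewrite -powR_mulrn ?rad_ge0// -powRrM gam_f// IH//.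
by rewrite mulrCA mulrA.
Qed.

Lemma crit_notin x : X x -> x \notin A -> W.[x] != 0.
Proof.
move=> Xx; apply: contraNneq => Wx; apply: (Xcrit Xx); last by rewrite subrr abs0.
by rewrite critsP Wx.
Qed.

(** The Wronskian is a product of distances to critical points. Those in [A] are far by assumption,
    those outside [A] are far from all of [X] by [Xcrit]. *)
Lemma df_far : exists2 K0 : R, 0 < K0 & forall x, X x ->
  (forall a, a \in A -> eA < absv (x - a)) -> K0 <= absv (df x).
Proof.
have W0 : 0 < absv (lead_coef W) by rewrite abs_gt0 lead_coef_eq0 wronsk_neq0.
exists (absv (lead_coef W) * eA ^+ size (crits P Q) / B ^+ 2).
  by rewrite divr_gt0 ?mulr_gt0 ?exprn_gt0 ?regB0.
move=> x Xx h; have xG := X_inG Xx.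
have Qx : absv Q.[x] <= B by rewrite (le_trans (gaussn_horner _ xG.1)) ?regQB.
rewrite rat_derivE absf_div absX; apply: ler_pM; rewrite ?mulr_ge0 ?invr_ge0 ?exprn_ge0 ?(ltW eA0) ?(ltW (regB0 G))//.
  rewrite wronskE absM ler_wpM2l//.
  have : forall c, c \in crits P Q -> eA <= absv (x - c).
    move=> c cc; have [cA|cA] := boolP (c \in A); first by rewrite ltW// h.
    by rewrite leNgt; apply: contra cA; exact: Xcrit.
  elim: (crits P Q) => [|c s IH] hs; first by rewrite big_nil abs1.
  rewrite big_cons absM exprS ler_pM ?exprn_ge0 ?(ltW eA0) ?hs ?mem_head ?IH// => c' c's.
  by rewrite hs// in_cons c's orbT.
have Qx0 : 0 < absv Q.[x] by rewrite abs_gt0 (inG_Q xG).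
by rewrite lef_pV2 ?posrE ?exprn_gt0 ?regB0// lerXn2r// ?nnegrE ?(ltW (regB0 G)).
Qed.

Lemma weight_step_near a z : a \in A -> z != a -> absv (z - a) <= eA -> f z != f a ->
  m0 * Num.min eA (loccoef a `^ gam (f a)) * weight z <= weight (f z) * absv (df z).
Proof.
move=> aA za zeA fza; have z0 : 0 < absv (z - a) by rewrite abs_gt0 subr_eq0.
have m00 := m0_gt0 (HC := HC) P Q; have aG := X_inG (AX aA).
have [_ F2 F3] := Anormal aA zeA; have zE : a + (z - a) = z by rewrite addrC subrK.
rewrite zE in F2 F3.
set t := absv (z - a) in z0 zeA F2 F3 *.
have em : m0 <= absv (locdeg a)%:R by exact: abs_locdeg_ge aG.
have dfE : absv (df z) = absv (locdeg a)%:R * absv (f z - f a) / t.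
  by rewrite F2 -F3 mulfK// gt_eqF.
rewrite (weight_near aA za zeA) -/t /sing dfE !mulrA ler_wpM2r ?invr_ge0 ?(ltW z0)//.
rewrite -[leLHS]mulrA [X in _ <= X * _]mulrC -[leRHS]mulrA.
apply: ler_pM => //.
  by rewrite mulr_ge0 ?powR_ge0// le_min (ltW eA0) powR_ge0.
have [near|far] := leP (absv (f z - f a)) eA.
  have pos : 0 < absv (f z - f a) by rewrite abs_gt0 subr_eq0.
  rewrite (weight_near (Af aA) fza near) /sing divfK ?gt_eqF// F2 powRM ?exprn_ge0 ?(ltW z0)//; last first.
    by rewrite ltW// (loccoef_gt0 aG).
  rewrite -powR_mulrn ?(ltW z0)// -powRrM gam_f// ler_wpM2r ?powR_ge0//.
  by rewrite ge_min lexx orbT.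
rewrite (@le_trans _ _ (eA * 1))//; last first.
  by rewrite mulr1 (le_trans (ltW far))// ler_peMl// weight_ge1.
apply: ler_pM; rewrite ?powR_ge0//; first by rewrite le_min (ltW eA0) powR_ge0.
  by rewrite ge_min lexx.
rewrite -[leRHS](powRr0 t); apply: ger_powR; last exact: ltW (gam_gt0 aA).
by rewrite z0 (le_trans zeA) ?eA_le1.
Qed.

(** One step may contract the weight, but by a bounded factor only; this controls the finitely many
    steps that no expansion estimate covers. *)
Lemma weight_step : exists2 K0 : R, 0 < K0 <= 1 & forall z, X z -> z \notin A -> f z \notin A ->
  K0 * weight z <= weight (f z) * absv (df z).
Proof.
have m00 := m0_gt0 (HC := HC) P Q.
have [K1 K10 hK1] := df_far.
have [K2 K20 hK2] : exists2 K2 : R, 0 < K2 & forall a, a \in A ->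
    K2 <= m0 * Num.min eA (loccoef a `^ gam (f a)).
  apply: (@seq_radius _ _ A (fun a K2 => K2 <= m0 * Num.min eA (loccoef a `^ gam (f a)))).
    by move=> a e e' /andP[_ ee]; exact: le_trans.
  move=> a aA; exists (m0 * Num.min eA (loccoef a `^ gam (f a))) => //.
  by rewrite mulr_gt0// lt_min eA0 powR_gt0// (loccoef_gt0 (X_inG (AX aA))).
have K30 : 0 < Num.min 1 (Num.min K1 K2) by rewrite !lt_min ltr01 K10.
exists (Num.min 1 (Num.min K1 K2)); first by rewrite K30 ge_min lexx.
move=> z Xz zA fzA; have [[a aA za]|far] := near_or_far z.
  have nza : z != a by apply: contraNneq zA => ->.
  have nfz : f z != f a by apply: contraNneq fzA => ->; exact: Af.
  rewrite (le_trans _ (weight_step_near aA nza za nfz))// ler_wpM2r ?(ltW (weight_gt0 z))//.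
  by rewrite (le_trans _ (hK2 a aA))// !ge_min lexx !orbT.
rewrite (weight_far far) mulr1 (@le_trans _ _ (1 * K1))//.
  by rewrite mul1r !ge_min lexx !orbT.
by apply: ler_pM; rewrite ?ler01 ?weight_ge1 ?hK1// ltW.
Qed.

(** On such orbits [weight] has its intended values, and for [z] in [X] no critical point is met, so
    [gder] is positive. *)
Definition avoids z n := forall i, (i <= n)%N -> iter i f z \notin A.

Lemma avoidsW z m n : (m <= n)%N -> avoids z n -> avoids z m.
Proof. by move=> mn h i im; apply: h; exact: leq_trans mn. Qed.

Lemma avoids_iter z m n : avoids z (m + n) -> avoids (iter m f z) n.
Proof. by move=> h i i_n; rewrite -iterD h// addnC leq_add2l. Qed.

Lemma weight_steps (K0 : R) z n : 0 < K0 -> (forall z, X z -> z \notin A -> f z \notin A ->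
    K0 * weight z <= weight (f z) * absv (df z)) ->
  X z -> avoids z n -> K0 ^+ n * weight z <= weight (iter n f z) * gder z n.
Proof.
move=> K00 hK0 Xz; elim: n => [|n IH] h; first by rewrite expr0 mul1r mulr1.
have {}IH := IH (avoidsW (leqnSn n) h).
rewrite exprS -mulrA (le_trans (ler_wpM2l (ltW K00) IH))//= [leLHS]mulrA [leRHS]mulrCA.
rewrite [leRHS]mulrC ler_wpM2r ?gder_ge0// hK0//.
- exact: X_iter.
- exact: h (leqnSn n).
- exact: (h n.+1).
Qed.

Lemma avoids_gder z n : X z -> (forall i, (i < n)%N -> iter i f z \notin A) -> 0 < gder z n.
Proof.
move=> Xz h; apply: gder_gt0 => i ni; split; first exact: X_inG (X_iter i Xz).
by apply: crit_notin (h i ni); exact: X_iter.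
Qed.

(** As long as the orbit stays within [eA] of that of [a], the weight is multiplied by exactly
    [emul a n * drift a n]. A disc that starts very small needs a large [drift] to leave, whereas
    [emul] is bounded below. *)
Lemma expansion_at_A a (K0 : R) : a \in A -> 0 < K0 -> exists n (r : R), [/\ (0 < n)%N, 0 < r &
  forall z, z != a -> absv (z - a) <= r -> K0 * weight z <= weight (iter n f z) * gder z n].
Proof.
move=> aA K00; have m00 := m0_gt0 (HC := HC) P Q; have g0 := gam_gt0 aA.
have mA : 0 < m0 ^+ size A by rewrite exprn_gt0.
(* If [|u| ^ gam a <= tau], then at the exit time [eA <= rad ^ gam = drift |u| ^ gam a <= drift
   tau], that is, [K0 <= m0 ^ size A drift]. *)
pose tau := m0 ^+ size A * eA / K0; have tau0 : 0 < tau by rewrite divr_gt0// mulr_gt0.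
have mn0 : 0 < Num.min eA (tau `^ (gam a)^-1) by rewrite lt_min eA0 powR_gt0.
have [l hl] := abs_p_exp_small (HC := HC) mn0; set u := p%:R ^+ l in hl.
have u0 : 0 < absv u by rewrite absX exprn_gt0// abs_p_gt0.
move: hl; rewrite lt_min => /andP[ueA ut].
have utau : absv u `^ gam a <= tau.
  have -> : tau = (tau `^ (gam a)^-1) `^ gam a.
    by rewrite -powRrM mulVf ?gt_eqF// powRr1// ltW.
  by apply: ge0_ler_powR; rewrite ?nnegrE ?powR_ge0// ltW.
have [n hn hmin] := exit_time AE eAd aA u0.
have n0 : (0 < n)%N by case: (n) hn => //=; rewrite ltNge ltW.
have Ln : 0 < L ^+ n by rewrite exprn_gt0.
have an := A_iter Af n aA.
have drift_ge : K0 <= m0 ^+ size A * drift a n.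
  have E := rad_power aA hmin.
  have h1 : eA <= rad a (absv u) n `^ gam (iter n f a).
    rewrite (@le_trans _ _ (eA `^ gam (iter n f a)))//.
      by rewrite ger1_powR ?eA0 ?eA_le1// gam_le1.
    by apply: ge0_ler_powR; rewrite ?nnegrE ?rad_ge0 ?(ltW eA0) ?(ltW hn)// ltW// gam_gt0.
  have h2 : eA <= drift a n * tau.
    by rewrite (le_trans h1)// E ler_wpM2l// ltW// drift_gt0.
  move: h2; rewrite /tau mulrA ler_pdivlMr// => h2.
  by rewrite -(ler_pM2r eA0) mulrC (le_trans h2)// mulrCA mulrA.
exists n, (eA / L ^+ n); rewrite divr_gt0//; split => // z za zr.
have z0 : 0 < absv (z - a) by rewrite abs_gt0 subr_eq0.
have Lz : L ^+ n * absv (z - a) <= eA by rewrite mulrC -ler_pdivlMr.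
have small i : (i <= n)%N -> rad a (absv (z - a)) i <= eA.
  move=> i_n; have h : L ^+ i * absv (z - a) <= eA.
    by rewrite (le_trans _ Lz)// ler_wpM2r// ler_weXn2l ?regL1.
  rewrite (le_trans (rad_le_exp (AE aA).1 (ltW z0) _))//.
  by rewrite (le_trans h) ?eA_le1.
have [|E1 E2] := follow Af Anormal (u := z - a) (n := n) aA.
  by move=> i i_n; rewrite small// ltnW.
have zE : a + (z - a) = z by rewrite addrC subrK.
rewrite zE in E1 E2.
have r0 : 0 < rad a (absv (z - a)) n by exact: rad_gt0 (AE aA).1 _.
have nz : iter n f z != iter n f a by rewrite -subr_eq0 -(abs_gt0 (absv := absv)) E1.
have zeA : absv (z - a) <= eA by exact: (small 0%N).
have em_ge := emul_ge (HC := HC) (HPQ := HPQ) AE Af n aA.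
set em := emul _ _ in E2 em_ge.
have gE : gder z n = em * rad a (absv (z - a)) n / absv (z - a).
  by rewrite -E2 mulfK// gt_eqF.
rewrite (weight_near aA za zeA) (weight_near an nz) E1 ?small// /sing gE.
rewrite (rad_power aA) => [|i i_n]; last by rewrite small// ltnW.
set t := absv (z - a) in z0 r0 *; set r := rad a t n in r0 *.
have -> : drift a n * t `^ gam a / r * (em * r / t) =
    (em * drift a n) * (t `^ gam a / t).
  by field; rewrite !gt_eqF.
rewrite ler_wpM2r ?divr_ge0 ?powR_ge0 ?(ltW z0)// (le_trans drift_ge)//.
by rewrite ler_wpM2r ?(ltW (drift_gt0 n aA)).
Qed.

Lemma local_expansion x : X x -> exists n (r : R), [/\ (0 < n)%N, 0 < r &
  forall z, X z -> absv (z - x) < r -> avoids z n ->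
    2 * weight z <= weight (iter n f z) * gder z n].
Proof.
move=> Xx; have xE := XE Xx; have [xG _] := xE.
have [[j xj]|miss] := pselect (exists j, iter j f x \in A).
  have [K1 /andP[K10 _] hK1] := weight_step.
  (* The rate required at the point of [A] makes up for the possible loss [K1 ^ j] of the [j] steps
     that lead to it. *)
  have K20 : 0 < 2 / K1 ^+ j by rewrite divr_gt0// exprn_gt0.
  have [n [r [n0 r0 hr]]] := expansion_at_A xj K20.
  have [e e0 he] := iter_punctured (HC := HC) (HPQ := HPQ) j xG r0.
  exists (j + n)%N, e; rewrite addn_gt0 n0 orbT; split => // z Xz ze zav.
  have zx : z != x.
    by apply: contraTneq xj => <-; apply: zav; rewrite leq_addr.
  have [zj1 zj2] := he z zx ze; have {}hr := hr _ zj1 (ltW zj2).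
  have h := weight_steps K10 hK1 Xz (avoidsW (leq_addr n j) zav).
  rewrite gder_shift addnC iterD mulrA [leRHS]mulrAC.
  rewrite (le_trans _ (ler_wpM2r (gder_ge0 z j) hr))// -mulrA.
  by rewrite -ler_pdivrMl ?divr_gt0 ?exprn_gt0// invf_div mulrA divfK.
have xA n : iter n f x \notin A by apply/negP => h; apply: miss; exists n.
have xc n c : c \in crits P Q -> absv (iter n f x - c) < eA -> c \in A.
  by move=> cc; apply: Xcrit => //; exact: X_iter.
have [d1 d10 hd1] := univalent_to_scale (HC := HC) (HPQ := HPQ) AE Af eA0 eAd Anormal Acrit xE xA xc.
have w0 := weight_gt0 x; have w1 := weight_ge1 x.
(* A disc of radius at most [d1 / (2 weight x)] that grows linearly to size [d1] has derivative at
   least [2 weight x]. *)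
have [s [n [s0 ss0 lin big]]] := hd1 _ (divr_gt0 d10 (mulr_gt0 (ltr0n R 2) w0)).
have gx : 2 * weight x <= gder x n.
  rewrite -(ler_pM2r s0) (le_trans _ big)// mulrC -ler_pdivlMr// mulr_gt0//.
have [r r0 hr] := weight_near_const (xA 0%N).
exists n, (Num.min s r); split.
- case: n gx {lin big} => //=; rewrite leNgt => /negP; case.
  by rewrite (lt_le_trans (ltr1n R 2))// ler_peMr.
- by rewrite lt_min s0.
- move=> z Xz; rewrite lt_min => /andP[zs zr] _.
  have zE : x + (z - x) = z by rewrite addrC subrK.
  rewrite (hr z (ltW zr)) -{2}zE (lin_orbit_gder xG s0 lin (ltW zs)).
  by rewrite (le_trans gx)// ler_peMl ?gder_ge0// weight_ge1.
Qed.

Hypothesis Xcompact : disc_compact absv X.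

Lemma uniform_expansion : exists2 N, (0 < N)%N & forall z, X z -> avoids z N ->
  2 * weight z <= weight (iter N f z) * gder z N.
Proof.
have /choice[g hg] : forall x, exists nr : nat * R, X x -> [/\ (0 < nr.1)%N, 0 < nr.2 &
    forall z, X z -> absv (z - x) < nr.2 -> avoids z nr.1 ->
    2 * weight z <= weight (iter nr.1 f z) * gder z nr.1].
  move=> x; have [Xx|nX] := pselect (X x); last by exists (0%N, 0).
  by have [n [r h]] := local_expansion Xx; exists (n, r).
have [s sX hs] := Xcompact (r := fun x => (g x).2) (fun x Xx => let: And3 _ h _ := hg x Xx in h).
pose M := (\max_(x <- s) (g x).1).+1%N.
have block z : X z -> exists2 n, (0 < n <= M)%N & avoids z n ->
    2 * weight z <= weight (iter n f z) * gder z n.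
  move=> Xz; have [y ys zy] := hs z Xz; have [h1 h2 h3] := hg y (sX y ys).
  exists (g y).1; last exact: h3.
  by rewrite h1 ltnW// ltnS (@leq_bigmax_seq _ s xpredT (fun x => (g x).1) y).
have [K1 /andP[K10 K11] hK1] := weight_step.
have KM : 0 < K1 ^+ M by rewrite exprn_gt0.
(* The orbit is cut into blocks of length at most [M]. Each block gains a factor 2, and the
   incomplete last one loses at most [K1 ^ M]. *)
have key n : forall l z, (l * M <= n)%N -> X z -> avoids z n ->
    2 ^+ l * K1 ^+ M * weight z <= weight (iter n f z) * gder z n.
  have [m] := ubnP n; elim: m n => // m IH n nm l z ln Xz zn.
  have [nM|Mn] := ltnP n M.
    have -> : l = 0%N by case: l ln => // l; rewrite mulSn => h; move: (leq_trans (leq_addr _ _) h); rewrite leqNgt nM.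
    rewrite mul1r (le_trans _ (weight_steps K10 hK1 Xz zn))//.
    by rewrite ler_wpM2r ?(ltW (weight_gt0 z))// ler_wiXn2l ?(ltW K10)// ltnW.
  have [i /andP[i0 iM] hi] := block z Xz; have i_n := leq_trans iM Mn.
  have {}hi := hi (avoidsW i_n zn).
  have nE : n = (i + (n - i))%N by rewrite subnKC.
  have hl : (l.-1 * M <= n - i)%N.
    rewrite -subn1 mulnBl mul1n (leq_trans (leq_sub2r M ln))//.
    exact: leq_sub2l.
  have nim : (n - i < m)%N by rewrite (leq_trans _ (ltnSE nm))// ltn_subrL i0 (leq_trans i0).
  have zni : avoids (iter i f z) (n - i) by apply: avoids_iter; rewrite -nE.
  have h := IH (n - i)%N nim l.-1 (iter i f z) hl (X_iter i Xz) zni.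
  rewrite nE gder_shift addnC iterD [leRHS]mulrA [leRHS]mulrAC.
  have a0 : 0 <= 2 ^+ l.-1 * K1 ^+ M by rewrite mulr_ge0 ?exprn_ge0// ltW.
  rewrite (le_trans _ (ler_wpM2r (gder_ge0 z i) h))// -[leRHS]mulrA.
  rewrite (le_trans _ (ler_wpM2l a0 hi))// [leRHS]mulrA ler_wpM2r ?(ltW (weight_gt0 z))//.
  rewrite [leRHS]mulrAC -exprSr ler_wpM2r ?(ltW KM)// ler_weXn2l ?ler1n//.
  exact: leqSpred.
have [l hl] := half_exp_small (2 / K1 ^+ M) ltr01.
exists (l.+1 * M)%N => // z Xz zn.
rewrite (le_trans _ (key _ l.+1 z (leqnn _) Xz zn))// ler_wpM2r ?(ltW (weight_gt0 z))//.
rewrite -ler_pdivrMr//; move: hl; rewrite ltr_pdivrMr ?exprn_gt0// mul1r => hl.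
by rewrite (le_trans (ltW hl))// ler_weXn2l ?ler1n.
Qed.

Lemma sing_infty a (K0 : R) : a \in A -> 0 < K0 -> exists2 r : R, 0 < r <= eA &
  forall t, 0 < t <= r -> K0 <= sing a t.
Proof.
(* As [gam a <= 1/2], the singular weight is at least [t ^ (-1/2)], which is at least [K0] once
   [t <= K0 ^ (-2)]. *)
move=> aA K00; have r0 : 0 < Num.min eA (K0 ^- 2) by rewrite lt_min eA0 invr_gt0 exprn_gt0.
exists (Num.min eA (K0 ^- 2)); first by rewrite r0 ge_min lexx.
move=> t /andP[t0]; rewrite le_min => /andP[teA tK].
have t1 : 0 < t <= 1 by rewrite t0 (le_trans teA) ?eA_le1.
have s0 : 0 <= sing a t by rewrite divr_ge0 ?powR_ge0// ltW.
rewrite -(ler_pXn2r (ltn0Sn 1)) ?nnegrE ?(ltW K00)//.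
rewrite /sing expr_div_n -(powR_mulrn 2 (powR_ge0 t (gam a))) -powRrM.
rewrite (@le_trans _ _ (t / t ^+ 2))//.
  rewrite [t ^+ 2]expr2 invfM mulrA divff ?gt_eqF// mul1r.
  by rewrite -[leLHS]invrK lef_pV2// posrE ?invr_gt0 ?exprn_gt0.
rewrite ler_wpM2r ?invr_ge0 ?exprn_ge0 ?(ltW t0)// ger1_powR//.
by rewrite -ler_pdivlMr// mul1r gam_le.
Qed.

Lemma weight_infty a (K0 : R) : a \in A -> 0 < K0 -> exists2 r : R, 0 < r &
  forall z, z != a -> absv (z - a) < r -> K0 <= weight z.
Proof.
move=> aA /(sing_infty aA)[r /andP[r0 reA] hr]; exists r => // z za zr.
rewrite (weight_near aA za (le_trans (ltW zr) reA)) hr// ltW// abs_gt0 subr_eq0 za//.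
Qed.

Lemma local_const x : X x -> x \notin A -> exists2 r : R, 0 < r & forall w, absv (w - x) < r ->
  [/\ w \notin A, weight w = weight x & absv (df w) = absv (df x)].
Proof.
move=> Xx xA; have [r1 r10 hr1] := weight_near_const xA.
have [r2 r20 hr2] := seq_separated (HC := HC) x A.
have [r3 r30 hr3] := seq_separated (HC := HC) x (crits P Q).
have m30 : 0 < k * Num.min 1 r3 by rewrite mulr_gt0// lt_min ltr01.
exists (Num.min r1 (Num.min r2 (k * Num.min 1 r3))); first by rewrite !lt_min r10 r20.
move=> w; rewrite !lt_min => /and3P[w1 w2 w3]; split.
- apply: contraL w2 => wA; rewrite -leNgt absC ltW// hr2//.
  by apply: contraNneq xA => <-.
- by rewrite hr1// ltW.
- rewrite -(subrK x w) addrC; apply: (df_near (X_inG Xx) m30 _ (ltW w3)).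
  split; first by rewrite ler_piMr ?ge_min ?lexx ?(ltW (regk0 G)).
  move=> c cc; rewrite ler_pM2l// ge_min (ltW (hr3 c cc _)) ?orbT//.
  have := crit_notin Xx xA; apply: contraNneq => <-.
  by rewrite -critsP.
Qed.

Lemma orbit_near x n r : X x -> 0 < r -> exists2 e : R, 0 < e & forall w, absv (w - x) < e ->
  absv (iter n f w - iter n f x) < r.
Proof.
move=> Xx r0; have [e e0 he] := iter_punctured (HC := HC) (HPQ := HPQ) n (XE Xx).1 r0.
exists e => // w we; have [->|wx] := eqVneq w x; first by rewrite subrr abs0.
by case: (he w wx we).
Qed.

Lemma orbit_local_const x n : X x -> (forall i, (i < n)%N -> iter i f x \notin A) ->
  exists2 r : R, 0 < r & forall w, absv (w - x) < r ->
    (forall i, (i < n)%N -> iter i f w \notin A) /\ gder w n = gder x n.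
Proof.
move=> Xx; elim: n => [|n IH] h; first by exists 1.
have [|r1 r10 hr1] := IH; first by move=> i ni; apply: h; rewrite ltnS ltnW.
have [r2 r20 hr2] := local_const (X_iter n Xx) (h n (ltnSn n)).
have [r3 r30 hr3] := orbit_near n Xx r20.
exists (Num.min r1 r3); first by rewrite lt_min r10.
move=> w; rewrite lt_min => /andP[/hr1[h1 h2] /hr3/hr2[h3 h4 h5]]; split.
  by move=> i; rewrite ltnS leq_eqVlt => /orP[/eqP ->//|]; exact: h1.
by rewrite /= h2 h5.
Qed.

(** * A metric expanded at every step *)

Section AdaptedMetric.
Variables (N : nat) (lam : R).
Hypotheses (N0 : (0 < N)%N) (lam1 : 1 < lam) (lamN : lam ^+ N <= 2).
Hypothesis Nexp : forall z, X z -> avoids z N -> 2 * weight z <= weight (iter N f z) * gder z N.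

Let lam0 : 0 < lam. Proof. exact: lt_trans lam1. Qed.

Definition scaled z n := (lam ^+ n)^-1 * (weight (iter n f z) * gder z n).

(* Taking the minimum over a period of expansion makes the metric expand at every step. *)
Definition metric z : R := \big[Num.min/weight z]_(n < N | `[< avoids z n >]) scaled z n.

Lemma metric_le z : metric z <= weight z.
Proof. exact: bigmin_le_id. Qed.

Lemma metric_le_scaled z n : (n < N)%N -> avoids z n -> metric z <= scaled z n.
Proof.
move=> nN zn; apply: (@bigmin_le_cond _ _ _ _ (Ordinal nN)); exact/asboolP.
Qed.

Lemma metric_ge z m : m <= weight z -> (forall n, (n < N)%N -> avoids z n -> m <= scaled z n) ->
  m <= metric z.
Proof. by move=> h0 h; apply: le_bigmin => // i /asboolP; exact: h. Qed.

Lemma metric_lower : exists2 K0 : R, 0 < K0 & forall z, X z -> K0 * weight z <= metric z.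
Proof.
have [K1 /andP[K10 K11] hK1] := weight_step.
have l1 n : lam ^- n <= 1 by rewrite invf_le1 ?exprn_gt0// exprn_ege1// ltW.
exists (lam ^- N * K1 ^+ N); first by rewrite mulr_gt0 ?invr_gt0 ?exprn_gt0.
move=> z Xz; apply: metric_ge => [|n nN zn].
  rewrite ler_piMl ?(ltW (weight_gt0 z))// mulr_ile1 ?invr_ge0 ?exprn_ge0 ?(ltW lam0) ?(ltW K10)//.
  by rewrite exprn_ile1// ltW.
rewrite /scaled -mulrA; apply: ler_pM.
- by rewrite invr_ge0 exprn_ge0// ltW.
- by rewrite mulr_ge0 ?exprn_ge0 ?(ltW K10)// ltW// weight_gt0.
- by rewrite lef_pV2 ?posrE ?exprn_gt0// ler_weXn2l ?(ltW lam1)// ltnW.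
- rewrite (le_trans _ (weight_steps K10 hK1 Xz zn))// ler_wpM2r ?(ltW (weight_gt0 z))//.
  by rewrite ler_wiXn2l ?(ltW K10)// ltnW.
Qed.

Lemma metric_expanding z : X z -> z \notin A -> f z \notin A ->
  lam * metric z <= metric (f z) * absv (df z).
Proof.
move=> Xz zA fzA; have D0 : 0 < absv (df z).
  by have := @avoids_gder z 1 Xz; rewrite /= mul1r; apply; case.
have next n : avoids (f z) n -> avoids z n.+1.
  by move=> h [|i]; rewrite ?ltnS// iterSr => /h.
have E n : scaled (f z) n * absv (df z) = lam * scaled z n.+1.
  have lE : lam * (lam ^+ n.+1)^-1 = (lam ^+ n)^-1.
    by rewrite exprS invfM mulrA divff ?mul1r// gt_eqF.
  have E4 (a b c e : R) : a * (b * c) * e = a * (b * (e * c)) by ring.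
  by rewrite /scaled [RHS]mulrA lE -iterSr gder_S; exact: E4.
(* Shifting the orbit produces the one term [n + 1 = N] outside the minimum; expansion over [N]
   steps and [lam ^ N <= 2] make it at least [weight z]. *)
have main n : (n < N)%N -> avoids z n.+1 -> metric z <= scaled z n.+1.
  rewrite leq_eqVlt => /orP[/eqP nN|nN] zn; last exact: metric_le_scaled.
  rewrite nN in zn *; rewrite (le_trans (metric_le z))// /scaled mulrC.
  rewrite ler_pdivlMr ?exprn_gt0// (le_trans _ (Nexp Xz zn))// mulrC.
  by rewrite ler_wpM2r ?(ltW (weight_gt0 z)).
rewrite -ler_pdivrMr//; apply: metric_ge => [|n nN fzn].
  have -> : weight (f z) = scaled (f z) 0 by rewrite /scaled expr0 invr1 mul1r mulr1.
  rewrite ler_pdivrMr// E ler_pM2l// main//; apply: next.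
  by case.
by rewrite ler_pdivrMr// E ler_pM2l// main//; exact: next.
Qed.

(** Terms whose orbit avoids [A] are locally constant. A term omitted at [x] because the orbit of
    [x] meets [A] may occur at nearby points, but there it exceeds [weight x], as the weight blows
    up at [A], and leaves the minimum unchanged. *)
Lemma metric_local_const x : X x -> x \notin A -> exists2 r : R, 0 < r &
  forall w, X w -> absv (w - x) < r -> metric w = metric x.
Proof.
move=> Xx xA; have [K1 /andP[K10 K11] hK1] := weight_step.
have [r0 r00 hr0] := local_const Xx xA.
have step n : exists2 r : R, 0 < r & forall w, X w -> absv (w - x) < r ->
    (avoids x n -> avoids w n /\ scaled w n = scaled x n) /\
    (~ avoids x n -> avoids w n -> weight x <= scaled w n).
  have [xn|xn] := pselect (avoids x n).
    have [r1 r10 hr1] := orbit_local_const Xx (fun i ni => xn i (ltnW ni)).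
    have [r2 r20 hr2] := local_const (X_iter n Xx) (xn n (leqnn n)).
    have [r3 r30 hr3] := orbit_near n Xx r20.
    exists (Num.min r1 r3); first by rewrite lt_min r10.
    move=> w Xw; rewrite lt_min => /andP[/hr1[h1 h2] /hr3/hr2[h3 h4 h5]]; split => // _.
    split; last by rewrite /scaled h4 h2.
    by move=> i; rewrite leq_eqVlt => /orP[/eqP ->//|]; exact: h1.
  have [j jn [xj jmin]] : exists2 j, (j <= n)%N & iter j f x \in A /\
      forall i, (i < j)%N -> iter i f x \notin A.
    have [|j xj jmin] := @first_nat (fun j => iter j f x \in A).
      apply: contrapT => h; apply: xn => i _; apply/negP => xi; apply: h.
      by exists i.
    exists j => //; rewrite leqNgt; apply/negP => nj; apply: xn => i i_n; apply: jmin.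
    exact: leq_ltn_trans nj.
  have gj := avoids_gder Xx jmin.
  have [r1 r10 hr1] := orbit_local_const Xx jmin.
  have c0 : 0 < (lam ^+ n)^-1 * K1 ^+ (n - j) * gder x j.
    by rewrite !mulr_gt0 ?invr_gt0 ?exprn_gt0.
  have [r2 r20 hr2] := weight_infty xj (divr_gt0 (weight_gt0 x) c0).
  have [r3 r30 hr3] := orbit_near j Xx r20.
  exists (Num.min r1 r3); first by rewrite lt_min r10.
  move=> w Xw; rewrite lt_min => /andP[/hr1[h1 h2] /hr3 h3]; split => // _ wn.
  have wj : iter j f w != iter j f x by apply: contraTneq xj => <-; exact: wn.
  have := hr2 _ wj h3; rewrite ler_pdivrMr// => h4.
  have wnj : avoids (iter j f w) (n - j) by apply: avoids_iter; rewrite subnKC.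
  have h5 := weight_steps K10 hK1 (X_iter j Xw) wnj.
  have iE : iter n f w = iter (n - j) f (iter j f w) by rewrite -iterD subnK.
  have gE : gder w n = gder x j * gder (iter j f w) (n - j) by rewrite -h2 -gder_shift subnKC.
  have E5 (l g K u : R) : u * (l * K * g) = l * g * (K * u) by ring.
  have E6 (l g v h : R) : l * (v * (g * h)) = l * g * (v * h) by ring.
  rewrite (le_trans h4)// /scaled iE gE E5 E6 ler_wpM2l//.
  by rewrite mulr_ge0 ?gder_ge0// invr_ge0 exprn_ge0// ltW.
have [r1 r10 hr1] := @seq_radius R _ (iota 0 N) (fun n r => forall w, X w -> absv (w - x) < r ->
    (avoids x n -> avoids w n /\ scaled w n = scaled x n) /\
    (~ avoids x n -> avoids w n -> weight x <= scaled w n))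
  (fun n r r' rr h w Xw wr => h w Xw (lt_le_trans wr (proj2 (andP rr)))) (fun n _ => step n).
exists (Num.min r0 r1); first by rewrite lt_min r00.
move=> w Xw; rewrite lt_min => /andP[/hr0[wA wE _] wr].
have hw n : (n < N)%N -> (avoids x n -> avoids w n /\ scaled w n = scaled x n) /\
    (~ avoids x n -> avoids w n -> weight x <= scaled w n).
  by move=> nN; apply: hr1 => //; rewrite mem_iota.
apply/eqP; rewrite eq_le; apply/andP; split; apply: metric_ge.
- by rewrite -wE metric_le.
- by move=> n nN xn; have [/(_ xn)[wn <-] _] := hw n nN; exact: metric_le_scaled.
- by rewrite wE metric_le.
- move=> n nN wn; have [h1 h2] := hw n nN; have [xn|xn] := pselect (avoids x n).
    by have [_ ->] := h1 xn; exact: metric_le_scaled.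
  by rewrite (le_trans (metric_le x))// h2.
Qed.

End AdaptedMetric.

Lemma eta_le : eta <= 2^-1.
Proof.
rewrite /eta invfM ler_piMr// invf_le1 ?exprn_gt0 ?rdeg_gt0//.
by rewrite exprn_ege1// ler1n (leq_trans _ (dPQ (HPQ := HPQ))).
Qed.

Lemma adapted_metric_exists : exists (g : C -> R) (lam beta c : R),
  [/\ [/\ 1 < lam, 0 < beta < 1, 0 < c & forall z, X z -> c <= g z],
  (forall z, X z -> z \notin A -> g z <= 1 \/
     exists2 a, a \in A & g z <= (absv (z - a) `^ beta)^-1),
  (forall z, X z -> z \notin A -> f z \notin A -> lam * g z <= g (f z) * absv (df z)),
  (forall z, X z -> z \notin A -> exists2 r : R, 0 < r &
     forall w, X w -> absv (w - z) < r -> g w = g z) &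
  (forall a (K0 : R), a \in A -> 0 < K0 -> exists2 r : R, 0 < r &
     forall z, X z -> z != a -> absv (z - a) < r -> K0 <= g z)].
Proof.
have [N N0 Nexp] := uniform_expansion.
pose lam : R := 2 `^ (N%:R)^-1.
have NR : N%:R != 0 :> R by rewrite pnatr_eq0 -lt0n.
have lamN : lam ^+ N = 2 by rewrite -powR_mulrn ?powR_ge0// -powRrM mulVf// powRr1.
have lam1 : 1 < lam.
  rewrite ltNge; apply/negP => l1; have : lam ^+ N <= 1 by rewrite exprn_ile1// powR_ge0.
  by rewrite lamN leNgt ltr1n.
have lamN2 : lam ^+ N <= 2 by rewrite lamN.
have [c c_gt0 hc] := metric_lower N lam1.
exists (metric N lam), lam, (1 - eta), c; split.
- split => //; last by move=> z Xz; rewrite (le_trans _ (hc z Xz))// ler_peMr ?weight_ge1// ltW.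
  by rewrite subr_gt0 gtrBl eta_gt0 andbT (le_lt_trans eta_le)// invf_lt1// ltr1n.
- move=> z Xz zA; have [h|[a aA h]] := weight_le zA; [left|right; exists a => //].
    exact: le_trans (metric_le _ _ _) h.
  exact: le_trans (metric_le _ _ _) h.
- exact: (metric_expanding N0 lam1 lamN2 Nexp).
- by move=> z Xz zA; exact: metric_local_const.
- move=> a K0 aA K00; have [r r0 hr] := weight_infty aA (divr_gt0 K00 c_gt0).
  exists r => // z Xz za zr; rewrite (le_trans _ (hc z Xz))// mulrC -ler_pdivrMr//.
  exact: hr.
Qed.

End Weight.

(** * Extension of a metric from a closed set to a disc *)

Section Extension.
Context {R : realType} {C : closedFieldType} {absv : C -> R} {p : nat}.
Context {HC : padic_field absv p}.
Implicit Types (a b c x y z w : C) (r e : R).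

Variables (X : set C) (zs : seq C) (M B beta c0 : R) (z0 : C) (g : C -> \bar R).
Hypotheses (zsX : forall x, x \in zs -> X x) (z0s : z0 \in zs).
Hypotheses (M0 : 0 < M) (XM : forall x, X x -> absv x <= M) (Xclosed : closed_set absv X).
Hypotheses (B0 : 0 < B) (beta0 : 0 < beta) (c00 : 0 < c0).

Definition poles z : R := \sum_(y <- zs) B / absv (z - y) `^ beta.

Hypotheses (gc0 : forall x, X x -> (c0%:E <= g x)%E) (gX : econt_on absv X g).
Hypothesis gpoles : forall x, X x -> x \notin zs -> (g x <= (poles x)%:E)%E.

Lemma pole_ge0 z y : 0 <= B / absv (z - y) `^ beta.
Proof. by rewrite divr_ge0 ?powR_ge0// ltW. Qed.

Lemma poles_ge z y : y \in zs -> B / absv (z - y) `^ beta <= poles z.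
Proof.
by move=> yz; rewrite /poles (big_rem y)//= lerDl sumr_ge0// => x _; exact: pole_ge0.
Qed.

Lemma poles_lower : exists2 c : R, 0 < c & forall z, absv z <= M -> z \notin zs -> c <= poles z.
Proof.
exists (B / M `^ beta); first by rewrite divr_gt0 ?powR_gt0.
move=> z zM zz; rewrite (le_trans _ (poles_ge z z0s))// ler_wpM2l ?(ltW B0)//.
have zz0 : 0 < absv (z - z0).
  by rewrite abs_gt0 subr_eq0; apply: contraNneq zz => ->.
rewrite lef_pV2 ?posrE ?powR_gt0//; apply: ge0_ler_powR; rewrite ?nnegrE ?(ltW beta0) ?(ltW zz0) ?(ltW M0)//.
by rewrite absB_le// XM//; exact: zsX.
Qed.

Lemma poles_infty x (K0 : R) : x \in zs -> exists2 r : R, 0 < r &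
  forall z, z != x -> absv (z - x) < r -> K0 < poles z.
Proof.
move=> xz; have K1 : 0 < `|K0| + 1 by rewrite ltr_wpDl.
exists ((B / (`|K0| + 1)) `^ beta^-1); first by rewrite powR_gt0// divr_gt0.
move=> z zx zr; have zx0 : 0 < absv (z - x) by rewrite abs_gt0 subr_eq0.
rewrite (lt_le_trans _ (poles_ge z xz))// (@lt_le_trans _ _ (`|K0| + 1))//.
  by rewrite (le_lt_trans (ler_norm _))// ltrDl.
rewrite ler_pdivlMr ?powR_gt0// mulrC -ler_pdivlMr//.
have -> : B / (`|K0| + 1) = ((B / (`|K0| + 1)) `^ beta^-1) `^ beta.
  by rewrite -powRrM mulVf ?gt_eqF// powRr1// divr_ge0 ?ltW.
by apply: ge0_ler_powR; rewrite ?nnegrE ?powR_ge0// ltW.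
Qed.

Lemma poles_const z : z \notin zs -> exists2 r : R, 0 < r &
  forall w, absv (w - z) < r -> w \notin zs /\ poles w = poles z.
Proof.
move=> zz; have [r r0 hr] := seq_separated (HC := HC) z zs; exists r => // w wz.
have sep y : y \in zs -> r < absv (z - y).
  by move=> yz; apply: hr => //; apply: contraNneq zz => <-.
split.
  apply: contraL wz => wz; rewrite -leNgt absC ltW// sep//.
rewrite /poles big_seq [RHS]big_seq; apply: eq_bigr => y yz.
rewrite (_ : w - y = (z - y) + (w - z)); last by ring.
by rewrite absDl// (lt_trans wz) ?sep.
Qed.

(* A point of [X] almost nearest to [z], chosen through the set of all such points so that it
   does not change when [z] moves by less than its distance to [X]. *)
Definition nearest z : set C := [set x | X x /\ forall y, X y -> absv (z - x) <= 2 * absv (z - y)].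
Definition proj z : C := if `[< X z >] then z else xget z0 (nearest z).

Lemma nearest_exists z : ~ X z -> exists x, nearest z x.
Proof.
move=> nX; have [r r0 hr] := closed_dist Xclosed nX; apply: contrapT => h.
have X0 : X z0 by exact: zsX.
have next n : exists2 x, X x & absv (z - x) <= absv (z - z0) / 2 ^+ n.
  elim: n => [|n [x Xx xn]]; first by exists z0 => //; rewrite expr0 divr1.
  apply: contrapT => h'; apply: h; exists x; split => // y Xy.
  rewrite leNgt; apply/negP => yx; apply: h'; exists y => //.
  by rewrite exprS invfM mulrCA ler_pdivlMl// (le_trans (ltW yx)).
have [N hN] := half_exp_small (absv (z - z0)) r0; have [x Xx xN] := next N.
by have := hr x Xx; rewrite leNgt (le_lt_trans xN).
Qed.

Lemma proj_near w x : X x -> X (proj w) /\ absv (proj w - x) <= 2 * absv (w - x).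
Proof.
move=> Xx; rewrite /proj; case: ifPn => [/asboolP Xw|/asboolPn nX].
  by split => //; rewrite ler_peMl// ler1n.
have [Xp pw] := xgetPex z0 (nearest_exists nX); split => //.
apply: (abs_tri_le (y := w)); first by rewrite absC pw.
by rewrite ler_peMl// ler1n.
Qed.

Lemma proj_const z : ~ X z -> exists2 r : R, 0 < r & forall w, absv (w - z) < r ->
  ~ X w /\ proj w = proj z.
Proof.
move=> nX; have [r r0 hr] := closed_dist Xclosed nX; exists r => // w wz.
have nXw : ~ X w by move=> /hr; rewrite absC leNgt wz.
split => //; rewrite /proj; case: ifPn => [/asboolP//|_]; case: ifPn => [/asboolP//|_].
congr xget; apply/predeqP => x.
have E y : X y -> absv (w - y) = absv (z - y).
  move=> Xy; rewrite (_ : w - y = (z - y) + (w - z)); last by ring.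
  by rewrite absDl// (lt_le_trans wz)// hr.
by split=> -[Xx h]; split => // y Xy; have := h y Xy; rewrite !E.
Qed.

(** The truncation gives the upper bound of admissibility off [zs] and changes nothing on [X], by
    [gpoles]. At a point of [zs] the formula for [poles] loses its infinite term to the convention
    on division, so [g] is taken directly. *)
Definition extension z : \bar R :=
  if z \in zs then g z else Order.min (g (proj z)) (poles z)%:E.

Lemma extensionE x : X x -> extension x = g x.
Proof.
move=> Xx; rewrite /extension; case: ifPn => // xz.
by rewrite /proj asboolT// min_l// gpoles.
Qed.

Lemma extension_near x d : X x -> 0 < d -> exists2 r : R, 0 < r & forall w, absv (w - x) < r ->
  X (proj w) /\ absv (proj w - x) < d.
Proof.
move=> Xx d0; exists (d / 2); first by rewrite divr_gt0.
move=> w wx; have [Xp h] := proj_near w Xx; split => //.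
by rewrite (le_lt_trans h)// mulrC -ltr_pdivlMr.
Qed.

Lemma extension_cont : econt_on absv [set z | absv z <= M] extension.
Proof.
have ubound (m b : \bar R) (e : R) : (e%:E < m)%E -> (e%:E < b)%E -> (e%:E < Order.min m b)%E.
  by rewrite lt_min => -> ->.
move=> z zM; have [Xz|nX] := pselect (X z); last first.
  have zz : z \notin zs by apply/negP => /zsX.
  have [r1 r10 hr1] := poles_const zz; have [r2 r20 hr2] := proj_const nX.
  have r0 : 0 < Num.min r1 r2 by rewrite lt_min r10.
  have E w : absv (w - z) < Num.min r1 r2 -> extension w = extension z.
    rewrite lt_min => /andP[/hr1[wz wS] /hr2[nXw wp]].
    by rewrite /extension (negPf wz) (negPf zz) wS wp.
  case F : (extension z) => [m| |] t.
  - move=> t0; exists (Num.min r1 r2) => // w _ /E ->; rewrite F !lte_fin.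
    by rewrite ltrBlDr ltrDl.
  - by exists (Num.min r1 r2) => // w _ /E ->; rewrite F ltry.
  - by exists (Num.min r1 r2) => // w _ /E ->; rewrite F ltNyr.
rewrite extensionE//; have := gX Xz; have := gc0 Xz.
case F : (g z) => [m| |]; last by rewrite leeNy_eq.
- move=> _ cont e e0; have [d d0 hd] := cont e e0.
  have [r r0 hr] := extension_near Xz d0.
  (* An exceptional point may carry a finite value of [g]. Near it [poles] is large, so the lower
     estimate comes from [g] alone. *)
  have [zz|zz] := boolP (z \in zs).
    have [r1 r10 hr1] := poles_infty m zz.
    exists (Num.min r r1); first by rewrite lt_min r0.
    move=> w _; rewrite lt_min => /andP[/hr[Xp pd] wr1].
    have [h1 h2] := hd _ Xp pd; have [wX|wz] := pselect (X w).
      by rewrite extensionE//; move: h1 h2; rewrite /proj asboolT.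
    have wzs : w \notin zs by apply/negP => /zsX.
    rewrite /extension (negPf wzs); split; last by rewrite gt_min h2.
    apply: ubound => //; rewrite lte_fin (@lt_trans _ _ m) ?ltrBlDr ?ltrDl//.
    by apply: hr1 => //; apply: contra_notN wz => /eqP ->.
  have [r1 r10 hr1] := poles_const zz.
  exists (Num.min r r1); first by rewrite lt_min r0.
  move=> w _; rewrite lt_min => /andP[/hr[Xp pd] /hr1[wz wS]].
  have [h1 h2] := hd _ Xp pd; rewrite /extension (negPf wz) wS; split; last by rewrite gt_min h2.
  apply: ubound => //; have := gpoles Xz zz; rewrite F lee_fin => h3.
  by rewrite lte_fin (lt_le_trans _ h3)// ltrBlDr ltrDl.
- move=> _ cont K0; have [d d0 hd] := cont K0.
  have zz : z \in zs by apply: contraT => /(gpoles Xz); rewrite F leye_eq.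
  have [r r0 hr] := extension_near Xz d0; have [r1 r10 hr1] := poles_infty K0 zz.
  exists (Num.min r r1); first by rewrite lt_min r0.
  move=> w _; rewrite lt_min => /andP[/hr[Xp pd] wr1].
  have h1 := hd _ Xp pd; have [wX|wX] := pselect (X w).
    by rewrite extensionE//; move: h1; rewrite /proj asboolT.
  have wzs : w \notin zs by apply/negP => /zsX.
  rewrite /extension (negPf wzs); apply: ubound => //; rewrite lte_fin.
  by apply: hr1 => //; apply: contra_notN wX => /eqP ->.
Qed.

Lemma extension_lower : exists2 c : R, 0 < c & forall z, absv z <= M -> (c%:E <= extension z)%E.
Proof.
have [c c_gt0 hc] := poles_lower.
have m0 : 0 < Num.min c0 c by rewrite lt_min c00.
exists (Num.min c0 c) => // z zM; rewrite /extension; case: ifPn => zz.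
  by rewrite (le_trans _ (gc0 (zsX zz)))// lee_fin ge_min lexx.
rewrite le_min lee_fin; apply/andP; split; last by rewrite ge_min hc ?orbT.
have [Xp _] := proj_near z (zsX z0s).
by rewrite (le_trans _ (gc0 Xp))// lee_fin ge_min lexx.
Qed.

Lemma extension_upper z : z \notin zs -> (extension z <= (poles z)%:E)%E.
Proof. by move=> zz; rewrite /extension (negPf zz) ge_min lexx orbT. Qed.

Lemma extension_exists : exists rho : C -> \bar R,
  [/\ econt_on absv [set z | absv z <= M] rho,
  (exists2 c : R, 0 < c & forall z, absv z <= M -> (c%:E <= rho z)%E),
  (forall x, X x -> rho x = g x) &
  (forall z, z \notin zs -> (rho z <= (poles z)%:E)%E)].
Proof.
exists extension; split; [exact: extension_cont|exact: extension_lower|exact: extensionE|].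
exact: extension_upper.
Qed.

End Extension.

(** * The admissible metric on the Julia points of a finite extension *)

Section Sufficiency.
Context {R : realType} {C : closedFieldType} {absv : C -> R} {p : nat}.
Context {HC : padic_field absv p}.
Context {P Q : {poly C}} {HPQ : good_map P Q}.
Variable G : region absv P Q.
Implicit Types (a b c x y z w : C) (r e : R).
Notation f := (ratf P Q).
Notation Julia := (Julia absv P Q).

Hypothesis JG : forall z, Julia setT (Some z) -> inG G z /\ Julia setT (Some (f z)).
Hypothesis sub : forall c, c \in crits P Q -> Julia setT (Some c) -> preperiodic P Q c.

Variable F : set C.
Hypotheses (FE : finite_ext_Qp absv F) (FP : poly_over F P) (FQ : poly_over F Q).

Let X := [set z | F z /\ Julia setT (Some z)].
Let FF : is_subfield F. Proof. by case: FE. Qed.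

Lemma Julia_points_closed : closed_set absv X.
Proof.
move=> x h; split.
  apply: (finite_ext_loc_compact (HC := HC) FE).1 => e e0.
  by have [y [Fy _] xy] := h e e0; exists y.
split => // xF; have [r r0 hr] := Fatou_open (HC := HC) xF.
have [y [_ [_ yJ]] xy] := h r r0; apply: yJ; apply: hr.
by rewrite absC.
Qed.

Lemma Julia_points_compact : disc_compact absv X.
Proof.
apply: closed_tot_bounded_compact; first exact: Julia_points_closed.
have [_ tF] := finite_ext_loc_compact (HC := HC) FE.
by apply: tot_bounded_subset (tF (regM G)) => x [Fx /JG[[xM _] _]].
Qed.

(** Treated apart because the extension needs a point of [X] as exceptional point; here the empty
    domain makes all conditions vacuous. *)
Lemma expanding_admissible_empty : (forall z, ~ X z) -> expanding_admissible absv P Q F.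
Proof.
move=> X0; exists set0, (fun=> 0%E), [::]; split.
  split=> //.
  - by split => // z Fz Jz; case: (X0 z).
  - by exists 1.
  - by exists 1, 2^-1; split; rewrite ?invf_lt1 ?ltr1n.
exists 2; first by rewrite ltr1n.
by move=> z w [Fz zF]; case: (X0 z); split => //; exact: Julia_extend (conj Fz zF).
Qed.

Lemma singular_orbits : exists (A : seq C) eA, [/\
  (forall a, a \in A -> X a), (forall a, a \in A -> f a \in A),
  [/\ 0 < eA, eA <= regd G & (forall a, a \in A -> normal_at absv P Q a eA)],
  (forall a c, a \in A -> c \in crits P Q -> c != a -> eA < absv (a - c)) &
  (forall a b, a \in A -> b \in A -> b != a -> eA < absv (a - b)) /\
  (forall x c, X x -> c \in crits P Q -> absv (x - c) < eA -> c \in A)].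
Proof.
pose s := [seq c <- crits P Q | `[< X c >]].
have [|A [sA Af As]] := @preperiodic_orbits _ P Q s.
  by move=> c; rewrite mem_filter => /andP[/asboolP[_ cJ] cc]; exact: sub.
have AX a : a \in A -> X a.
  move=> /As[r]; rewrite mem_filter => /andP[/asboolP[Fr rJ] _] [n ->]; split.
    exact: sub_iter_ratf.
  exact: (Julia_orbit JG n rJ).
have [e1 e10 he1] : exists2 e, 0 < e & forall a, a \in A -> normal_at absv P Q a e.
  apply: (@seq_radius _ _ A (fun a e => normal_at absv P Q a e)).
    by move=> a e e' /andP[_ ee]; exact: normal_le.
  move=> a /AX[_ /JG[aG _]]; have [e /andP[e0 _] he] := normal_exists (HC := HC) (HPQ := HPQ) aG.
  by exists e.
have [e2 e20 he2] : exists2 e, 0 < e & forall a, a \in A ->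
    forall b, b \in crits P Q ++ A -> b != a -> e < absv (a - b).
  apply: (@seq_radius _ _ A (fun a e => forall b, b \in crits P Q ++ A -> b != a -> e < absv (a - b))).
    by move=> a e e' /andP[_ ee] h b bb ba; rewrite (le_lt_trans ee)// h.
  by move=> a _; exact: seq_separated.
(* A critical point outside [X] is at positive distance from the closed set [X]; one in [X] belongs
   to [A]. *)
have [e3 e30 he3] : exists2 e, 0 < e & forall c, c \in crits P Q ->
    forall x, X x -> c \notin A -> e <= absv (x - c).
  apply: (@seq_radius _ _ (crits P Q) (fun c e => forall x, X x -> c \notin A -> e <= absv (x - c))).
    by move=> c e e' /andP[_ ee] h x Xx cA; rewrite (le_trans ee)// h.
  move=> c cc; have [Xc|Xc] := pselect (X c).
    by exists 1 => // x _; rewrite sA// mem_filter cc andbT; exact/asboolP.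
  have [r r0 hr] := closed_dist Julia_points_closed Xc; exists r => // x Xx _.
  by rewrite absC hr.
pose eA := Num.min (regd G) (Num.min e1 (Num.min e2 e3)).
have [eAd eA1 eA2 eA3] : [/\ eA <= regd G, eA <= e1, eA <= e2 & eA <= e3].
  by split; rewrite !ge_min lexx ?orbT.
exists A, eA; split => //.
- split => //; first by rewrite !lt_min regd0 e10 e20.
  by move=> a /he1; exact: normal_le.
- by move=> a c aA cc ca; rewrite (le_lt_trans eA2)// he2// mem_cat cc.
split.
- by move=> a b aA bA ba; rewrite (le_lt_trans eA2)// he2// mem_cat bA orbT.
- move=> x c Xx cc; apply: contraTT => cA; rewrite -leNgt (le_trans eA3)//.
  exact: he3.
Qed.

Lemma subhyperbolic_expanding : expanding_admissible absv P Q F.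
Proof.
have [[x0 Xx0]|/forallNP] := pselect (exists x, X x); last exact: expanding_admissible_empty.
have Xf x : X x -> X (f x).
  by move=> [Fx xJ]; split; [exact: sub_ratf|case: (JG xJ)].
have XE x : X x -> expansive G x by move=> [_ xJ]; exact: Julia_expansive.
have [A [eA [AX Af [eA0 eAd Anormal] Acrit [Asep Xcrit]]]] := singular_orbits.
have [m [lam [beta [c [[lam1 /andP[beta0 beta1] c0 mc] mle mexp mloc minf]]]]] :=
  adapted_metric_exists Xf XE AX Af eA0 eAd Anormal Acrit Asep Xcrit Julia_points_compact.
have M1 := regM1 G; have M0 : 0 < regM G by exact: regM0.
have XM x : X x -> absv x <= regM G by move=> [_ /JG[[]]].
(* Far from [A] the metric is only known to be at most 1. The term of [x0] with [B = M] dominates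
   it: two points of [X] are at distance at most [M], and [M ^ beta <= M] because [M >= 1]. *)
pose zs := x0 :: A; pose g z : \bar R := if z \in A then +oo%E else (m z)%:E.
have zsX x : x \in zs -> X x by rewrite in_cons => /orP[/eqP ->|/AX].
have gc x : X x -> (c%:E <= g x)%E.
  by move=> Xx; rewrite /g; case: ifP => _; rewrite ?leey// lee_fin mc.
have gX : econt_on absv X g.
  move=> z Xz; rewrite {1}/g; have [zA|zA] := boolP (z \in A).
    move=> K0; have K1 : 0 < `|K0| + 1 by rewrite ltr_wpDl.
    have [r r0 hr] := minf z _ zA K1; exists r => // w Xw wz; rewrite /g.
    have [wA|wA] := boolP (w \in A); first by rewrite ltry.
    rewrite lte_fin (@lt_le_trans _ _ (`|K0| + 1))//.
      by rewrite (le_lt_trans (ler_norm _))// ltrDl.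
    by apply: hr => //; apply: contraNneq wA => ->.
  move=> e e0; have [r r0 hr] := mloc z Xz zA.
  have [r1 r10 hr1] := seq_separated (HC := HC) z A.
  exists (Num.min r r1); first by rewrite lt_min r0.
  move=> w Xw; rewrite lt_min => /andP[wr wr1].
  have wA : w \notin A.
    apply: contraL wr1 => wA; rewrite -leNgt absC ltW// hr1//.
    by apply: contraNneq zA => <-.
  by rewrite /g (negPf wA) (hr w Xw wr) !lte_fin ltrBlDr ltrDl.
have x0zs : x0 \in zs by exact: mem_head.
have pos x : x \notin zs -> forall y, y \in zs -> 0 < absv (x - y).
  by move=> xz y yz; rewrite abs_gt0 subr_eq0; apply: contraNneq xz => ->.
have gp x : X x -> x \notin zs -> (g x <= (poles (absv := absv) zs (regM G) beta x)%:E)%E.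
  move=> Xx xz; have xA : x \notin A by apply: contra xz => xA; rewrite in_cons xA orbT.
  rewrite /g (negPf xA) lee_fin; have [h|[a aA h]] := mle x Xx xA.
    rewrite (le_trans h)// (le_trans _ (poles_ge _ M0 x x0zs))//.
    rewrite ler_pdivlMr ?powR_gt0 ?pos// mul1r.
    rewrite (@le_trans _ _ (regM G `^ beta))//; last by rewrite ler1_powR// ltW.
    apply: ge0_ler_powR; rewrite ?nnegrE ?(ltW beta0) ?(ltW M0)//.
    by rewrite absB_le ?XM.
  have azs : a \in zs by rewrite in_cons aA orbT.
  rewrite (le_trans h)// (le_trans _ (poles_ge _ M0 x azs))//.
  by rewrite ler_peMl// invr_ge0 powR_ge0.
have [rho [rcont rlow rE rup]] := extension_exists zsX x0zs M0 XM Julia_points_closed M0 beta0 c0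
  gc gX gp.
exists [set z | absv z <= regM G], rho, zs; split.
  split.
  - split => //.
      move=> z zM; exists (regM G) => // w wz; rewrite /= -(subrK z w) absD_le//.
      exact: ltW.
    by move=> z Fz zJ; apply: XM; split.
  - exact: rlow.
  - by move=> z /zsX[].
  - by move=> z _ zoo; apply: contraT => /rup; rewrite zoo leye_eq.
  - by exists (regM G), beta; split => // z _; exact: rup.
exists lam => // z w zJ zw zz wz.
have Xz : X z by split; [case: zJ|exact: Julia_extend zJ].
have Qz : Q.[z] != 0 by case: Xz => _ /JG[zG _]; exact: inG_Q zG.
move: zw wz; rewrite rat_evalE// => -[<-] fzz.
have nA x : x \notin zs -> x \notin A by apply: contra => xA; rewrite in_cons xA orbT.
rewrite !rE//; last exact: Xf.
rewrite /g (negPf (nA _ zz)) (negPf (nA _ fzz)) -!EFinM lee_fin.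
by apply: mexp => //; exact: nA.
Qed.

End Sufficiency.

Theorem theorem1p3 (R : realType) (p : nat) (C : closedFieldType) (absv : C -> R)
  (hp : prime p) (HC : is_Cp absv p)
  (K : set C) (HK : finite_ext_Qp absv K)
  (P Q : {poly C}) (Hphi : is_ratmap K P Q) (Hdeg : (2 <= rdeg P Q)%N)
  (Hinf : Fatou absv P Q setT None) :
  subhyperbolic absv P Q <->
  (forall L : set C, finite_ext_Qp absv L -> K `<=` L ->
     expanding_admissible absv P Q L).
Proof.
have [PQ KP KQ] := Hphi.
have HC' : padic_field absv p by split.
have HPQ : good_map P Q by split.
have [G JG] := Julia_region Hinf.
have Jfin c : Julia absv P Q setT (Some c) -> Q.[c] != 0 /\
    (eventually_periodic P Q (Some c) <-> preperiodic P Q c).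
  move=> cJ; have Qn n : Q.[iter n (ratf P Q) c] != 0.
    by case: (JG _ (Julia_orbit JG n cJ)) => cG _; exact: inG_Q cG.
  by split; [exact: (Qn 0%N)|exact: preperiodicP].
split=> [sub L LE KL|hexp [c|] cc cJ].
- apply: (subhyperbolic_expanding JG _ LE (poly_over_sub KL KP) (poly_over_sub KL KQ)) => c cc cJ.
  have [Qc E] := Jfin c cJ; apply/E; apply: sub cJ.
  by rewrite /= /crit_fin Qc -critsP.
- have [Qc E] := Jfin c cJ; apply/E.
  apply: (expanding_subhyperbolic JG HK KP KQ hexp _ cJ).
  by move: cc; rewrite /= /crit_fin Qc critsP.
(* The remaining critical point is infinity, a Fatou point by hypothesis. *)
- by case: cJ => _.
Qed.
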